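(* Let $B\subset\mathbb{R}^2$ be a symmetric oval and let $F\subset\mathbb{R}^2$ be a regular closed topological disk whose boundary has positive reach $r(\partial F)$ with respect to $d_B$, having $c(F)$ convex pieces and $d(F)$ concave pieces. Then for every $\lambda>0$ with $2\lambda<r(\partial F)$ $$p_B(\partial F)-2\lambda\bigl(2c(F)+p_B(\partial B)\,d(F)+3d(F)\bigr)\le 2\lambda N_\lambda(F,B)\le p_B(\partial F)+2\lambda\,p_B(\partial B).$$
   Context: A symmetric oval $B\subset\mathbb{R}^2$ is a compact convex set with non-empty interior, symmetric about its center. $\|\cdot\|_B$ is the norm on $\mathbb{R}^2$ with unit ball $B$ (centered at the origin), $d_B(x,y)=\|x-y\|_B$, and $p_B(\gamma)$ is the length of a curve $\gamma$ in this norm. $F$ is regular if $\partial F$ is the union of finitely many (maximal) arcs, called pieces, overlapping only at endpoints, each of which is either convex or concave. Here an arc of $\partial F$ is convex if it is contained in the boundary of a convex region lying locally on the same side of the arc as $F$, and concave if it is contained in the boundary of a convex region lying locally on the side of the arc opposite to $F$. $c(F)$ and $d(F)$ are the numbers of convex, respectively concave, pieces in this decomposition. The reach $r(A)\in[0,\infty]$ of a closed set $A\subset\mathbb{R}^2$ is the largest $\varepsilon$ (possibly $\infty$) such that each point $x$ with $d_B(x,A)<\varepsilon$ has a unique point of $A$ realizing the distance $d_B(x,A)$; positive reach means $r(A)>0$. For $\lambda>0$ let $A_{F,B,\lambda}$ be the family of all sets homothetic to $B$ in the ratio $\lambda$ (translates of $\lambda B$) which have at least one point in common with $F$ and have only boundary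 points in common with $F$. $N_\lambda(F,B)$ is the greatest integer $k$ such that $A_{F,B,\lambda}$ contains $k$ sets with pairwise disjoint interiors. *)

(* Defs.v *)
(* MathComp-Analysis; the plane is 'rV[R]_2 over an arbitrary R : realType. *)
From HB Require Import structures.
From mathcomp Require Export all_boot all_order all_algebra.
From mathcomp Require Export all_classical all_reals all_analysis.
Export Order.TTheory GRing.Theory Num.Theory numFieldNormedType.Exports.

Set Implicit Arguments.
Unset Strict Implicit.
Unset Printing Implicit Defensive.

Local Open Scope classical_set_scope.
Local Open Scope ring_scope.

Notation plane R := 'rV[R]_2.

Definition boundary {T : topologicalType} (A : set T) : set T :=
  closure A `\` interior A.

Section MinkowskiPlane.
Context {R : realType}.
Implicit Types (x y z : plane R) (A B C F K : set (plane R)).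
Implicit Types (g : R -> plane R) (lambda : R).

Definition convex_region K : Prop :=
  convex_set (K : set (convex_lmodType (plane R))) /\ interior K !=set0.

(* z is the center of B *)
Definition symmetric_oval z B : Prop :=
  [/\ compact B, convex_region B & forall x, B x -> B (z *+ 2 - x)].

(* The gauge of B - z. *)
Definition normB z B x : R := inf [set t | 0 < t /\ B (z + t^-1 *: x)].

Definition distB z B x y : R := normB z B (x - y).

Definition dist_setB z B x A : R := inf [set distB z B x a | a in A].

(* The condition on e is inherited by smaller values and by suprema, so that
   the supremum is attained. *)
Definition reach z B A : \bar R :=
  ereal_sup [set e : \bar R | (0 <= e)%E /\
    forall x, ((dist_setB z B x A)%:E < e)%E ->
      exists! a, A a /\ distB z B x a = dist_setB z B x A].

Definition lengthB z B g : \bar R :=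
  ereal_sup [set (\sum_(0 <= n < size s)
                    distB z B (g (nth 1 (0 :: s) n.+1))
                              (g (nth 1 (0 :: s) n)))%:E
            | s in itv_partition 0 1].

(* The image of [0, 1] by g. *)
Definition trace g : set (plane R) := g @` `[0, 1].

Definition endpoints g : set (plane R) := [set g 0; g 1].

(* A simple arc, or a simple closed curve when g 0 = g 1: the boundary of a
   convex disk is a single convex piece. *)
Definition is_arc g : Prop :=
  {within `[0, 1], continuous g} /\
  {in `[0, 1] &, forall s t, s < t -> g s = g t -> s = 0 /\ t = 1}.

Definition simple_closed_param g C : Prop :=
  [/\ is_arc g, g 0 = g 1 & trace g = C].

Definition closed_unit_disk : set (plane R) :=
  [set x | x 0 0 ^+ 2 + x 0 1 ^+ 2 <= 1].

Definition closed_topological_disk F : Prop :=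
  exists f h : plane R -> plane R,
    [/\ set_bij closed_unit_disk F f,
        {in closed_unit_disk, cancel f h},
        {within closed_unit_disk, continuous f} &
        {within F, continuous h}].

(* At a point of an arc of the boundary of F other than its endpoints, the two
   local sides of the arc are interior F (the side of F) and ~` F (the opposite
   side); the region bounded by the arc lies on the side with which its interior
   coincides near that point. *)
Definition convex_arc F g : Prop :=
  [/\ is_arc g, trace g `<=` boundary F &
    exists K, [/\ convex_region K, trace g `<=` boundary K &
      forall t, 0 < t < 1 ->
        \forall y \near g t, interior K y <-> interior F y]].

Definition concave_arc F g : Prop :=
  [/\ is_arc g, trace g `<=` boundary F &
    exists K, [/\ convex_region K, trace g `<=` boundary K &
      forall t, 0 < t < 1 -> \forall y \near g t, interior K y <-> ~ F y]].

(* Indices inl i are the convex pieces and inr j the concave ones. Inclusion-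
   maximal convex or concave arcs usually overlap, so maximality is that of the
   decomposition: no two pieces together form a convex or a concave arc. *)
Definition regular_pieces F (c d : nat) (g : 'I_c + 'I_d -> R -> plane R) :
    Prop :=
  [/\ boundary F = \bigcup_i trace (g i),
      forall i, convex_arc F (g (inl i)),
      forall j, concave_arc F (g (inr j)),
      forall i j, i <> j ->
        trace (g i) `&` trace (g j) `<=` endpoints (g i) `&` endpoints (g j) &
      forall i j, i <> j -> ~ exists h,
        trace h = trace (g i) `|` trace (g j) /\
        (convex_arc F h \/ concave_arc F h)].

Definition regular F (c d : nat) : Prop :=
  exists g : 'I_c + 'I_d -> R -> plane R, regular_pieces F g.

Definition touching_homothets F B lambda : set (set (plane R)) :=
  [set S | [/\ exists v, S = [set v + lambda *: b | b in B],
               S `&` F !=set0 &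
               S `&` F `<=` boundary S `&` boundary F]].

Definition packable F B lambda (k : nat) : Prop :=
  exists S : 'I_k -> set (plane R),
    (forall i, touching_homothets F B lambda (S i)) /\
    trivIset setT (fun i => interior (S i)).

(* N is the greatest k for which k such homothets can be packed *)
Definition is_packing_number F B lambda (N : nat) : Prop :=
  packable F B lambda N /\ forall k, packable F B lambda k -> (k <= N)%N.

End MinkowskiPlane.

(* Main.v *)
(* Let r > 2 lambda be below the reach. Nearest points on the boundary of F are then unique within
   r, and the boundary has a continuous field u of unit outer normals along a periodic parametrization a.
   The homothets of B that touch F are the balls of radius lambda centered on the outer curve
   w = a + lambda u, and their interiors are disjoint iff the centers are 2 lambda-separated.

   Lower bound: from a joint of two pieces, walk along w and mark the first exit from the ball of
   radius 2 lambda around the last mark. Between consecutive marks, the normals through the chord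
   of length 2 lambda sweep the boundary arc, so this arc lies under a path X = a + sigma u of length
   2 lambda with 0 <= sigma <= 2 lambda. Along a convex piece, norming functionals show that a is at
   most 2 lambda longer than X; along a concave piece, the norm is compared with a zonotope norm and
   every functional of the zonotope changes monotonicity at most twice on the piece.

   Upper bound: a polygon inscribed in w has at most the length of a plus lambda times the perimeter of
   B. With a zonotope norm this reduces to one functional D, whose extrema along w occur where
   u is extreme for D; the excess is the signed number of half turns of the direction of w, which
   Hopf's argument bounds by 2. *)
Require Import Defs.
From mathcomp Require Import ring lra zify.

Set Implicit Arguments.
Unset Strict Implicit.
Unset Printing Implicit Defensive.

Local Open Scope classical_set_scope.
Local Open Scope ring_scope.

(** * Norms and functionals on the plane *)

(** The curves need have no tangents and the norm may be neither smooth nor strictly convex, so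
    derivatives and angles never occur. Their substitutes are finite: lengths are sums over
    partitions, chords are tested against norming functionals, turning counts signed crossings of
    the kernel of a functional, and the Crofton formula is used only for a zonotope norm that lies
    below the given norm and equals it on the edges of one polygon.

    The Jordan curve theorem is avoided as well: the sides of the boundary are those of F, because a
    segment leading into F from outside meets the boundary, and the two arcs between a pair of
    points are told apart by the feet of a moving chord.

    Costs of a piece: k marks inside it leave k + 1 stretches, hence 2 lambda beyond the marks; the
    ends of the path X, both at height lambda, cost 2 lambda more. On a concave piece each
    functional D also pays for its two turns, at heights up to 2 lambda; these payments sum to at
    most 2 lambda times the perimeter of B, because D varies along the boundary of B by at least
    four times its dual norm. *)

Section Vectors.
Context {R : realType}.
Implicit Types (x y u v w f g h : plane R).

(* A vector f also stands for the linear functional dot f. *)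
Definition dot f v : R := f 0 0 * v 0 0 + f 0 1 * v 0 1.
Definition det u v : R := u 0 0 * v 0 1 - u 0 1 * v 0 0.
Definition perp v : plane R := \row_(i < 2) (if i == 0 then - v 0 1 else v 0 0).

Lemma plane_eqP x y : x 0 0 = y 0 0 -> x 0 1 = y 0 1 -> x = y.
Proof.
move=> h0 h1; apply/rowP => i; case: i => -[|[|//]] hi.
  by have -> : Ordinal hi = 0 by apply/val_inj.
by have -> : Ordinal hi = 1 by apply/val_inj.
Qed.

End Vectors.

(* ring and lra reify the whole context, which is slow in long proofs. Unlike clear, move
   leaves the section hypotheses alone, which lra insists on. *)
Ltac drop_props := repeat match goal with
  | H : ?P |- _ => lazymatch type of P with Prop => progress (move: H => _) end
  end.
Ltac drop_irrelevant := repeat match goal with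
  | H : ?P |- _ => lazymatch type of P with Prop => lazymatch P with
      | is_true (Order.le _ _) => fail
      | is_true (Order.lt _ _) => fail
      | @eq (matrix _ _ _) _ _ => progress (move: H => _)
      | @eq _ _ _ => fail
      | _ => progress (move: H => _)
      end end
  end.
Ltac lin := first [solve [drop_irrelevant; lra] | lra].
Ltac vec := drop_props; apply: plane_eqP; rewrite !mxE /=;
  repeat match goal with |- context [fun_of_matrix ?x ?i ?j] => move: (x i j) => ? end; ring.

Section VectorTheory.
Context {R : realType}.
Implicit Types (x y u v w f g h : plane R) (c : R).

Lemma dotDr f v w : dot f (v + w) = dot f v + dot f w.
Proof. rewrite /dot !mxE; ring. Qed.
Lemma dotBr f v w : dot f (v - w) = dot f v - dot f w.
Proof. rewrite /dot !mxE; ring. Qed.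
Lemma dotNr f v : dot f (- v) = - dot f v.
Proof. rewrite /dot !mxE; ring. Qed.
Lemma dotZr f c v : dot f (c *: v) = c * dot f v.
Proof. rewrite /dot !mxE; ring. Qed.
Lemma dotDl f g v : dot (f + g) v = dot f v + dot g v.
Proof. rewrite /dot !mxE; ring. Qed.
Lemma dotBl f g v : dot (f - g) v = dot f v - dot g v.
Proof. rewrite /dot !mxE; ring. Qed.
Lemma dotNl f v : dot (- f) v = - dot f v.
Proof. rewrite /dot !mxE; ring. Qed.
Lemma dotZl f c v : dot (c *: f) v = c * dot f v.
Proof. rewrite /dot !mxE; ring. Qed.
Lemma dot0r f : dot f 0 = 0.
Proof. rewrite /dot !mxE; ring. Qed.
Lemma dot0l f : dot 0 f = 0.
Proof. rewrite /dot !mxE; ring. Qed.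
Lemma detDr f v w : det f (v + w) = det f v + det f w.
Proof. rewrite /det !mxE; ring. Qed.
Lemma detBr f v w : det f (v - w) = det f v - det f w.
Proof. rewrite /det !mxE; ring. Qed.
Lemma detNr f v : det f (- v) = - det f v.
Proof. rewrite /det !mxE; ring. Qed.
Lemma detZr f c v : det f (c *: v) = c * det f v.
Proof. rewrite /det !mxE; ring. Qed.
Lemma detDl f g v : det (f + g) v = det f v + det g v.
Proof. rewrite /det !mxE; ring. Qed.
Lemma detZl f c v : det (c *: f) v = c * det f v.
Proof. rewrite /det !mxE; ring. Qed.
Lemma detNl f v : det (- f) v = - det f v.
Proof. rewrite /det !mxE; ring. Qed.
Lemma detC u v : det u v = - det v u.
Proof. rewrite /det; ring. Qed.
Lemma detxx u : det u u = 0.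
Proof. rewrite /det; ring. Qed.
Lemma dot_perp u v : dot (perp u) v = det u v.
Proof. rewrite /dot /det !mxE /=; ring. Qed.

Lemma dotvv_gt0 v : v != 0 -> 0 < dot v v.
Proof.
move=> v0; have h0 := sqr_ge0 (v 0 0); have h1 := sqr_ge0 (v 0 1).
rewrite lt_neqAle; apply/andP; split; last by rewrite /dot -!expr2 addr_ge0.
apply: contra v0 => /eqP; rewrite /dot -!expr2 => e.
have e0 : v 0 0 ^+ 2 = 0 by lin.
have e1 : v 0 1 ^+ 2 = 0 by lin.
move/eqP: e0; move/eqP: e1; rewrite !sqrf_eq0 => /eqP e1 /eqP e0.
by apply/eqP/plane_eqP; rewrite !mxE.
Qed.

Lemma det_cramer u v w : det u v *: w = det w v *: u + det u w *: v.
Proof. apply: plane_eqP; rewrite /det !mxE; ring. Qed.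

Lemma det_decomp u v w : det u v != 0 ->
  w = (det w v / det u v) *: u + (det u w / det u v) *: v.
Proof.
move=> h; rewrite !(mulrC _ (det u v)^-1) -!scalerA -scalerDr -det_cramer.
by rewrite scalerA mulVf // scale1r.
Qed.

Lemma det_eq0 u v : u != 0 -> det u v = 0 -> exists c, v = c *: u.
Proof.
move=> u0 h; have p := dotvv_gt0 u0.
exists (dot u v / dot u u); have q : dot u u != 0 by rewrite gt_eqF.
apply: (scalerI q); rewrite scalerA mulrCA mulfV // mulr1.
have H : dot u u *: v - dot u v *: u = det u v *: perp u.
  apply: plane_eqP; rewrite /det /dot !mxE /=; ring.
by apply/eqP; rewrite -subr_eq0 H h scale0r.
Qed.

End VectorTheory.

(** A predicate on functions rather than a new normed structure: the topology of the plane stays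
    that of its library norm, and [norm_equiv] carries both definiteness and the comparison of the
    two. *)
Record is_norm {R : realType} (N : plane R -> R) : Prop := IsNorm {
  norm_tri : forall x y, N (x + y) <= N x + N y;
  norm_scale : forall c x, N (c *: x) = `|c| * N x;
  norm_equiv : exists2 C, 0 < C &
    forall x, N x <= C * `|x| /\ `|x| <= C * N x }.

Section Norm.
Context {R : realType} (N : plane R -> R) (hN : is_norm N).
Implicit Types (x y u v w f g h : plane R) (c : R).

Let tri := norm_tri hN.
Let scl := norm_scale hN.

Lemma norm0 : N 0 = 0.
Proof. by rewrite -(scale0r 0) scl normr0 mul0r. Qed.

Lemma normN x : N (- x) = N x.
Proof. by rewrite -scaleN1r scl normrN1 mul1r. Qed.

Lemma normC x y : N (x - y) = N (y - x).
Proof. by rewrite -normN opprB. Qed.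

Lemma norm_ge0 x : 0 <= N x.
Proof. by have := tri x (- x); rewrite normN subrr norm0; lin. Qed.

Lemma norm_eq0 x : N x = 0 -> x = 0.
Proof.
have [C C0 /(_ x)[_]] := norm_equiv hN.
by move=> + e; rewrite e mulr0 normr_le0 => /eqP.
Qed.

Lemma norm_gt0 x : x != 0 -> 0 < N x.
Proof.
move=> x0; rewrite lt_neqAle norm_ge0 andbT eq_sym.
by apply: contra x0 => /eqP /norm_eq0 ->.
Qed.

Lemma norm_triB x y z : N (x - z) <= N (x - y) + N (y - z).
Proof. by have -> : x - z = (x - y) + (y - z) by vec. Qed.

Lemma normB_ge x y : N x - N y <= N (x - y).
Proof. by have := tri (x - y) y; rewrite subrK; lin. Qed.

Lemma normZp c x : 0 <= c -> N (c *: x) = c * N x.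
Proof. by move=> c0; rewrite scl ger0_norm. Qed.

Definition dual_ball f := forall v, dot f v <= N v.

Lemma dual_ball_abs f v : dual_ball f -> `|dot f v| <= N v.
Proof.
by move=> hf; rewrite ler_norml lerNl -dotNr -{1}(normN v) !hf.
Qed.

(** Hahn-Banach in a single step. On the line of [v] the functional is forced; its value [c] on
    [y = perp v] may be any number between the bounds in [lo] and [hi], which the triangle
    inequality [ub] separates. *)
Lemma norming_functional v : exists f, dual_ball f /\ dot f v = N v.
Proof.
have [->|v0] := eqVneq v 0.
  by exists 0; split=> [w|]; rewrite dot0l ?norm0 // norm_ge0.
pose y := perp v.
pose S := [set s * N v - N (s *: v - y) | s in setT].
have ub s s' : s * N v - N (s *: v - y) <= N (s' *: v + y) - s' * N v.
  have := tri (s *: v - y) (s' *: v + y).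
  have -> : s *: v - y + (s' *: v + y) = (s + s') *: v by vec.
  rewrite scl; have := ler_norm (s + s'); have := norm_ge0 v.
  by move=> a b; have := ler_wpM2r a b; lin.
have hS : has_sup S.
  split; first by exists (0 * N v - N (0 *: v - y)); exists 0.
  by exists (N (0 *: v + y) - 0 * N v) => _ [s _ <-].
pose c := sup S.
have lo s : s * N v - N (s *: v - y) <= c.
  by apply: sup_upper_bound => //; exists s.
have hi s : c <= N (s *: v + y) - s * N v.
  by apply: ge_sup; [case: hS|move=> _ [s' _ <-]].
have p := dotvv_gt0 v0; have q : dot v v != 0 by rewrite gt_eqF.
(* [y] is orthogonal to [v] and of the same Euclidean length, so this [f] takes the value [N v] at
   [v] and [c] at [y]. *)
pose f := (dot v v)^-1 *: (N v *: v + c *: y).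
have fv : dot f v = N v.
  rewrite dotZl dotDl !dotZl dot_perp detxx mulr0 addr0 mulrCA mulVf // mulr1 //.
have fy : dot f y = c.
  rewrite dotZl dotDl !dotZl.
  have -> : dot v y = 0 by rewrite /dot !mxE /=; ring.
  have -> : dot y y = dot v v by rewrite /dot !mxE /=; ring.
  by rewrite mulr0 add0r mulrCA mulVf // mulr1.
exists f; split=> // w.
have -> : w = (dot v w / dot v v) *: v + (det v w / dot v v) *: y.
  rewrite !(mulrC _ (dot v v)^-1) -!scalerA -scalerDr.
  apply: (scalerI q); rewrite scalerA mulfV // scale1r.
  apply: plane_eqP; rewrite /det /dot !mxE /=; ring.
move: (dot v w / _) (det v w / _) => s t.
rewrite dotDr !dotZr fv fy.
have [->|t0] := eqVneq t 0.
  rewrite mul0r addr0 scale0r addr0 scl.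
  by apply: ler_wpM2r (ler_norm _); exact: norm_ge0.
have e : s *: v + t *: y = t *: ((s / t) *: v + y).
  by rewrite scalerDr scalerA mulrC divfK.
have e' : s *: v + t *: y = (- t) *: ((- s / t) *: v - y).
  by apply: plane_eqP; rewrite !mxE; field.
have st : s = s / t * t by rewrite divfK.
have [tp|tn] := ltrP 0 t.
  rewrite e scl gtr0_norm // {1}st; move: (hi (s / t)).
  set r := s / t; set A := N (r *: v + y) => hr.
  suff : t * c <= t * (A - r * N v) by lin.
  by rewrite ler_pM2l.
have {}tn : t < 0 by rewrite lt_neqAle t0.
rewrite e' scl gtr0_norm ?oppr_gt0 // {1}st; move: (lo (- s / t)).
rewrite !mulNr; set r := s / t; set A := N (- r *: v - y) => hr.
suff : (- t) * (- r * N v - A) <= (- t) * c by lin.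
by rewrite ler_pM2l ?oppr_gt0 //; lin.
Qed.

End Norm.

(** * Continuity and compactness with explicit radii *)

Section Metric.
Context {R : realType}.

Lemma withinP_eps (V W : normedModType R) (A : set V) (f : V -> W) :
  {within A, continuous f} <->
  forall x, A x -> forall e : R, 0 < e -> exists2 d : R, 0 < d &
    forall y, A y -> `|y - x| < d -> `|f y - f x| < e.
Proof.
split.
  move=> /subspace_continuousP cf x Ax e e0.
  have /cvgrPdist_lt /(_ e e0) := cf x Ax.
  rewrite near_withinE => /nbhs_ballP [d /= d0 hd].
  exists d => // y Ay yx; rewrite distrC; apply: hd => //.
  by rewrite -ball_normE /= distrC.
move=> h; apply/subspace_continuousP => x Ax; apply/cvgrPdist_lt => e e0.
have [d d0 hd] := h x Ax e e0.
rewrite near_withinE; apply/nbhs_ballP; exists d => //= y.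
by rewrite -ball_normE /= distrC => yx Ay; rewrite distrC; exact: hd.
Qed.

Lemma closedP_eps (V : normedModType R) (A : set V) :
  closed A <-> forall x, ~ A x -> exists2 d : R, 0 < d & forall y, `|y - x| < d -> ~ A y.
Proof.
rewrite -openC openE; split.
  move=> h x nAx; have /nbhs_ballP [d /= d0 hd] := h x nAx.
  by exists d => // y yx; apply: hd; rewrite -ball_normE /= distrC.
move=> h x nAx; have [d d0 hd] := h x nAx; apply/nbhs_ballP; exists d => //= y.
by rewrite -ball_normE /= distrC; exact: hd.
Qed.

Lemma compact_positive (V : normedModType R) (K : set V) (f : V -> R) :
  compact K ->
  (forall x, K x -> forall e : R, 0 < e -> exists2 d : R, 0 < d &
    forall y, K y -> `|y - x| < d -> `|f y - f x| < e) ->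
  (forall x, K x -> 0 < f x) -> exists2 m, 0 < m & forall x, K x -> m <= f x.
Proof.
move=> cK cf fp; have [->|/set0P K0] := eqVneq K set0; first by exists 1.
have [|c cA cm] := @compact_EVT_min _ R f K K0 cK; first exact/withinP_eps.
move/set_mem : cA => cA; exists (f c); first exact: fp.
by move=> x Kx; apply: cm; exact: mem_set.
Qed.

(** The substitute for extracting convergent subsequences: the function [f + max 0 (e - g)] is
    positive on [K], and its positive lower bound [m] is the required threshold. *)
Lemma compact_modulus (V : normedModType R) (K : set V) (f g : V -> R) (e : R) : compact K ->
  (forall x, K x -> forall r : R, 0 < r -> exists2 d : R, 0 < d &
    forall y, K y -> `|y - x| < d -> `|f y - f x| < r /\ `|g y - g x| < r) ->
  (forall x, K x -> 0 <= f x) -> (forall x, K x -> f x = 0 -> g x < e) ->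
  exists2 m, 0 < m & forall x, K x -> f x < m -> g x < e.
Proof.
move=> cK cfg f0 fg.
have max0 (p q : R) : `|Num.max 0 p - Num.max 0 q| <= `|p - q|.
  rewrite !maxEle; case: ifP => hp; case: ifP => hq //.
  - by rewrite subr0 ger0_norm // ger0_norm; lin.
  - by rewrite sub0r normrN ger0_norm // ler0_norm; lin.
  - by rewrite subrr normr0.
have [||m m0 hm] := @compact_positive V K (fun x => f x + Num.max 0 (e - g x)) cK.
- move=> x Kx r r0; have r2 : 0 < r / 2 by lin.
  have [d d0 hd] := cfg x Kx _ r2; exists d => // y Ky /(hd y Ky)[h1 h2].
  rewrite opprD addrACA; apply: le_lt_trans (ler_normD _ _) _.
  have := max0 (e - g y) (e - g x).
  have -> : e - g y - (e - g x) = - (g y - g x) by ring.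
  rewrite normrN; lin.
- move=> x Kx; have := f0 x Kx; rewrite le_eqVlt => /orP[/eqP/esym ex|fx].
    by rewrite ex add0r lt_max subr_gt0 fg ?orbT.
  by apply: ltr_wpDr; rewrite // le_max lexx.
exists m => // x Kx fm; rewrite ltNge; apply/negP => h.
by have := hm x Kx; rewrite max_l ?subr_le0 // addr0; lin.
Qed.

Lemma interiorP_eps (V : normedModType R) (A : set V) x :
  interior A x <-> exists2 d : R, 0 < d & forall y, `|y - x| < d -> A y.
Proof.
split.
  move=> /nbhs_ballP [d /= d0 hd].
  by exists d => // y yx; apply: hd; rewrite -ball_normE /= distrC.
case=> d d0 hd; apply/nbhs_ballP; exists d => //= y.
by rewrite -ball_normE /= distrC; exact: hd.
Qed.

Lemma closureP_eps (V : normedModType R) (A : set V) x :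
  closure A x <-> forall d : R, 0 < d -> exists2 y, A y & `|y - x| < d.
Proof.
split.
  move=> cx d d0; have /cx[y [Ay]] : nbhs x (ball x d) by exact: nbhsx_ballx.
  by rewrite -ball_normE /= distrC; exists y.
move=> h B /nbhs_ballP [d /= d0 hd]; have [y Ay yx] := h d d0.
by exists y; split=> //; apply: hd; rewrite -ball_normE /= distrC.
Qed.

Lemma IVT_eps (f : R -> R) (a b v : R) : a <= b ->
  (forall x, a <= x <= b -> forall e, 0 < e -> exists2 d, 0 < d &
    forall y, a <= y <= b -> `|y - x| < d -> `|f y - f x| < e) ->
  f a <= v <= f b \/ f b <= v <= f a -> exists2 c, a <= c <= b & f c = v.
Proof.
move=> ab cf hv.
have [] := @IVT _ f a b v ab.
- apply/withinP_eps => x /=; rewrite in_itv /= => xab e e0.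
  by have [d d0 hd] := cf x xab e e0; exists d => // y /=; rewrite in_itv /=; exact: hd.
- rewrite ge_min le_max; case: hv => /andP[-> ->] //=; by rewrite ?orbT.
- by move=> c; rewrite in_itv /= => hc <-; exists c.
Qed.

End Metric.

Section NormTopology.
Context {R : realType} (N : plane R -> R) (hN : is_norm N).
Implicit Types (x y u v w f g h D : plane R) (c : R).

Lemma norm_to_std e : 0 < e -> exists2 d : R, 0 < d & forall x, N x < d -> `|x| < e.
Proof.
have [C C0 hC] := norm_equiv hN; move=> e0; exists (e / C); first by rewrite divr_gt0.
move=> x; rewrite ltr_pdivlMr // mulrC => h.
by apply: le_lt_trans h; case: (hC x).
Qed.

Lemma std_to_norm e : 0 < e -> exists2 d : R, 0 < d & forall x, `|x| < d -> N x < e.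
Proof.
have [C C0 hC] := norm_equiv hN; move=> e0; exists (e / C); first by rewrite divr_gt0.
move=> x; rewrite ltr_pdivlMr // mulrC => h.
by apply: le_lt_trans h; case: (hC x).
Qed.

Lemma norm_dist x y : `|N x - N y| <= N (x - y).
Proof.
rewrite ler_norml (normB_ge hN) andbT; have := normB_ge hN y x.
by rewrite (normC hN); lin.
Qed.

Lemma norm_dist2 x y x' y' : `|N (x' - y') - N (x - y)| <= N (x' - x) + N (y' - y).
Proof.
apply: le_trans (norm_dist _ _) _.
have -> : x' - y' - (x - y) = (x' - x) - (y' - y) by vec.
by apply: le_trans (norm_tri hN _ _) _; rewrite (normN hN).
Qed.

Lemma compact_normP (K : set (plane R)) :
  (forall x, ~ K x -> exists2 d, 0 < d & forall y, N (y - x) < d -> ~ K y) ->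
  (exists M, forall x, K x -> N x <= M) -> compact K.
Proof.
move=> h [M hM]; apply: bounded_closed_compact.
  have [C C0 hC] := norm_equiv hN.
  exists (C * M); split; first exact: num_real.
  move=> r hr x /hM xM; apply: le_trans (ltW hr).
  by apply: le_trans (hC x).2 _; rewrite ler_pM2l.
apply/closedP_eps => x /h [d d0 hd]; have [e e0 he] := std_to_norm d0.
by exists e => // y yx; apply: hd; exact: he.
Qed.

Lemma compact_norm_closed (K : set (plane R)) : compact K ->
  forall x, ~ K x -> exists2 d, 0 < d & forall y, N (y - x) < d -> ~ K y.
Proof.
move=> cK x; have /closedP_eps : closed K.
  by apply: compact_closed => //; exact: norm_hausdorff.
move=> h /h [d d0 hd]; have [e e0 he] := norm_to_std d0.
by exists e => // y yx; apply: hd; exact: he.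
Qed.

Lemma compact_norm_bounded (K : set (plane R)) : compact K ->
  exists M, forall x, K x -> N x <= M.
Proof.
move=> /compact_bounded [M [_ hM]]; have [C C0 hC] := norm_equiv hN.
exists (C * (M + 1)) => x Kx; apply: le_trans (hC x).1 _.
by rewrite ler_pM2l //; apply: hM Kx; lin.
Qed.

Lemma compact_norm_positive (K : set (plane R)) (F : plane R -> R) : compact K ->
  (forall x, K x -> forall e : R, 0 < e -> exists2 d : R, 0 < d &
    forall y, K y -> N (y - x) < d -> `|F y - F x| < e) ->
  (forall x, K x -> 0 < F x) -> exists2 m, 0 < m & forall x, K x -> m <= F x.
Proof.
move=> cK cf; apply: compact_positive => // x Kx e e0.
have [d d0 hd] := cf x Kx e e0; have [d' d'0 hd'] := std_to_norm d0.
by exists d' => // y Ky yx; apply: hd => //; exact: hd'.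
Qed.

Lemma compact_norm_max (K : set (plane R)) (F : plane R -> R) : K !=set0 -> compact K ->
  (forall x, K x -> forall e : R, 0 < e -> exists2 d : R, 0 < d &
    forall y, K y -> N (y - x) < d -> `|F y - F x| < e) ->
  exists2 c, K c & forall x, K x -> F x <= F c.
Proof.
move=> K0 cK cf.
have [|c cA cm] := @compact_EVT_max _ R F K K0 cK.
  apply/withinP_eps => x Kx e e0.
  have [d d0 hd] := cf x Kx e e0; have [d' d'0 hd'] := std_to_norm d0.
  by exists d' => // y Ky yx; apply: hd => //; exact: hd'.
move/set_mem : cA => cA; exists c => // x Kx; apply: cm; exact: mem_set.
Qed.

Lemma dot_bound D : exists2 M, 0 < M & forall x, `|dot D x| <= M * N x.
Proof.
have [C C0 hC] := norm_equiv hN.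
pose S := `|D 0 0| + `|D 0 1| + 1.
have S0 : 0 < S by rewrite /S; have := normr_ge0 (D 0 0); have := normr_ge0 (D 0 1); lin.
exists (S * C); first by rewrite mulr_gt0.
move=> x; rewrite -mulrA; apply: le_trans (_ : S * `|x| <= _); last first.
  by rewrite ler_pM2l //; case: (hC x).
have coord i : `|x 0 i| <= `|x|.
  rewrite [leRHS]/Num.Def.normr /= mx_normrE; apply/bigmax_geP; right.
  by exists (0, i).
apply: le_trans (ler_normD _ _) _; rewrite !normrM /S.
have := ler_wpM2l (normr_ge0 (D 0 0)) (coord 0).
have := ler_wpM2l (normr_ge0 (D 0 1)) (coord 1).
have := normr_ge0 x; lin.
Qed.

Lemma dot_cont D x e : 0 < e -> exists2 d, 0 < d &
  forall y, N (y - x) < d -> `|dot D y - dot D x| < e.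
Proof.
move=> e0; have [M M0 hM] := dot_bound D; exists (e / M); first by rewrite divr_gt0.
move=> y; rewrite ltr_pdivlMr // mulrC -dotBr; exact: le_lt_trans.
Qed.

Lemma nonzero_plane : exists v : plane R, v != 0.
Proof.
exists (\row_(i < 2) 1); apply/eqP => /(congr1 (fun v : plane R => v 0 0)).
by rewrite !mxE; apply/eqP; exact: oner_neq0.
Qed.

Lemma exists_unit : exists v, N v = 1.
Proof.
have [v v0] := nonzero_plane; exists ((N v)^-1 *: v).
have p := norm_gt0 hN v0; rewrite (normZp hN); last by rewrite invr_ge0 ltW.
by rewrite mulVf // gt_eqF.
Qed.

Lemma dual_norm_attained D : exists v, N v = 1 /\ forall w, dot D w <= dot D v * N w.
Proof.
have [v0 hv0] := exists_unit.
have [] := @compact_norm_max [set v | N v = 1] (dot D).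
- by exists v0.
- apply: compact_normP; last by exists 1 => x ->.
  move=> x /= /eqP; rewrite -subr_eq0 => nx; exists (`|N x - 1|); first by rewrite normr_gt0.
  move=> y /[swap] /= <-; rewrite distrC => h; have := norm_dist y x; lin.
- by move=> x _ e e0; have [d d0 hd] := dot_cont D x e0; exists d => // y _; exact: hd.
move=> v /= Nv mv; exists v; split => // w.
have [->|w0] := eqVneq w 0; first by rewrite dot0r (norm0 hN) mulr0.
have p := norm_gt0 hN w0.
have := mv ((N w)^-1 *: w); rewrite (normZp hN); last by rewrite invr_ge0 ltW.
have q : N w != 0 by rewrite gt_eqF.
by rewrite mulVf // => /(_ erefl); rewrite dotZr mulrC ler_pdivrMr.
Qed.

Definition dual_norm D : R := dot D (projT1 (cid (dual_norm_attained D))).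

Lemma dual_normP D v : dot D v <= dual_norm D * N v.
Proof. by rewrite /dual_norm; case: cid => /= w [_]. Qed.

Lemma dual_norm_ex D : exists2 v, N v = 1 & dot D v = dual_norm D.
Proof. by rewrite /dual_norm; case: cid => /= w []; exists w. Qed.

Lemma dual_norm_abs D v : `|dot D v| <= dual_norm D * N v.
Proof. by rewrite ler_norml dual_normP andbT lerNl -dotNr -(normN hN) dual_normP. Qed.

Lemma dual_norm_ge0 D : 0 <= dual_norm D.
Proof.
by have [v v1 _] := dual_norm_ex D; have := dual_norm_abs D v; rewrite v1 mulr1; apply: le_trans.
Qed.

End NormTopology.

(** * Zonotope norms from symmetric dual polygons *)

Section Zonotope.
Context {R : realType} (N : plane R -> R) (hN : is_norm N).
Implicit Types (x y u v w f g h D : plane R) (c : R).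

(** The points of the dual unit circle, that is, the functionals of dual norm 1. They need not be
    extreme points of the dual ball. *)
Definition extreme_dual f := dual_ball N f /\ exists2 v, v != 0 & dot f v = N v.

Lemma extreme_dualN f : extreme_dual f -> extreme_dual (- f).
Proof.
move=> [hf [v v0 fv]]; split; first by move=> w; rewrite dotNl -dotNr -(normN hN).
by exists (- v); rewrite ?oppr_eq0 // dotNl dotNr opprK fv (normN hN).
Qed.

Lemma extreme_dual_neq0 f : extreme_dual f -> f != 0.
Proof.
move=> [_ [v v0 e]]; apply/eqP => f0; move: e; rewrite f0 dot0l => /esym /(norm_eq0 hN) /eqP.
by rewrite (negPf v0).
Qed.

(** [h] has dual norm 1 while [f] and [g] have dual norm at most 1; evaluate at a vector normed by
    [h]. *)
Lemma extreme_dual_le1 f g h (a b : R) : extreme_dual h -> dual_ball N f -> dual_ball N g ->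
  h = a *: f + b *: g -> 1 <= `|a| + `|b|.
Proof.
move=> [_ [v v0 hv]] df dg e; have p := norm_gt0 hN v0.
move: hv; rewrite e dotDl !dotZl => hv.
rewrite -(ler_pM2r p) mul1r mulrDl -{1}hv; apply: le_trans (ler_norm _) _.
apply: le_trans (ler_normD _ _) _; rewrite !normrM.
by apply: lerD; apply: ler_wpM2l => //; exact: (dual_ball_abs hN).
Qed.

(* The functional h lies on the arc from f to g of the dual unit circle. *)
Lemma arc_monotone f g h v (a b : R) : extreme_dual f -> extreme_dual g -> extreme_dual h ->
  0 <= a -> 0 <= b -> h = a *: f + b *: g -> `|dot f v| <= dot g v ->
  dot f v <= dot h v.
Proof.
move=> ef eg eh a0 b0 e fv.
have ab : 1 <= a + b.
  by have := extreme_dual_le1 eh ef.1 eg.1 e; rewrite !ger0_norm.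
rewrite e dotDl !dotZl.
move: fv; rewrite ler_norml => /andP[v1 v2].
have [fp|fn] := lerP 0 (dot f v).
  have := ler_wpM2l b0 v2; have := ler_wpM2r fp ab; lin.
have [a1|a1] := lerP a 1.
  have := mulr_ge0 b0 (_ : 0 <= dot g v).
  have h1 : 0 <= dot g v by lin.
  move=> /(_ h1) h2; have : (1 - a) * dot f v <= 0.
    by rewrite nmulr_lle0 //; lin.
  lin.
(* In the remaining case [dot f v < 0] and [1 < a]; solving for [f] and using that its dual norm is
   1 bounds the excess of [a]. *)
have a1b : a <= 1 + b.
  have e' : f = a^-1 *: h + (- (b / a)) *: g.
    rewrite {1}e scalerDr !scalerA mulVf ?scale1r; last by rewrite gt_eqF //; lin.
    by rewrite -addrA -scalerDl mulrC subrr scale0r addr0.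
  have := extreme_dual_le1 ef eh.1 eg.1 e'.
  have ap : 0 < a by lin.
  rewrite normrN normrM normfV !(ger0_norm b0) !(gtr0_norm ap).
  rewrite -(ler_pM2r ap) mulrDl mulVf ?gt_eqF // divfK ?gt_eqF //; lin.
have h3 : - dot f v <= dot g v by lin.
have := ler_wpM2l b0 h3; have : 0 <= (1 + b - a) * - dot f v by rewrite mulr_ge0 //; lin.
lin.
Qed.

(** Lengths of inscribed polygons and variations of functionals along a partition are both sums of
    this form. *)
Fixpoint vsum (T : Type) (d : T -> T -> R) (x : T) (s : seq T) : R :=
  if s is y :: s' then d x y + vsum d y s' else 0.

(** A half-open half plane: it contains exactly one of [f] and [- f] when [f] is not 0, and the sign
    of [det] orders its directions. *)
Definition upper f := (0 < f 0 1) || ((f 0 1 == 0) && (0 < f 0 0)).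

Lemma upper_or f : f != 0 -> upper f || upper (- f).
Proof.
move=> f0; rewrite /upper !mxE oppr_gt0 oppr_eq0.
case: (ltrgtP (f 0 1) 0) => //= h; case: (ltrgtP (f 0 0) 0) => //= h'.
- by rewrite oppr_gt0.
- by case/eqP: f0; apply/plane_eqP; rewrite !mxE.
Qed.

Lemma upper_det_trans f g h : upper f -> upper g -> upper h ->
  0 <= det f g -> 0 <= det g h -> 0 <= det f h.
Proof.
rewrite /upper /det.
move: (f 0 0) (f 0 1) (g 0 0) (g 0 1) (h 0 0) (h 0 1) => f0 f1 g0 g1 h0 h1.
move=> /orP[F|/andP[/eqP -> F]] /orP[G|/andP[/eqP -> G]] /orP[H|/andP[/eqP -> H]];
  rewrite ?mulr0 ?mul0r ?subr0 ?sub0r ?oppr_ge0 => A B; nra.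
Qed.

(** Parallel vectors of the half plane differ by a positive factor, which is 1 because both have
    dual norm 1. *)
Lemma upper_det0 f g : upper f -> upper g -> det f g = 0 ->
  extreme_dual f -> extreme_dual g -> f = g.
Proof.
move=> uf ug e ef eg.
have [c cg] := det_eq0 (extreme_dual_neq0 ef) e.
have c0 : 0 < c.
  move: uf ug; rewrite /upper cg !mxE.
  move: (f 0 0) (f 0 1) => f0 f1.
  move=> /orP[F|/andP[/eqP -> F]] /orP[G|/andP[/eqP G G']].
  - by rewrite pmulr_lgt0 in G.
  - move/eqP : G; rewrite mulf_eq0 (gt_eqF F) orbF => /eqP c0.
    by move: G'; rewrite c0 mul0r ltxx.
  - by move: G; rewrite mulr0 ltxx.
  - by rewrite pmulr_lgt0 in G'.
have d0 : dual_ball N 0 by move=> w; rewrite dot0l (norm_ge0 hN).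
have h1 := @extreme_dual_le1 f 0 g c 0 eg ef.1 d0.
have h2 := @extreme_dual_le1 g 0 f c^-1 0 ef eg.1 d0.
have {}h1 : 1 <= `|c| + `|0 : R| by apply: h1; rewrite scaler0 addr0.
have {}h2 : 1 <= `|c^-1| + `|0 : R|.
  by apply: h2; rewrite cg scaler0 addr0 scalerA mulVf ?gt_eqF // scale1r.
move: h1 h2; rewrite normr0 !addr0 !gtr0_norm ?invr_gt0 // => h1.
rewrite -(ler_pM2r c0) mulVf ?gt_eqF // mul1r => h2.
by rewrite cg (_ : c = 1) ?scale1r //; lin.
Qed.

Lemma arc_monotone_ccw f g h v : extreme_dual f -> extreme_dual g -> extreme_dual h ->
  0 < det f g -> 0 <= det f h -> 0 <= det h g -> `|dot f v| <= dot g v ->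
  dot f v <= dot h v.
Proof.
move=> ef eg eh fg fh hg; have fg0 : det f g != 0 by rewrite gt_eqF.
by apply: (arc_monotone ef eg eh _ _ (det_decomp h fg0)); rewrite divr_ge0 // ltW.
Qed.

Lemma arc_monotone_cw f g h v : extreme_dual f -> extreme_dual g -> extreme_dual h ->
  0 < det g f -> 0 <= det h f -> 0 <= det g h -> `|dot f v| <= dot g v ->
  dot f v <= dot h v.
Proof.
move=> ef eg eh gf hf gh; have fg0 : det f g != 0 by rewrite detC oppr_eq0 gt_eqF.
apply: (arc_monotone ef eg eh _ _ (det_decomp h fg0));
  rewrite (detC f g) invrN mulrN -mulNr -detC divr_ge0 // ltW //.
Qed.

(** The edges of one half of a symmetric polygon, from the vertex [f0] round to [- f0]; the other
    half consists of their opposites. *)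
Definition edges f0 s := pairmap (fun g h => h - g) f0 (rcons s (- f0)).

Lemma edges_sum v f x s : \sum_(D <- pairmap (fun g h => h - g) x (rcons s f)) `|dot D v| =
  vsum (fun g h => `|dot h v - dot g v|) x (rcons s f).
Proof.
elim: s x => [|y s IH] x /=; first by rewrite big_cons big_nil dotBl.
by rewrite big_cons dotBl IH.
Qed.

Lemma vsum_cat (T : Type) (d : T -> T -> R) (x : T) s t :
  vsum d x (s ++ t) = vsum d x s + vsum d (last x s) t.
Proof. by elim: s x => [|y s IH] x /=; rewrite ?add0r // IH addrA. Qed.

Lemma vsum_abs_ge (T : Type) (y : T -> R) (x : T) s :
  `|y (last x s) - y x| <= vsum (fun a b => `|y b - y a|) x s.
Proof.
elim: s x => [|z s IH] x /=; first by rewrite subrr normr0.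
have -> : y (last z s) - y x = (y z - y x) + (y (last z s) - y z) by ring.
by apply: le_trans (ler_normD _ _) _; rewrite lerD2l.
Qed.

(** The values at [v] travel from [dot f0 v] through [dot f v] to [- dot f0 v], and |p - q| + |p +
    q| is at least 2|p|. *)
Lemma edges_ge f0 s f v : f \in f0 :: s -> 2 * `|dot f v| <= \sum_(D <- edges f0 s) `|dot D v|.
Proof.
move=> fs; rewrite edges_sum -cats1.
have [s1 [s2 [es el]]] : exists s1 s2, s = s1 ++ s2 /\ last f0 s1 = f.
  move: fs; rewrite inE => /orP[/eqP ->|]; first by exists [::], s.
  by case/splitPr => s1 s2; exists (rcons s1 f), s2; rewrite cat_rcons last_rcons.
rewrite es -catA vsum_cat el.
have h1 := vsum_abs_ge (fun g => dot g v) f0 s1.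
have h2 := vsum_abs_ge (fun g => dot g v) f (s2 ++ [:: - f0]).
move: h1 h2; rewrite last_cat /= el dotNl => h1 h2.
have := ler_norm (dot f v - dot f0 v); have := ler_norm (- dot f0 v - dot f v).
have := ler_norm (- (dot f v - dot f0 v)); have := ler_norm (- (- dot f0 v - dot f v)).
rewrite !normrN; case: (ger0P (dot f v)) => h; lin.
Qed.

Local Notation le := (fun f g : plane R => 0 <= det f g).
Local Notation good := (fun f => extreme_dual f /\ upper f).

(** On an arc ending at the vertex [p] whose value at [v] dominates, [arc_monotone_ccw] makes the
    values at [v] increase, so their variation telescopes. *)
Lemma edges_inc v p s x : good p -> good x -> (forall g, g \in s -> good g) ->
  pairwise le (x :: rcons s p) -> `|dot x v| <= dot p v ->
  (forall g, g \in s -> `|dot g v| <= dot p v) ->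
  vsum (fun g h => `|dot h v - dot g v|) x (rcons s p) = dot p v - dot x v.
Proof.
move=> gp; elim: s x => [|h s IH] x gx gs pw xv sv /=.
  by rewrite addr0 ger0_norm // subr_ge0; apply: le_trans xv; exact: ler_norm.
have gh : good h by apply: gs; rewrite mem_head.
have /= := pw; rewrite all_rcons => /andP[/and3P[xh xp _] pw'].
rewrite IH //; first last.
- by move=> g gs'; apply: sv; rewrite inE gs' orbT.
- by apply: sv; rewrite mem_head.
- by move=> g gs'; apply: gs; rewrite inE gs' orbT.
have hp : 0 <= det h p by move: pw'; rewrite /= all_rcons => /andP[/andP[]].
rewrite ger0_norm; first by ring.
rewrite subr_ge0; have [xp0|xp0] := eqVneq (det x p) 0.
  have ep := upper_det0 gx.2 gp.2 xp0 gx.1 gp.1.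
  suff -> : h = x by [].
  apply: (upper_det0 gh.2 gx.2 _ gh.1 gx.1).
  by apply/eqP; rewrite eq_le {2}ep hp detC oppr_le0 xh.
by apply: arc_monotone_ccw xv => //; [exact: gx.1|exact: gp.1|exact: gh.1|rewrite lt_neqAle eq_sym xp0].
Qed.

(** The counterpart beyond [p]: the values decrease down to the last vertex [- f0], by
    [arc_monotone_cw]. *)
Lemma edges_dec v p f0 s x : good p -> good f0 -> good x -> (forall g, g \in s -> good g) ->
  pairwise le (x :: s) -> 0 <= det p x -> (forall g, g \in s -> 0 <= det p g) ->
  0 <= det f0 p -> 0 <= det f0 x -> (forall g, g \in s -> 0 <= det f0 g) ->
  `|dot x v| <= dot p v -> `|dot f0 v| <= dot p v ->
  (forall g, g \in s -> `|dot g v| <= dot p v) ->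
  vsum (fun g h => `|dot h v - dot g v|) x (rcons s (- f0)) = dot x v + dot f0 v.
Proof.
move=> gp g0; elim: s x => [|h s IH] x gx gs pw px ps f0p f0x f0s xv f0v sv /=.
  rewrite addr0 dotNl ler0_norm; first by ring.
  rewrite subr_le0; have [e|e] := eqVneq (det f0 p) 0.
    have ep := upper_det0 g0.2 gp.2 e g0.1 gp.1.
    by rewrite ep lerNl; apply: le_trans xv; rewrite -normrN ler_norm.
  rewrite -dotNl; apply: (arc_monotone_cw (g := p)) => //.
  - by apply: extreme_dualN; exact: g0.1.
  - exact: gp.1.
  - exact: gx.1.
  - by rewrite detNr -detC lt_neqAle eq_sym e.
  - by rewrite detNr -detC.
  - by rewrite dotNl normrN.
have gh : good h by apply: gs; rewrite mem_head.
have /= := pw => /andP[/andP[xh _] pw'].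
rewrite IH //; first last.
- by move=> g gs'; apply: sv; rewrite inE gs' orbT.
- by apply: sv; rewrite mem_head.
- by move=> g gs'; apply: f0s; rewrite inE gs' orbT.
- by apply: f0s; rewrite mem_head.
- by move=> g gs'; apply: ps; rewrite inE gs' orbT.
- by apply: ps; rewrite mem_head.
- by move=> g gs'; apply: gs; rewrite inE gs' orbT.
have ph : 0 <= det p h by apply: ps; rewrite mem_head.
have hv : `|dot h v| <= dot p v by apply: sv; rewrite mem_head.
rewrite ler0_norm; first by ring.
rewrite subr_le0; have [e|e] := eqVneq (det p h) 0.
  have ep := upper_det0 gp.2 gh.2 e gp.1 gh.1.
  suff -> : h = x by [].
  apply: (upper_det0 gh.2 gx.2 _ gh.1 gx.1).
  by apply/eqP; rewrite eq_le -{2}ep px detC oppr_le0 xh.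
by apply: (arc_monotone_cw (g := p)) => //; [exact: gh.1|exact: gp.1|exact: gx.1|rewrite lt_neqAle eq_sym e].
Qed.

(** Let [p] be the vertex with the largest absolute value at [v], made positive by the choice of
    sign of [v]. The values rise from [f0] to [p] and fall from [p] to [- f0], so the variation is
    exactly [2 * dot p v]. *)
Lemma edges_le f0 s v : good f0 -> (forall g, g \in s -> good g) -> pairwise le (f0 :: s) ->
  \sum_(D <- edges f0 s) `|dot D v| <= 2 * N v.
Proof.
move=> g0 gs pw.
have [p ps pm] : exists2 p, p \in f0 :: s & forall g, g \in f0 :: s -> `|dot g v| <= `|dot p v|.
  elim: (s) (f0) => [|h t IH] x; first by exists x; rewrite ?mem_head // => g; rewrite inE => /eqP ->.
  have [p pt pm] := IH h; have [le1|le1] := lerP `|dot x v| `|dot p v|.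
    exists p; first by rewrite inE pt orbT.
    by move=> g; rewrite inE => /orP[/eqP -> //|]; exact: pm.
  exists x; first by rewrite mem_head.
  move=> g; rewrite inE => /orP[/eqP -> //|/pm h1]; apply: le_trans h1 (ltW le1).
wlog pv : v pm / 0 <= dot p v.
  move=> H; have [h|h] := lerP 0 (dot p v); first exact: H.
  have := H (- v); rewrite (normN hN).
  under eq_bigr do rewrite dotNr normrN.
  apply; last by rewrite dotNr; lin.
  by move=> g gs'; rewrite !dotNr !normrN; exact: pm.
have pm' g : g \in f0 :: s -> `|dot g v| <= dot p v by move=> /pm; rewrite (ger0_norm pv).
have gp : good p by move: ps; rewrite inE => /orP[/eqP ->|/gs].
have dp : dot p v <= N v by exact: gp.1.1.
apply: le_trans (_ : 2 * dot p v <= _); last by lin.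
rewrite /edges edges_sum.
have f00 : `|dot f0 v| <= dot p v by apply: pm'; rewrite mem_head.
have pm0 g : g \in s -> `|dot g v| <= dot p v by move=> h; apply: pm'; rewrite inE h orbT.
have /= /andP[/allP f0s pws] := pw.
move: ps; rewrite inE => /orP[/eqP e|/splitPr].
  subst p; rewrite (@edges_dec v f0) //; first by lin.
  - by rewrite detxx.
  - by rewrite detxx.
  - by rewrite detxx.
move=> ss; case: ss gs pw pm0 f0s pws {pm pm'} => s1 s2 gs pw pm0 f0s pws.
have sub1 g : g \in s1 -> g \in s1 ++ p :: s2 by rewrite mem_cat => ->.
have sub2 g : g \in s2 -> g \in s1 ++ p :: s2 by rewrite mem_cat inE => ->; rewrite !orbT.
have psub : p \in s1 ++ p :: s2 by rewrite mem_cat mem_head orbT.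
rewrite rcons_cat /= -cat_rcons vsum_cat last_rcons.
rewrite edges_inc //; first last.
- by move=> g /sub1; exact: pm0.
- by move: pw; rewrite -cat_rcons -cat_cons pairwise_cat => /and3P[].
- by move=> g /sub1; exact: gs.
move: pws; rewrite pairwise_cat => /and3P[_ _ /= /andP[/allP pws2 pw2]].
rewrite (@edges_dec v p) //.
- by lin.
- by move=> g /sub2; exact: gs.
- by apply/andP; split => //; exact/allP.
- by rewrite detxx.
- by apply: f0s.
- by apply: f0s.
- by move=> g /sub2; exact: f0s.
- by rewrite (ger0_norm pv).
- by move=> g /sub2; exact: pm0.
Qed.

(* The norm whose dual unit ball is a symmetric polygon is half the sum of the absolute
   values of the edges of half of that polygon. *)
Lemma zonotope (L : seq (plane R)) : (forall f, f \in L -> extreme_dual f) ->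
  exists Ds : seq (plane R), (forall v, \sum_(D <- Ds) `|dot D v| <= 2 * N v) /\
    forall f v, f \in L -> 2 * `|dot f v| <= \sum_(D <- Ds) `|dot D v|.
Proof.
move=> hL.
pose flip f := if upper f then f else - f.
pose S := sort le (map flip L).
have gS g : g \in S -> good g.
  rewrite mem_sort => /mapP[f /hL ef ->]; rewrite /flip.
  have := upper_or (extreme_dual_neq0 ef).
  by case E: (upper f) => //= uf; split => //; exact: extreme_dualN.
have pS : pairwise le S.
  (* Angles compare transitively only within the half plane, hence the sorting lemma relative to the
     members of [S]. *)
  have tt : {in mem S & &, transitive le}.
    move=> g f h /gS[_ ug] /gS[_ uf] /gS[_ uh] a b.
    exact: (upper_det_trans uf ug uh a b).
  have aS : all (mem S) S by apply/allP.
  rewrite -(sorted_pairwise_in tt aS); apply: sort_sorted => f g.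
  by rewrite (detC g f) oppr_ge0; case: (lerP 0 (det f g)) => //= /ltW.
have mS f : f \in L -> f \in S \/ - f \in S.
  move=> fL; have : flip f \in S by rewrite mem_sort; apply: map_f.
  by rewrite /flip; case: (upper f) => ?; [left|right].
case: S gS pS mS => [|f0 s] gS pS mS.
  exists [::]; split; first by move=> v; rewrite big_nil; have := norm_ge0 hN v; lin.
  by move=> f v /mS[].
exists (edges f0 s); split.
  move=> v; apply: edges_le => //; first by apply: gS; rewrite mem_head.
  by move=> g gs; apply: gS; rewrite inE gs orbT.
move=> f v /mS[/edges_ge|/edges_ge]; first exact.
by move=> /(_ v); rewrite dotNl normrN.
Qed.

End Zonotope.

(** * Turning of closed polygons *)

Section HalfTurns.
Context {R : realType} (f : plane R).
Hypothesis f0 : f != 0.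
Implicit Types (x y z u v w p : plane R).

(* Ties on the kernel of f are broken so that exactly one of v and - v is on the side of f. *)
Definition side v := (0 < dot f v) || ((dot f v == 0) && (0 < det f v)).

Lemma side_ge0 v : side v -> 0 <= dot f v.
Proof. by move=> /orP[/ltW //|/andP[/eqP ->]]. Qed.

Lemma sideN v : v != 0 -> side (- v) = ~~ side v.
Proof.
move=> v0; rewrite /side dotNr detNr oppr_eq0 !oppr_gt0.
case: (ltrgtP (dot f v) 0) => //= h; case: (ltrgtP (det f v) 0) => //= h'.
have [c e] := det_eq0 f0 h'.
move: h; rewrite e dotZr => /eqP; rewrite mulf_eq0 (gt_eqF (dotvv_gt0 f0)) orbF => /eqP c0.
by move: v0; rewrite e c0 scale0r eqxx.
Qed.

Lemma side_le0 v : v != 0 -> ~~ side v -> dot f v <= 0.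
Proof. by move=> v0; rewrite -sideN // => /side_ge0; rewrite dotNr oppr_ge0. Qed.

(** The signed crossing of the kernel of [f] when turning from [x] to [y] by less than a straight
    angle. Summed over a closed polygon it counts half turns. *)
Definition half_turn x y : R :=
  if side x == side y then 0 else if 0 < det x y then 1 else - 1.

Lemma half_turn_bound x y : -1 <= half_turn x y <= 1.
Proof. by rewrite /half_turn; case: eqP => _; last case: (0 < _); apply/andP; split; lin. Qed.

Lemma acute_neq0 p x : 0 < dot p x -> x != 0.
Proof. by apply: contraTneq => ->; rewrite dot0r ltxx. Qed.

(** In the open half plane of [p] the kernel of [f] leaves at most one ray, crossed in a direction
    given by the sign of [det p f]. The half turn is therefore a difference of a potential, and
    additivity follows. *)
Lemma half_turn_acute p x y : 0 < dot p x -> 0 < dot p y ->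
  half_turn x y = (if det p f < 0 then 1 else - 1) * ((side x)%:R - (side y)%:R).
Proof.
move=> px py; have x0 := acute_neq0 px; have y0 := acute_neq0 py.
have key : det p f * det x y = dot p x * dot f y - dot p y * dot f x.
  rewrite /det /dot; ring.
(* Two vectors on the kernel of [f] in the half plane of [p] lie on the same ray. *)
have nz : dot f x = 0 -> dot f y = 0 -> side x != side y -> False.
  move=> hx hy; rewrite /side hx hy ltxx eqxx /= => s.
  have pf0 : perp f != 0.
    apply: contra f0 => /eqP e; apply/eqP/plane_eqP; rewrite !mxE.
      by move: e => /(congr1 (fun v : plane R => v 0 1)); rewrite !mxE.
    by move: e => /(congr1 (fun v : plane R => v 0 0)); rewrite !mxE /= => /eqP; rewrite oppr_eq0 => /eqP.
  have dp w : det (perp f) w = - dot f w by rewrite /det /dot !mxE /=; ring.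
  have /(det_eq0 pf0)[c e] : det (perp f) x = 0 by rewrite dp hx oppr0.
  have /(det_eq0 pf0)[c' e'] : det (perp f) y = 0 by rewrite dp hy oppr0.
  have dpf : det f (perp f) = dot f f by rewrite /det /dot !mxE /=; ring.
  have ff := dotvv_gt0 f0.
  move: s px py; rewrite e e' !detZr !dotZr dpf !(pmulr_lgt0 _ ff).
  set d := dot p _; clearbody d.
  case: (ltrP 0 c) => hc; case: (ltrP 0 c') => hc' // _ h1 h2; nra.
rewrite /half_turn.
case sx : (side x); case sy : (side y) => /=; rewrite ?subrr ?mulr0 ?subr0 ?sub0r ?mulr1 //.
- have gx := side_ge0 sx; have gy := side_le0 y0 (negbT sy).
  have h : det p f * det x y < 0.
    rewrite key; have [e|e] := eqVneq (dot f x) 0; first have [e'|e'] := eqVneq (dot f y) 0.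
    + by case: (nz e e'); rewrite sx sy.
    + have : dot f y < 0 by rewrite lt_neqAle e'.
      by move=> h; rewrite e mulr0 subr0 pmulr_rlt0.
    + have : 0 < dot f x by rewrite lt_neqAle eq_sym e.
      by move=> h; have := mulr_gt0 py h; have := mulr_ge0 (ltW px) (_ : 0 <= - dot f y); lin.
  case: ltrP => h1; case: ltrP => h2 //; nra.
- have gy := side_ge0 sy; have gx := side_le0 x0 (negbT sx).
  have h : 0 < det p f * det x y.
    rewrite key; have [e|e] := eqVneq (dot f x) 0; first have [e'|e'] := eqVneq (dot f y) 0.
    + by case: (nz e e'); rewrite sx sy.
    + have : 0 < dot f y by rewrite lt_neqAle eq_sym e'.
      by move=> h; rewrite e mulr0 subr0 pmulr_rgt0.
    + have : dot f x < 0 by rewrite lt_neqAle e.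
      move=> h; have h1 : 0 < - dot f x by lin.
      by have := mulr_gt0 py h1; have := mulr_ge0 (ltW px) gy; lin.
  case: ltrP => h1; case: ltrP => h2; rewrite ?opprK //; nra.
Qed.

(** Three vectors in a common open half plane: the condition under which half turns add. *)
Definition acute x y z := exists p, [/\ 0 < dot p x, 0 < dot p y & 0 < dot p z].

Lemma half_turn_add x y z : acute x y z -> half_turn x y + half_turn y z = half_turn x z.
Proof.
move=> [p [px py pz]].
rewrite (half_turn_acute px py) (half_turn_acute py pz) (half_turn_acute px pz); ring.
Qed.

(* Hopf's argument: the turning of the edges of a simple closed polygon is transported,
   through the triangle of chords, to the chords that start or end at the vertex v 0, which
   is extreme for f. *)
Section Hopf.
Variables (v : nat -> plane R) (m : nat).
Let e i j := v j - v i.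
Hypotheses (m3 : (3 <= m)%N) (vm : v m = v 0%N).
(** The excluded case [i = 0], [j.+1 = m] would involve the chord from [v 0] to itself. *)
Hypothesis T1 : forall i j, (i < j)%N -> (j < m)%N -> (0 < i)%N \/ (j.+1 < m)%N ->
  acute (e i j) (e i j.+1) (e i.+1 j.+1).
Hypothesis T2 : forall i j, (i.+1 < j)%N -> (j < m)%N ->
  acute (e i j) (e i.+1 j) (e i.+1 j.+1).
Hypothesis base : forall j, (0 < j < m)%N -> side (v 0%N - v j).

(** Two paths in the grid of pairs [(i, j)] with the same ends have the same turning of chords,
    since the turning agrees around each triangle of the grid by [T1] and [T2]. Here the start of
    the chords moves from [v i] to [v i.+1]. *)
Lemma hopf_row i M : (i.+1 < M)%N -> (M <= m)%N -> (0 < i)%N \/ (M < m)%N ->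
  \sum_(i.+1 <= j < M) half_turn (e i j) (e i j.+1) + half_turn (e i M) (e i.+1 M) =
  half_turn (e i i.+1) (e i.+1 i.+2) +
  \sum_(i.+2 <= j < M) half_turn (e i.+1 j) (e i.+1 j.+1).
Proof.
elim: M => // M IH; rewrite ltnS leq_eqVlt => /orP[/eqP <-|iM] Mm hi.
  rewrite big_nat1 big_geq // addr0; apply: half_turn_add; apply: T1 => //.
have := IH iM (ltnW Mm); rewrite Mm => /(_ (or_intror erefl)) h.
rewrite big_nat_recr /=; last by lia.
rewrite [in RHS]big_nat_recr /=; last by lia.
rewrite addrA -h.
have h1 := half_turn_add (T1 (ltnW iM) Mm hi).
have h2 := half_turn_add (T2 iM Mm).
lin.
Qed.

(** The chords that end at [v m = v 0] all lie on one side of [f], so the boundary term of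
    [hopf_row] vanishes and the rows can be chained. *)
Lemma hopf_col i : (0 < i)%N -> (i < m)%N ->
  \sum_(i.+1 <= j < m) half_turn (e i j) (e i j.+1) =
  \sum_(i <= j < m.-1) half_turn (e j j.+1) (e j.+1 j.+2).
Proof.
move=> i0 im; have [k hk] : exists k, (m - i)%N = k.+1 by exists (m - i).-1; lia.
elim: k i i0 im hk => [|k IH] i i0 im hk.
  by rewrite !big_geq //; lia.
have iM : (i.+1 < m)%N by lia.
have := hopf_row iM (leqnn m) (or_introl i0).
have -> : half_turn (e i m) (e i.+1 m) = 0.
  rewrite /half_turn /e vm !base ?eqxx //; lia.
rewrite addr0 (IH i.+1) //; last by lia.
by move=> ->; rewrite [in RHS]big_ltn //; lia.
Qed.

(** The chords starting at [v 0] lie on one side of [f] and contribute no half turn among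
    themselves. Two half turns remain, one at the missing corner of the grid and one at the closing
    vertex, each at most 1 in absolute value. *)
Theorem hopf_turning :
  `|\sum_(0 <= j < m.-1) half_turn (e j j.+1) (e j.+1 j.+2) + half_turn (e m.-1 m) (e 0 1)| <= 2.
Proof.
have T3 : acute (e 0 m.-1) (e 1 m.-1) (e 1 m).
  have em : m = m.-1.+1 by lia.
  by rewrite {3}em; apply: T2; lia.
have nz j : (0 < j < m)%N -> v 0%N - v j != 0.
  move=> /base; apply: contraTneq => ->.
  by rewrite /side dot0r ltxx /det !mxE !mulr0 subrr ltxx andbF.
have h0 : \sum_(1 <= j < m.-1) half_turn (e 0 j) (e 0 j.+1) = 0.
  rewrite big_nat big1 // => j hj; rewrite /half_turn /e.
  rewrite -(opprB (v 0%N) (v j)) -(opprB (v 0%N) (v j.+1)).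
  have hj1 : (0 < j < m)%N by lia.
  have hj2 : (0 < j.+1 < m)%N by lia.
  by rewrite !sideN ?nz // !base.
have := @hopf_row 0 m.-1; rewrite h0 add0r => h1.
have := hopf_col (isT : (0 < 1)%N) (_ : 1 < m)%N.
rewrite (_ : (1 < m)%N); last by lia.
move=> /(_ isT) h2.
have em : m = m.-1.+1 by lia.
rewrite {1}em in h2; rewrite big_nat_recr /= -?em in h2; last by lia.
rewrite big_ltn; last by lia.
rewrite -h2 addrA -h1; try lia.
rewrite (half_turn_add T3).
have := half_turn_bound (e 0 m.-1) (e 1 m).
have := half_turn_bound (e m.-1 m) (e 0 1).
by move=> /andP[a b] /andP[c d]; rewrite ler_norml; apply/andP; split; lin.
Qed.

End Hopf.
End HalfTurns.

(** * Curves with a transverse field *)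

Section Curves.
Context {R : realType} (N : plane R -> R) (hN : is_norm N).
Implicit Types (x y z v w p : plane R) (g u : R -> plane R).

Definition unif_cont g := forall e, 0 < e -> exists2 d, 0 < d &
  forall t t', `|t - t'| < d -> N (g t - g t') < e.

Definition periodic g := forall t (n : int), g (t + n%:~R) = g t.

Lemma det_bound : exists2 M, 0 < M & forall x y, `|det x y| <= M * N x * N y.
Proof.
have [C C0 hC] := norm_equiv hN.
have coord i x : `|x 0 i| <= `|x|.
  rewrite [leRHS]/Num.Def.normr /= mx_normrE; apply/bigmax_geP; right.
  by exists (0, i).
exists (2 * C ^+ 2); first by rewrite mulr_gt0 ?exprn_gt0.
move=> x y; have [_ hx] := hC x; have [_ hy] := hC y.
apply: le_trans (_ : 2 * (`|x| * `|y|) <= _).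
  rewrite /det; apply: le_trans (ler_normB _ _) _; rewrite !normrM.
  have := ler_pM (normr_ge0 _) (normr_ge0 _) (coord 0 x) (coord 1 y).
  have := ler_pM (normr_ge0 _) (normr_ge0 _) (coord 1 x) (coord 0 y); lin.
have := ler_pM (normr_ge0 _) (normr_ge0 _) hx hy; lin.
Qed.

Lemma det_cont x y e : 0 < e -> exists2 d, 0 < d &
  forall x' y', N (x' - x) < d -> N (y' - y) < d -> `|det x' y' - det x y| < e.
Proof.
have [M M0 hM] := det_bound; move=> e0.
pose K := M * (N x + N y + 1); have K0 : 0 < K.
  by rewrite mulr_gt0 //; have := norm_ge0 hN x; have := norm_ge0 hN y; lin.
exists (Num.min 1 (e / K)); first by rewrite lt_min ltr01 divr_gt0.
move=> x' y'; rewrite !lt_min => /andP[x1 x2] /andP[y1 y2].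
have -> : det x' y' - det x y = det (x' - x) y' + det x (y' - y).
  rewrite /det !mxE; ring.
have ny : N y' <= N y + 1.
  have := norm_tri hN (y' - y) y; rewrite subrK; lin.
set m := e / K in x2 y2; have m0 : 0 < m by rewrite divr_gt0.
have h1 : `|det (x' - x) y'| <= M * (m * (N y + 1)).
  apply: le_trans (hM _ _) _; rewrite -mulrA ler_pM2l //.
  by apply: ler_pM; rewrite ?(norm_ge0 hN) // ltW.
have h2 : `|det x (y' - y)| <= M * (N x * N (y' - y)).
  by apply: le_trans (hM _ _) _; rewrite mulrA.
have h3 : M * (m * (N x + N y + 1)) = e.
  by rewrite mulrCA -/K /m divfK // gt_eqF.
apply: le_lt_trans (ler_normD _ _) _.
have [nx|nx] := eqVneq (N x) 0.
  rewrite nx mul0r mulr0 in h2.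
  have h4 : `|det (x' - x) y'| < M * (m * (N y + 1)).
    apply: le_lt_trans (hM _ _) _; rewrite -mulrA ltr_pM2l //.
    apply: le_lt_trans (_ : N (x' - x) * (N y + 1) < _).
      by rewrite ler_wpM2l // (norm_ge0 hN).
    by rewrite ltr_pM2r //; have := norm_ge0 hN y; lin.
  by move: h3; rewrite nx add0r; lin.
have px : 0 < N x by rewrite lt_neqAle eq_sym nx (norm_ge0 hN).
have h4 : M * (N x * N (y' - y)) < M * (N x * m) by rewrite !ltr_pM2l.
lin.
Qed.

Section TwoSided.
Variables (g u : R -> plane R) (eta : R).
Hypotheses (cg : unif_cont g) (cu : unif_cont u) (u1 : forall t, N (u t) = 1).
Hypothesis inj : forall t t', 0 < t' - t < 1 -> g t <> g t'.
Hypothesis eta0 : 0 < eta.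
(** The curve stays out of the open balls of radius [eta] about [g t + eta *: u t] and
    [g t - eta *: u t], which touch it at [g t] from both sides. *)
Hypothesis ballp : forall t t', eta <= N (g t' - g t - eta *: u t).
Hypothesis balln : forall t t', eta <= N (g t' - g t + eta *: u t).

Lemma two_sided_transverse : exists2 d, 0 < d <= 1 & forall t t' (th : R),
  0 < t' - t < d -> 0 <= th <= 1 ->
  det ((1 - th) *: u t + th *: u t') (g t' - g t) != 0.
Proof.
have e0 := eta0; have e2 : 0 < eta / 2 by lin.
have h2 : 0 < 2^-1 :> R by lin.
have [d1 d10 hd1] := cg e2; have [d2 d20 hd2] := cu h2.
exists (Num.min 1 (Num.min d1 d2)); first by rewrite !lt_min ltr01 d10 d20 ge_min lexx.
move=> t t' th; rewrite !lt_min => /and4P[t0 t1 t2 t3] /andP[th0 th1].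
apply/eqP => z0.
set U := _ + _ in z0; pose nu := th *: (u t' - u t).
have eU : U = u t + nu by rewrite /U /nu; vec.
have nnu : N nu <= 1 / 2.
  rewrite /nu (normZp hN) //; have := hd2 t' t; rewrite ger0_norm; last lin.
  move=> /(_ t3) h; have := norm_ge0 hN (u t' - u t).
  move: (N _) h => A h A0; have := ler_wpM2r A0 th1; lin.
have nU : 1 / 2 <= N U.
  have := normB_ge hN (u t) (- nu); rewrite opprK -eU (normN hN) u1; lin.
have U0 : U != 0 by apply: contraTneq nU => ->; rewrite (norm0 hN) -ltNge; lin.
have [c ec] := det_eq0 U0 z0.
have c0 : c != 0.
  apply: contra_notN (inj (_ : 0 < t' - t < 1)) => [/eqP c0|]; last by rewrite t0.
  by move: ec; rewrite c0 scale0r => /eqP; rewrite subr_eq0 => /eqP.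
have nd : N (g t' - g t) < eta / 2 by apply: hd1; rewrite ger0_norm; lin.
have cb : `|c| * (1 / 2) <= N (g t' - g t).
  by rewrite ec (norm_scale hN) ler_wpM2l.
have [cp|cn] := ltrP 0 c.
  rewrite gtr0_norm // in cb.
  have := ballp t t'; rewrite ec eU.
  have -> : c *: (u t + nu) - eta *: u t = c *: nu - (eta - c) *: u t by vec.
  have := norm_tri hN (c *: nu) (- ((eta - c) *: u t)).
  have p1 : 0 <= eta - c by lin.
  rewrite (normN hN) (normZp hN _ (ltW cp)) (normZp hN _ p1) u1.
  have := ler_wpM2l (ltW cp) nnu; lin.
have {}cn : c < 0 by rewrite lt_neqAle c0.
rewrite ltr0_norm // in cb.
have := balln t t'; rewrite ec eU.
have -> : c *: (u t + nu) + eta *: u t = c *: nu + (eta + c) *: u t by vec.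
have := norm_tri hN (c *: nu) ((eta + c) *: u t).
have p1 : 0 <= eta + c by lin.
rewrite (normZp hN _ p1) u1 (norm_scale hN) ltr0_norm //.
have cn' : 0 <= - c by lin.
have := ler_wpM2l cn' nnu; lin.
Qed.

(** The orientation of the curve. The determinant does not vanish for short chords, and any two
    pairs [(t, t')] and [(s, s')] of admissible times are joined by a segment of admissible pairs,
    so by the intermediate value theorem its sign [k] is the same everywhere. *)
Lemma two_sided_side : exists2 d, 0 < d <= 1 & exists k : R, (k = 1 \/ k = -1) /\
  forall t t', 0 < t' - t < d ->
    0 < k * det (u t) (g t' - g t) /\ 0 < k * det (u t') (g t' - g t).
Proof.
have [d /andP[d0 d1] hd] := two_sided_transverse; exists d; first by rewrite d0.
have same t t' : 0 < t' - t < d ->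
    0 < det (u t) (g t' - g t) * det (u t') (g t' - g t).
  move=> tt; set A := det _ _; set B := det _ _.
  have hA : A != 0.
    by have := hd t t' 0 tt; rewrite lexx ler01 => /(_ isT); rewrite subr0 scale1r scale0r addr0.
  have hB : B != 0.
    by have := hd t t' 1 tt; rewrite lexx ler01 => /(_ isT); rewrite subrr scale1r scale0r add0r.
  rewrite lt_neqAle eq_sym mulf_neq0 //=; rewrite leNgt; apply/negP => ab.
  have ab0 : A - B != 0 by apply: contraTneq ab => e; have -> : A = B; rewrite -?leNgt; [lin|nra].
  have th : 0 <= A / (A - B) <= 1.
    case: (ltrP 0 A) => hA'.
      have hB' : B < 0 by nra.
      by rewrite divr_ge0 /= ?ler_pdivrMr; lin.
    have hB' : 0 < B by nra.
    have -> : A / (A - B) = (- A) / (B - A) by rewrite -(opprB A B) invrN mulrNN.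
    by rewrite divr_ge0 /= ?ler_pdivrMr; lin.
  have := hd t t' _ tt th; rewrite detDl !detZl -/A -/B => /eqP; apply.
  by field.
have cst t t' s s' : 0 < t' - t < d -> 0 < s' - s < d ->
    0 < det (u t) (g t' - g t) -> 0 < det (u s) (g s' - g s).
  move=> tt ss hp; rewrite ltNge; apply/negP => hn.
  pose al (th : R) := t + th * (s - t); pose be (th : R) := t' + th * (s' - t').
  pose F th := det (u (al th)) (g (be th) - g (al th)).
  have nz th : 0 <= th <= 1 -> F th != 0.
    move=> /andP[h0 h1]; have := hd (al th) (be th) 0.
    rewrite lexx ler01 subr0 scale1r scale0r addr0; apply => //.
    rewrite /al /be; move: tt ss => /andP[a b] /andP[a' b'].
    have -> : t' + th * (s' - t') - (t + th * (s - t)) = (1 - th) * (t' - t) + th * (s' - s) by ring.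
    apply/andP; split.
      have [->|th0] := eqVneq th 0; first by rewrite mul0r addr0 subr0 mul1r.
      have : 0 < th by rewrite lt_neqAle eq_sym th0.
      move=> thp; have := mulr_gt0 thp a'; have := mulr_ge0 (_ : 0 <= 1 - th) (ltW a).
      by move=> /(_ _); rewrite subr_ge0 h1 => /(_ isT); lin.
    have [->|th0] := eqVneq th 0; first by rewrite mul0r addr0 subr0 mul1r.
    have : 0 < th by rewrite lt_neqAle eq_sym th0.
    move=> thp; have b1 : th * (s' - s) < th * d by rewrite ltr_pM2l.
    have b2 : (1 - th) * (t' - t) <= (1 - th) * d by rewrite ler_wpM2l; lin.
    lin.
  have [||th thI] := @IVT_eps R F 0 1 0 ler01; last by have := nz th thI => /eqP.
  - move=> th _ e e0.
    have [r r0 hr] := det_cont (u (al th)) (g (be th) - g (al th)) e0.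
    have r2 : 0 < r / 2 by lin.
    have [c1 c10 hc1] := cg r2; have [c2 c20 hc2] := cu r0.
    pose L := `|s - t| + `|s' - t'| + 1.
    have L0 : 0 < L by rewrite /L; have := normr_ge0 (s - t); have := normr_ge0 (s' - t'); lin.
    exists (Num.min c1 c2 / L); first by rewrite divr_gt0 // lt_min c10.
    move=> y _; rewrite ltr_pdivlMr // lt_min => /andP[y1 y2].
    have dal : `|al y - al th| <= `|y - th| * L.
      have -> : al y - al th = (y - th) * (s - t) by rewrite /al; ring.
      by rewrite normrM ler_wpM2l // /L; have := normr_ge0 (s' - t'); lin.
    have dbe : `|be y - be th| <= `|y - th| * L.
      have -> : be y - be th = (y - th) * (s' - t') by rewrite /be; ring.
      by rewrite normrM ler_wpM2l // /L; have := normr_ge0 (s - t); lin.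
    apply: hr; first by apply: hc2; lin.
    have -> : g (be y) - g (al y) - (g (be th) - g (al th)) =
       (g (be y) - g (be th)) - (g (al y) - g (al th)) by vec.
    have h1 : N (g (be y) - g (be th)) < r / 2 by apply: hc1; lin.
    have h2 : N (g (al y) - g (al th)) < r / 2 by apply: hc1; lin.
    have := norm_tri hN (g (be y) - g (be th)) (- (g (al y) - g (al th))).
    by rewrite (normN hN); lin.
  - right; apply/andP; split.
      by rewrite /F /al /be !mul1r !subrKC.
    by rewrite /F /al /be !mul0r !addr0 ltW.
pose k : R := if 0 < det (u 0) (g (d / 2) - g 0) then 1 else - 1.
have d2 : 0 < d / 2 - 0 < d by lin.
exists k; split; first by rewrite /k; case: ifP; [left|right].
move=> t t' tt; have hs := same _ _ tt.
suff h1 : 0 < k * det (u t) (g t' - g t).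
  split => //; move: h1 hs; rewrite /k; case: ifP => _; rewrite ?mul1r ?mulN1r => h1.
    by rewrite pmulr_rgt0.
  by rewrite -mulrNN pmulr_rgt0.
rewrite /k; case: ifP => h.
  by rewrite mul1r; exact: cst h.
rewrite mulN1r oppr_gt0 ltNge; apply/negP => h'.
have h'' : 0 < det (u t) (g t' - g t).
  rewrite lt_neqAle h' andbT; apply: contraTneq hs => <-; by rewrite mul0r ltxx.
by have := cst _ _ _ _ tt d2 h''; rewrite h.
Qed.

End TwoSided.

Lemma injectivity_modulus g : unif_cont g -> periodic g ->
  (forall t t', 0 < t' - t < 1 -> g t <> g t') ->
  forall d, 0 < d -> exists2 m, 0 < m &
    forall t t', d <= t' - t <= 1 - d -> m <= N (g t' - g t).
Proof.
move=> cg pg inj d d0.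
pose K : set (R * R) := (`[0, 1] `*` `[d, 1 - d])%classic.
have cK : compact K by apply: compact_setX; exact: segment_compact.
pose F (p : R * R) := N (g (p.1 + p.2) - g p.1).
have [|[t h] [/=]|m m0 hm] := @compact_positive R _ K F cK.
- move=> x _ e e0.
  have e2 : 0 < e / 2 by lin.
  have [c c0 hc] := cg _ e2.
  exists (c / 2); first by lin.
  move=> y _; rewrite prod_normE gt_max /= => /andP[h1 h2].
  apply: le_lt_trans (norm_dist2 hN _ _ _ _) _.
  have k1 : N (g (y.1 + y.2) - g (x.1 + x.2)) < e / 2.
    apply: hc; have -> : y.1 + y.2 - (x.1 + x.2) = (y.1 - x.1) + (y.2 - x.2) by ring.
    by apply: le_lt_trans (ler_normD _ _) _; lin.
  have k2 : N (g y.1 - g x.1) < e / 2 by apply: hc; lin.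
  lin.
- rewrite !in_itv /= => /andP[t0 t1] /andP[h0 h1].
  apply: (norm_gt0 hN); rewrite subr_eq0; apply/eqP => /esym /=; apply: inj; apply/andP; split; lin.
exists m => // t t' /andP[h0 h1].
have := hm (t - (Num.floor t)%:~R, t' - t); rewrite /F /=.
have -> : t - (Num.floor t)%:~R + (t' - t) = t' + (- Num.floor t)%:~R by rewrite mulrNz; ring.
have -> : t - (Num.floor t)%:~R = t + (- Num.floor t)%:~R by rewrite mulrNz.
rewrite !pg; apply; split; rewrite /= in_itv /=; last by rewrite h0.
have /andP[f1 f2] := floor_itv t; rewrite intrD1 in f2.
rewrite mulrNz; set n := _%:~R in f1 f2 *; clearbody n; apply/andP; split; lin.
Qed.

End Curves.

(** * Nearest points and normals *)

Section Distance.
Context {R : realType} (N : plane R -> R) (hN : is_norm N) (J : set (plane R)).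
Hypotheses (cJ : compact J) (J0 : J !=set0).
Implicit Types (x y z v w p a b : plane R).

Definition dist x : R := inf [set N (x - a) | a in J].

Lemma dist_attained x : exists2 a, J a & N (x - a) = dist x.
Proof.
have [|a Ja am] := @compact_norm_max _ _ hN J (fun a => - N (x - a)) J0 cJ.
- move=> a _ e e0; exists e => // b _ h.
  rewrite -opprD normrN; apply: le_lt_trans (norm_dist hN _ _) _.
  by rewrite (_ : _ - _ = a - b) 1?(normC hN) //; vec.
exists a => //; apply/eqP; rewrite eq_le; apply/andP; split.
  apply: lb_le_inf; first by exists (N (x - a)); exists a.
  by move=> _ [b Jb <-]; have := am b Jb; rewrite lerN2.
apply: ge_inf; last by exists a.
by exists 0 => _ [b _ <-]; exact: norm_ge0.
Qed.

Definition foot x := projT1 (cid2 (dist_attained x)).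

Lemma footJ x : J (foot x).
Proof. by rewrite /foot; case: cid2. Qed.

Lemma footE x : N (x - foot x) = dist x.
Proof. by rewrite /foot; case: cid2. Qed.

Lemma dist_le x a : J a -> dist x <= N (x - a).
Proof.
by move=> Ja; apply: ge_inf; [exists 0 => _ [b _ <-]; exact: norm_ge0|exists a].
Qed.

Lemma dist_lip x y : dist x <= dist y + N (x - y).
Proof.
rewrite -(footE y) addrC; apply: le_trans (dist_le x (footJ y)) _.
exact: norm_triB.
Qed.

Lemma dist_lip_abs x y : `|dist x - dist y| <= N (x - y).
Proof.
rewrite ler_norml; have := dist_lip x y; have := dist_lip y x.
by rewrite (normC hN y x) => h1 h2; apply/andP; split; lin.
Qed.

Lemma dist_ge0 x : 0 <= dist x.
Proof. by rewrite -footE norm_ge0. Qed.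

Lemma dist_J a : J a -> dist a = 0.
Proof.
move=> Ja; apply/eqP; rewrite eq_le dist_ge0 andbT.
by apply: le_trans (dist_le a Ja) _; rewrite subrr (norm0 hN).
Qed.

Lemma dist_eq0 x : dist x = 0 -> J x.
Proof.
rewrite -footE => /(norm_eq0 hN) /eqP; rewrite subr_eq0 => /eqP ->.
exact: footJ.
Qed.

Lemma dist_gt0 x : ~ J x -> 0 < dist x.
Proof.
by move=> nJ; rewrite lt_neqAle dist_ge0 andbT eq_sym; apply/eqP => /dist_eq0.
Qed.

Lemma dist_ray a v c r : 0 <= r <= c -> J a -> dist (a + c *: v) = c * N v ->
  dist (a + r *: v) = r * N v.
Proof.
move=> /andP[r0 rc] Ja h; apply/eqP; rewrite eq_le; apply/andP; split.
  have := dist_le (a + r *: v) Ja.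
  by rewrite (_ : _ - a = r *: v) ?(normZp hN) //; vec.
have := dist_lip (a + c *: v) (a + r *: v).
rewrite (_ : _ - (a + _) = (c - r) *: v); last by vec.
by rewrite h (normZp hN) ?subr_ge0 //; lin.
Qed.

Section Reach.
Variable s : R.
Hypothesis uniq_foot : forall x, dist x < s -> forall a b, J a -> J b ->
  N (x - a) = dist x -> N (x - b) = dist x -> a = b.

Lemma foot_unique x a : dist x < s -> J a -> N (x - a) = dist x -> foot x = a.
Proof. by move=> xs Ja e; apply: (uniq_foot xs) (footJ x) Ja (footE x) e. Qed.

Lemma foot_cont x e : dist x < s -> 0 < e -> exists2 d, 0 < d &
  forall y, N (y - x) < d -> N (foot y - foot x) < e.
Proof.
move=> xs e0.
have [||a Ja|m m0 hm] := @compact_modulus R _ J (fun a => N (x - a) - dist x)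
  (fun a => N (a - foot x)) e cJ.
- move=> a _ r /(std_to_norm hN)[d d0 hd]; exists d => // b _ /hd h.
  have h1 := norm_dist hN (x - b) (x - a); have h2 := norm_dist hN (b - foot x) (a - foot x).
  have e1 : x - b - (x - a) = - (b - a) by vec.
  have e2 : b - foot x - (a - foot x) = b - a by vec.
  rewrite e1 (normN hN) in h1; rewrite e2 in h2.
  by split; [rewrite opprB addrA subrK|]; lin.
- by move=> a Ja; rewrite subr_ge0; exact: dist_le.
- by move=> /eqP; rewrite subr_eq0 => /eqP /(foot_unique xs Ja) <-; rewrite subrr (norm0 hN).
exists (m / 2); first by lin.
move=> y hy; apply: hm (footJ y) _.
have h1 := dist_lip y x; have h2 := norm_triB hN x y (foot y).
rewrite footE (normC hN x y) in h2; lin.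
Qed.

Lemma foot_pair_cont p q r : dist p < s -> dist q < s -> 0 < r ->
  exists2 d : R, 0 < d & forall p' q', `|(p', q') - (p, q)| < d ->
    `|N (p' - q') - N (p - q)| < r /\ `|N (foot p' - foot q') - N (foot p - foot q)| < r.
Proof.
move=> ps qs r0; have r4 : 0 < r / 4 by lin.
have [d1 d10 h1] := foot_cont ps r4; have [d2 d20 h2] := foot_cont qs r4.
have dd : 0 < Num.min (r / 4) (Num.min d1 d2) by rewrite !lt_min r4 d10.
have [d d0 hd] := std_to_norm hN dd; exists d => // p' q'.
rewrite prod_normE gt_max /= => /andP[/hd + /hd].
rewrite !lt_min => /and3P[k1 /h1 k2 _] /and3P[k3 _ /h2 k4].
split; apply: le_lt_trans (norm_dist2 hN _ _ _ _) _; lin.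
Qed.

(** A fixed-point argument in which the plane lets the intermediate value theorem replace Brouwer's.
    Among the points [y th] just beyond [x], one is such that the direction from [x] to [y th] is
    parallel to that from its foot to [x]. Then [x] lies between [y th] and its foot, so uniqueness
    makes this foot that of [x], which forces [th = 0]. *)
Lemma sun_local x : 0 < dist x < s -> exists2 eta, 0 < eta &
  dist (x + eta *: (x - foot x)) = (1 + eta) * dist x.
Proof.
move=> /andP[x0 xs]; set a := foot x; pose v := x - a.
have v0 : v != 0.
  by apply/eqP => e; move: x0; rewrite -footE -/a -/v e (norm0 hN) ltxx.
have dvv := dotvv_gt0 v0.
pose k := perp v.
have e0 : 0 < dot v v / 2 by lin.
have [d1 d10 hd1] := dot_cont hN v v e0.
have [d2 d20 hd2] := det_cont hN v v e0.
have dd : 0 < Num.min d1 d2 by rewrite lt_min d10.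
have [d d0 hd] := foot_cont xs dd.
pose L := N v + N k + 1.
have L0 : 0 < L by have := norm_ge0 hN v; have := norm_ge0 hN k; rewrite /L; lin.
pose eta := Num.min d (s - dist x) / (2 * L).
have eta0 : 0 < eta by rewrite divr_gt0 ?mulr_gt0 // lt_min d0 subr_gt0.
have [y yE] : exists y : R -> plane R, forall th, y th = x + eta *: (v + th *: k).
  by exists (fun th => x + eta *: (v + th *: k)).
have yx th : -1 <= th <= 1 -> N (y th - x) < Num.min d (s - dist x).
  move=> /andP[t1 t2]; rewrite yE (_ : _ - x = eta *: (v + th *: k)); last by vec.
  rewrite (normZp hN) ?ltW //.
  apply: le_lt_trans (_ : eta * L < _).
    rewrite ler_pM2l //; apply: le_trans (norm_tri hN _ _) _.
    rewrite (norm_scale hN) /L.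
    have : `|th| <= 1 by rewrite ler_norml t1.
    by move=> /(ler_wpM2r (norm_ge0 hN k)); rewrite mul1r; lin.
  have -> : eta * L = Num.min d (s - dist x) / 2.
    by rewrite /eta invfM mulrA mulfVK // gt_eqF.
  have : 0 < Num.min d (s - dist x) by rewrite lt_min d0 subr_gt0.
  by move: (Num.min _ _) => A; lin.
clearbody eta; have [p pE] : exists p : R -> plane R, forall th, p th = x - foot (y th).
  by exists (fun th => x - foot (y th)).
have ys th : -1 <= th <= 1 -> dist (y th) < s.
  move=> /yx; rewrite lt_min => /andP[_ h]; have := dist_lip (y th) x; lin.
have pv th : -1 <= th <= 1 -> N (p th - v) < Num.min d1 d2.
  move=> /yx; rewrite lt_min => /andP[/hd + _]; rewrite (normC hN).
  by rewrite (_ : a - foot (y th) = p th - v) // pE /v; vec.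
have pdot th : -1 <= th <= 1 -> dot v v / 2 < dot v (p th).
  move=> /pv; rewrite lt_min => /andP[/hd1 + _]; rewrite ltr_norml => /andP[h _]; lin.
have pdet th : -1 <= th <= 1 -> `|det v (p th)| < dot v v / 2.
  move=> /pv; rewrite lt_min => /andP[_ h]; have := hd2 v (p th).
  by rewrite subrr (norm0 hN) detxx subr0; apply.
(* At a zero, [p th] is a multiple of [v + th *: k], the direction from [x] to [y th]. The signs at
   -1 and 1 come from [pdot] and [pdet]. *)
have [|||th thI] := @IVT_eps R (fun th => th * dot v (p th) - det v (p th)) (-1) 1 0.
- lin.
- move=> th tI r r0.
  have r3 : 0 < r / 3 by lin.
  have [c1 c10 hc1] := dot_cont hN v (p th) r3.
  have [c2 c20 hc2] := det_cont hN v (p th) r3.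
  have cc : 0 < Num.min c1 c2 by rewrite lt_min c10.
  have [c c0 hc] := foot_cont (ys th tI) cc.
  have [M M0 hM] := dot_bound hN v.
  have k1 : 0 < N k + 1 by have := norm_ge0 hN k; lin.
  pose Q := `|dot v (p th)| + 1.
  have Q0 : 0 < Q by rewrite /Q; have := normr_ge0 (dot v (p th)); lin.
  exists (Num.min (c / (eta * (N k + 1))) (r / (3 * Q))).
    by rewrite lt_min !divr_gt0 ?mulr_gt0 ?ltr0n.
  move=> th' t'I; rewrite lt_min => /andP[h1 h2].
  have hp : N (p th' - p th) < Num.min c1 c2.
    rewrite (_ : p th' - p th = - (foot (y th') - foot (y th))); last by rewrite !pE; vec.
    rewrite (normN hN); apply: hc.
    rewrite (_ : y th' - y th = (eta * (th' - th)) *: k); last by rewrite !yE; vec.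
    rewrite (norm_scale hN) normrM (gtr0_norm eta0).
    rewrite ltr_pdivlMr ?mulr_gt0 // in h1.
    apply: le_lt_trans h1; rewrite mulrAC mulrC ler_wpM2l //.
    by rewrite ler_pM2l //; lin.
  move: hp; rewrite lt_min => /andP[p1 p2].
  have {}p1 := hc1 _ p1.
  have {}p2 : `|det v (p th') - det v (p th)| < r / 3.
    by apply: hc2 => //; rewrite subrr (norm0 hN).
  have -> : th' * dot v (p th') - det v (p th') - (th * dot v (p th) - det v (p th)) =
    (th' - th) * dot v (p th) + (th' * (dot v (p th') - dot v (p th)) -
    (det v (p th') - det v (p th))).
    move: (dot v (p th')) (dot v (p th)) (det v (p th')) (det v (p th)); clear.
    by move=> *; ring.
  have q1 : `|(th' - th) * dot v (p th)| < r / 3.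
    rewrite normrM; apply: le_lt_trans (_ : `|th' - th| * Q < _).
      by rewrite ler_wpM2l // /Q; lin.
    by rewrite ltr_pdivlMr ?mulr_gt0 ?ltr0n // in h2; lin.
  have q2 : `|th' * (dot v (p th') - dot v (p th))| <= `|dot v (p th') - dot v (p th)|.
    rewrite normrM -[leRHS]mul1r ler_wpM2r // ler_norml.
    by case/andP: t'I => -> ->.
  have q3 := ler_normD ((th' - th) * dot v (p th)) (th' * (dot v (p th') - dot v (p th)) -
    (det v (p th') - det v (p th))).
  have q4 := ler_normB (th' * (dot v (p th') - dot v (p th))) (det v (p th') - det v (p th)).
  move: q1 q2 q3 q4 p1 p2; clear; lin.
- left; have i1 : -1 <= (-1 : R) <= 1 by apply/andP; split; lin.
  have i2 : -1 <= (1 : R) <= 1 by apply/andP; split; lin.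
  have := pdot _ i1; have := pdet _ i1; have := pdot _ i2; have := pdet _ i2.
  rewrite !ltr_norml => /andP[a1 a2] a3 /andP[a4 a5] a6.
  by move: a1 a2 a3 a4 a5 a6; clear; move=> *; apply/andP; split; lin.
move=> eth.
have hdot := pdot th thI.
pose al := dot v (p th) / dot v v.
have al0 : 0 < al by rewrite divr_gt0 //; lin.
have nz : dot v v != 0 by rewrite gt_eqF.
have ep : p th = al *: (v + th *: k).
  apply: (scalerI nz); rewrite scalerA /al mulrCA mulfV // mulr1.
  have : det v (p th) = th * dot v (p th) by lin.
  rewrite /k; move: (p th) => q e.
  rewrite scalerDr scalerA mulrC -e.
  by apply: plane_eqP; rewrite /det /dot !mxE /=; ring.
clearbody al; have ey : y th = foot (y th) + (1 + eta / al) *: p th.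
  by rewrite scalerDl scale1r {2}ep scalerA divfK ?gt_eqF // pE [in RHS]addrA subrKC yE.
have fy : foot x = foot (y th).
  apply: (foot_unique xs (footJ _)).
  have h : dist (foot (y th) + (1 + eta / al) *: p th) = (1 + eta / al) * N (p th).
    rewrite -ey -footE {1}ey (_ : _ - foot _ = (1 + eta / al) *: p th); last by rewrite [foot _ + _]addrC addrK.
    by rewrite (normZp hN) // addr_ge0 ?ler01 // divr_ge0 ?ltW.
  have := dist_ray (r := 1) _ (footJ (y th)) h.
  rewrite ler01 lerDl divr_ge0 ?ltW // => /(_ isT).
  by rewrite !scale1r mul1r pE subrKC => <-.
have th0 : th = 0.
  have : p th = v by rewrite pE -fy.
  rewrite ep => /(congr1 (det v)); rewrite detxx detZr detDr detxx add0r detZr.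
  have -> : det v k = dot v v by rewrite /k /det /dot !mxE /=; ring.
  by move=> /eqP; rewrite !mulf_eq0 (negPf nz) orbF (gt_eqF al0) => /eqP.
exists eta => //.
have ye : y th = x + eta *: (x - foot x) by rewrite yE th0 scale0r addr0.
rewrite -ye -footE -fy ye (_ : _ - foot x = (1 + eta) *: (x - foot x)); last first.
  by rewrite scalerDl scale1r addrAC.
by rewrite (normZp hN) ?footE //; lin.
Qed.

(* In the language of best approximation, a closed set with unique nearest points is a sun. *)
Lemma sun x c : 0 < dist x < s -> 0 <= c -> c * dist x < s ->
  dist (foot x + c *: (x - foot x)) = c * dist x.
Proof.
move=> /andP[x0 xs] c0 cs; set a := foot x; set v := x - a.
have nv : N v = dist x by rewrite footE.
pose S := [set r | 0 <= r /\ dist (a + r *: v) = r * dist x].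
have S1 : S 1 by split; rewrite ?ler01 // scale1r mul1r subrKC.
apply: contrapT => nc.
have ub r : S r -> r <= c.
  move=> [r0 hr]; rewrite leNgt; apply/negP => cr; apply: nc.
  rewrite -nv in hr *; apply: dist_ray hr; last exact: footJ.
  by rewrite c0 ltW.
have hS : has_sup S by split; [exists 1|exists c => r; exact: ub].
(* The ray keeps its foot up to [m] by continuity of the distance, and [sun_local] extends it beyond
   [m]. *)
set m := sup S.
have m1 : 1 <= m by apply: sup_upper_bound.
have mc : m <= c by apply: ge_sup; [exists 1|exact: ub].
have Sm : dist (a + m *: v) = m * dist x.
  apply/eqP; rewrite eq_le; apply/andP; split.
    have := dist_le (a + m *: v) (footJ x).
    rewrite (_ : _ - foot x = m *: v) ?(normZp hN) ?nv //; first lin.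
    by rewrite -/a; vec.
  rewrite leNgt; apply/negP => h.
  pose e := (m * dist x - dist (a + m *: v)) / (2 * dist x).
  have e0 : 0 < e by rewrite divr_gt0 ?subr_gt0 // mulr_gt0.
  have [r Sr mr] := sup_adherent e0 hS.
  have rm : r <= m by apply: sup_upper_bound.
  have := dist_lip (a + r *: v) (a + m *: v).
  rewrite (_ : _ - (a + m *: v) = (r - m) *: v); last by vec.
  rewrite (norm_scale hN) nv Sr.2 ler0_norm; last by lin.
  have : (m - r) * dist x < e * dist x by rewrite ltr_pM2r // ltrBlDr -ltrBlDl.
  rewrite (_ : e * dist x = (m * dist x - dist (a + m *: v)) / 2); last first.
    by rewrite /e; field; rewrite gt_eqF.
  by move: h; rewrite -/m; lin.
have mx : 0 < m * dist x by rewrite mulr_gt0 //; lin.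
have ms : m * dist x < s by apply: le_lt_trans cs; rewrite ler_pM2r.
have fm : foot (a + m *: v) = a.
  apply: foot_unique; rewrite ?Sm //; first exact: footJ.
  rewrite (_ : _ - a = m *: v); last by vec.
  by rewrite (normZp hN) ?nv //; lin.
have [|eta eta0] := @sun_local (a + m *: v); first by rewrite Sm mx.
rewrite fm (_ : _ + eta *: _ = a + (m + eta * m) *: v); last by vec.
rewrite Sm => h.
have : S (m + eta * m).
  split; last by rewrite h; ring.
  by rewrite addr_ge0 ?mulr_ge0 //; lin.
move=> /(sup_upper_bound hS); rewrite -/m.
have : 0 < eta * m by rewrite mulr_gt0 //; lin.
lin.
Qed.

End Reach.
End Distance.

Section NormalField.
Context {R : realType} (N : plane R -> R) (hN : is_norm N) (F : set (plane R)).
Hypothesis cF : compact F.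
Local Notation J := (boundary F).
Implicit Types (x y z v w p a b : plane R).

Lemma compact_closedE : closure F = F.
Proof. by apply/esym/closure_id; apply: compact_closed => //; exact: norm_hausdorff. Qed.

Lemma boundaryE x : J x <-> F x /\ ~ interior F x.
Proof. by rewrite /boundary compact_closedE. Qed.

Lemma interior_normP x : interior F x <-> exists2 d, 0 < d & forall y, N (y - x) < d -> F y.
Proof.
split=> [/interiorP_eps [d d0 hd]|[d d0 hd]].
  have [e e0 he] := norm_to_std hN d0; exists e => // y /he; exact: hd.
apply/interiorP_eps; have [e e0 he] := std_to_norm hN d0; exists e => // y /he; exact: hd.
Qed.

Lemma compact_boundary : compact J.
Proof.
apply: (@subclosed_compact _ _ F) => //; last by move=> x /boundaryE[].
apply: closedI; first exact: closed_closure.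
by rewrite closedC; exact: open_interior.
Qed.

(** The only separation property of the boundary that is used, in place of the Jordan curve theorem:
    the first point of [F] on the segment is a boundary point. *)
Lemma seg_cross x y : ~ F x -> F y -> exists2 th : R, 0 <= th <= 1 & J (x + th *: (y - x)).
Proof.
move=> nFx Fy.
pose S := [set th : R | 0 <= th <= 1 /\ F (x + th *: (y - x))].
have S1 : S 1 by split; [rewrite ler01 lexx|rewrite scale1r subrKC].
have hS : has_inf S by split; [exists 1|exists 0 => th [/andP[]]].
set m := inf S.
have m0 : 0 <= m by apply: lb_le_inf; [exists 1|move=> th [/andP[]]].
have m1 : m <= 1 by apply: ge_inf => //; case: hS.
have L0 : 0 < N (y - x) + 1 by have := norm_ge0 hN (y - x); lin.
exists m; first by rewrite m0.
apply/boundaryE; split.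
  apply: contrapT => nm.
  have [d d0 hd] := compact_norm_closed hN cF nm.
  have [|th [tI Sth] tm] := @inf_adherent _ S (d / (N (y - x) + 1)) _ hS; first by rewrite divr_gt0.
  case: (hd (x + th *: (y - x))) => //.
  rewrite (_ : _ - (x + m *: _) = (th - m) *: (y - x)); last by vec.
  have mth : m <= th by apply: ge_inf; [case: hS|split].
  rewrite (normZp hN) ?subr_ge0 //.
  move: tm; rewrite -/m -ltrBlDl ltr_pdivlMr //.
  by have := norm_ge0 hN (y - x); nra.
move=> /interior_normP [d d0 hd].
have [em|em] := eqVneq m 0.
  by apply: nFx; apply: hd; rewrite em scale0r addr0 subrr (norm0 hN).
have mp : 0 < m by rewrite lt_neqAle eq_sym em.
pose e := Num.min m (d / (2 * (N (y - x) + 1))).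
have e0 : 0 < e by rewrite lt_min mp divr_gt0 // mulr_gt0.
have em1 : e <= m by rewrite ge_min lexx.
have ed : e * (2 * (N (y - x) + 1)) <= d.
  by rewrite -ler_pdivlMr ?mulr_gt0 // ge_min lexx orbT.
have : S (m - e).
  split; first by apply/andP; split; lin.
  apply: hd; rewrite (_ : _ - (x + m *: _) = (- e) *: (y - x)); last by vec.
  rewrite (norm_scale hN) normrN gtr0_norm //.
  have := mulr_ge0 (ltW e0) (norm_ge0 hN (y - x)); lin.
by move=> Sm; have := ge_inf hS.2 Sm; rewrite -/m; lin.
Qed.

Hypothesis J0 : J !=set0.
Let cJ := compact_boundary.
Local Notation dJ := (dist N J).
Local Notation ft := (foot hN cJ J0).

Lemma out_ball x y : ~ F x -> N (y - x) < dJ x -> ~ F y.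
Proof.
move=> nF yx Fy; have [th /andP[t0 t1] Jp] := seg_cross nF Fy.
have := dist_le hN x Jp; rewrite (_ : x - _ = (- th) *: (y - x)); last by vec.
rewrite (norm_scale hN) normrN ger0_norm //.
have := ler_wpM2r (norm_ge0 hN (y - x)) t1; lin.
Qed.

Lemma in_ball x y : F x -> N (y - x) < dJ x -> F y.
Proof.
move=> Fx yx; apply: contrapT => nF; have [th /andP[t0 t1] Jp] := seg_cross nF Fx.
have := dist_le hN x Jp; rewrite (_ : x - _ = (1 - th) *: (x - y)); last by vec.
rewrite (normZp hN) ?subr_ge0 // (normC hN) => h.
have := ler_wpM2r (norm_ge0 hN (y - x)) t0; lin.
Qed.

Variable s : R.
Hypothesis uniq_foot : forall x, dJ x < s -> forall a b, J a -> J b ->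
  N (x - a) = dJ x -> N (x - b) = dJ x -> a = b.
Hypothesis inner_near : forall a e, J a -> 0 < e -> exists y, [/\ F y, ~ J y & N (y - a) < e].

Lemma outer_near a e : J a -> 0 < e -> exists y, [/\ ~ F y, ~ J y & N (y - a) < e].
Proof.
move=> /boundaryE[_ na] e0; apply: contrapT => h; apply: na; apply/interior_normP.
exists e => // y ye; apply: contrapT => nF; apply: h; exists y; split => //.
by move=> /boundaryE[].
Qed.

Section Side.
(** [S] stands for either side of the boundary: it is later instantiated by [F] and by its
    complement. *)
Variable S : plane R -> Prop.
Hypothesis S_seg : forall x y, S x ->
  (forall th : R, 0 <= th <= 1 -> ~ J (x + th *: (y - x))) -> S y.
Hypothesis S_near : forall a e, J a -> 0 < e -> exists y, [/\ S y, ~ J y & N (y - a) < e].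

(** By [sun] the distance to the boundary stays positive along the ray from the foot through [x], so
    the side cannot change. *)
Lemma side_scale x c : 0 < dJ x < s -> 0 < c -> c * dJ x < s -> S x ->
  S (ft x + c *: (x - ft x)).
Proof.
move=> xs c0 cs Sx; have /andP[x0 x1] := xs; apply: S_seg Sx _ => th /andP[t0 t1].
rewrite (_ : x + _ = ft x + (1 + th * (c - 1)) *: (x - ft x)); last by vec.
set r := 1 + _.
have r0 : 0 < r.
  have -> : r = (1 - th) + th * c by rewrite /r; ring.
  have [->|th0] := eqVneq th 1; first by rewrite subrr add0r mul1r.
  have h1 : 0 < 1 - th by rewrite subr_gt0 lt_neqAle th0.
  have := mulr_ge0 t0 (ltW c0); lin.
have rs : r * dJ x < s.
  have -> : r * dJ x = (1 - th) * dJ x + th * (c * dJ x) by rewrite /r; ring.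
  have [->|th0] := eqVneq th 0; first by rewrite subr0 mul1r mul0r addr0.
  have h1 : 0 < th by rewrite lt_neqAle eq_sym th0.
  have h2 : th * (c * dJ x) < th * s by rewrite ltr_pM2l.
  have h3 : (1 - th) * dJ x <= (1 - th) * s by rewrite ler_wpM2l ?subr_ge0 // ltW.
  lin.
move=> /(dist_J hN cJ J0); rewrite (sun hN cJ J0 uniq_foot xs (ltW r0) rs) => /eqP.
by rewrite mulf_eq0 !gt_eqF.
Qed.

(** Otherwise the feet of the compact set of points of [S] at distance [r] would stay at least [m]
    away from [a]. But a point of [S] within [m / 2] of [a], pushed along its ray to distance [r],
    keeps a foot closer to [a] than [m]. *)
Lemma center_exists r a : 0 < r < s -> J a -> exists x, [/\ dJ x = r, S x & ft x = a].
Proof.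
move=> /andP[r0 rs] Ja; apply: contrapT => h.
pose C := [set x | dJ x = r /\ S x].
have cC : compact C.
  apply: (compact_normP hN).
    move=> x nC; have [e|ne] := eqVneq (dJ x) r.
      exists r => // y yx [ey Sy]; apply: nC; split => //.
      apply: S_seg Sy _ => th /andP[t0 t1] /(dist_le hN y).
      rewrite ey (_ : y - _ = th *: (y - x)); last by vec.
      rewrite (normZp hN) //.
      have := ler_wpM2r (norm_ge0 hN (y - x)) t1; lin.
    exists `|dJ x - r|; first by rewrite normr_gt0 subr_eq0.
    move=> y yx [ey _]; have := dist_lip_abs hN cJ J0 x y.
    by rewrite ey (normC hN); lin.
  have [M hM] := compact_norm_bounded hN cJ.
  exists (r + M) => x [ex _]; have := hM _ (footJ hN cJ J0 x).
  have := norm_tri hN (x - ft x) (ft x); rewrite subrK footE ex; lin.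
have [||m m0 hm] := @compact_norm_positive _ _ hN C (fun x => N (ft x - a)) cC.
- move=> x [ex _] e e0.
  have [|d d0 hd] := foot_cont hN cJ J0 uniq_foot (x := x) _ e0; first by rewrite ex.
  exists d => // y _ /hd hy; apply: le_lt_trans hy; apply: le_trans (norm_dist hN _ _) _.
  by rewrite (_ : _ - _ = ft y - ft x) //; vec.
- move=> x [ex Sx]; apply: (norm_gt0 hN); rewrite subr_eq0; apply/eqP => e.
  by apply: h; exists x.
have s0 : 0 < s by lin.
have mm : 0 < Num.min s (m / 2) by rewrite lt_min s0; lin.
have [y [Sy nJy]] := S_near Ja mm; rewrite lt_min => /andP[y1 y2].
have dy := dist_gt0 hN cJ J0 nJy.
have dya := dist_le hN y Ja.
have ys : 0 < dJ y < s by rewrite dy; lin.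
have q : r / dJ y * dJ y = r by rewrite divfK // gt_eqF.
have rd : 0 < r / dJ y by rewrite divr_gt0.
have qs : r / dJ y * dJ y < s by rewrite q.
have e1 := sun hN cJ J0 uniq_foot ys (ltW rd) qs; rewrite q in e1.
have S1 := side_scale ys rd qs Sy.
have := hm _ (conj e1 S1).
have -> : ft (ft y + (r / dJ y) *: (y - ft y)) = ft y.
  apply: (foot_unique hN cJ J0 uniq_foot); [by rewrite e1|exact: footJ|].
  rewrite e1 (_ : _ - ft y = (r / dJ y) *: (y - ft y)); last by vec.
  by rewrite (normZp hN) ?(ltW rd) // footE.
have := norm_triB hN (ft y) y a; rewrite (normC hN (ft y) y) footE.
lin.
Qed.

End Side.

Lemma out_seg x y : ~ F x ->
  (forall th : R, 0 <= th <= 1 -> ~ J (x + th *: (y - x))) -> ~ F y.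
Proof. by move=> nF h Fy; have [th tI /h] := seg_cross nF Fy; apply. Qed.

Lemma in_seg x y : F x ->
  (forall th : R, 0 <= th <= 1 -> ~ J (x + th *: (y - x))) -> F y.
Proof.
move=> Fx h; apply: contrapT => nF; have [th /andP[t0 t1]] := seg_cross nF Fx.
rewrite (_ : y + _ = x + (1 - th) *: (y - x)); last by vec.
by apply: h; apply/andP; split; lin.
Qed.

(* An outer and an inner ball of the same radius touching at the same point are symmetric
   about it: their centers x, x' and the point x + x' - a would otherwise give x two
   nearest points. *)
Lemma centers_opposite r a x x' : 0 < r < s -> dJ x = r -> dJ x' = r -> ~ F x -> F x' ->
  ft x = a -> ft x' = a -> x + x' = a + a.
Proof.
move=> /andP[r0 rs] ex ex' nFx Fx' fx fx'.
have Ja : J a by rewrite -fx; exact: footJ.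
have nx : N (x - a) = r by rewrite -ex -fx footE.
have nx' : N (x' - a) = r by rewrite -ex' -fx' footE.
set y := x + x' - a.
have yx : N (y - x) = r by rewrite (_ : y - x = x' - a) // /y; vec.
have yx' : N (y - x') = r by rewrite (_ : y - x' = x - a) // /y; vec.
(* [y] lies on both spheres. The open ball about [x'] is inside [F] and the open ball about [x] is
   outside, so [y] is a limit of points of both kinds. *)
have Jy : J y.
  apply/boundaryE; split.
    apply: contrapT => nF; have [d d0 hd] := compact_norm_closed hN cF nF.
    pose e := Num.min 1 (d / (2 * r)).
    have e0 : 0 < e by rewrite lt_min ltr01 divr_gt0 // mulr_gt0.
    have e1 : e <= 1 by rewrite ge_min lexx.
    have e2 : e * (2 * r) <= d by rewrite -ler_pdivlMr ?mulr_gt0 // ge_min lexx orbT.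
    have re : 0 < e * r by rewrite mulr_gt0.
    apply: (hd (x' + (1 - e) *: (y - x'))).
      rewrite (_ : _ - y = (- e) *: (y - x')); last by vec.
      by rewrite (norm_scale hN) normrN gtr0_norm // yx'; lin.
    apply: in_ball Fx' _; rewrite (_ : _ - x' = (1 - e) *: (y - x')); last by vec.
    by rewrite (normZp hN) ?subr_ge0 // yx' ex'; lin.
  move=> /interior_normP [d d0 hd].
  pose e := Num.min 1 (d / (2 * r)).
  have e0 : 0 < e by rewrite lt_min ltr01 divr_gt0 // mulr_gt0.
  have e1 : e <= 1 by rewrite ge_min lexx.
  have e2 : e * (2 * r) <= d by rewrite -ler_pdivlMr ?mulr_gt0 // ge_min lexx orbT.
  have re : 0 < e * r by rewrite mulr_gt0.
  have : F (x + (1 - e) *: (y - x)).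
    apply: hd; rewrite (_ : _ - y = (- e) *: (y - x)); last by vec.
    by rewrite (norm_scale hN) normrN gtr0_norm // yx; lin.
  apply: out_ball nFx _; rewrite (_ : _ - x = (1 - e) *: (y - x)); last by vec.
  by rewrite (normZp hN) ?subr_ge0 // yx ex; lin.
have : a = y.
  rewrite -fx; apply: (foot_unique hN cJ J0 uniq_foot) => //; first by rewrite ex.
  by rewrite (normC hN) yx ex.
by move=> e; rewrite {1}e /y; vec.
Qed.

Hypothesis s0 : 0 < s.

(** The outer and the inner center over a boundary point are opposite, so each determines the other
    and both are unique; [u a] points to the outer one. Uniform continuity follows by compactness,
    since outer points at distance [r] with the same foot coincide. Any [r] between 0 and [s] would
    do. *)
Lemma normal_exists : exists u : plane R -> plane R, 
  [/\ forall a, J a -> N (u a) = 1,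
      forall a r, J a -> 0 <= r < s -> dJ (a + r *: u a) = r /\ dJ (a - r *: u a) = r,
      forall a r, J a -> 0 < r < s -> ~ F (a + r *: u a) /\ F (a - r *: u a),
      forall x, ~ F x -> dJ x < s -> x = ft x + dJ x *: u (ft x) &
      forall e, 0 < e -> exists2 d, 0 < d &
        forall a b, J a -> J b -> N (a - b) < d -> N (u a - u b) < e].
Proof.
pose r := s / 2; have s0' := s0.
have rs : 0 < r < s by rewrite /r; lin.
have r0 : 0 < r by case/andP: rs.
have rz : r != 0 by rewrite gt_eqF.
have ex_out a : J a -> exists x, [/\ dJ x = r, ~ F x & ft x = a].
  exact: (@center_exists (fun x => ~ F x) out_seg outer_near).
have ex_in a : J a -> exists x, [/\ dJ x = r, F x & ft x = a].
  exact: (@center_exists F in_seg inner_near).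
have [c hc] : exists c, forall a, J a -> [/\ dJ (c a) = r, ~ F (c a) & ft (c a) = a].
  exists (fun a => match pselect (J a) with left h => projT1 (cid (ex_out a h)) | _ => 0 end).
  by move=> a Ja; case: pselect => // h; case: cid.
have [c' hc'] : exists c, forall a, J a -> [/\ dJ (c a) = r, F (c a) & ft (c a) = a].
  exists (fun a => match pselect (J a) with left h => projT1 (cid (ex_in a h)) | _ => 0 end).
  by move=> a Ja; case: pselect => // h; case: cid.
have opp a : J a -> c a + c' a = a + a.
  by move=> Ja; have [? ? ?] := hc a Ja; have [? ? ?] := hc' a Ja; apply: (@centers_opposite r).
pose u a := r^-1 *: (c a - a).
have cE a : c a = a + r *: u a by rewrite /u scalerA mulfV // scale1r subrKC.
have c'E a : J a -> c' a = a - r *: u a.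
  by move=> /opp e; rewrite -(addKr (c a) (c' a)) e cE; vec.
have u1 a : J a -> N (u a) = 1.
  move=> Ja; have [e _ f] := hc a Ja; rewrite /u (normZp hN) ?invr_ge0 ?(ltW r0) //.
  by have := footE hN cJ J0 (c a); rewrite f e => ->; rewrite mulVf.
have scl (a v : plane R) q : a + (q / r) *: (a + r *: v - a) = a + q *: v.
  by rewrite [a + r *: v]addrC addrK scalerA divfK.
have D a q : J a -> 0 <= q < s -> dJ (a + q *: u a) = q /\ dJ (a - q *: u a) = q.
  move=> Ja /andP[q0 qs]; have qr : 0 <= q / r by rewrite divr_ge0 // ltW.
  have qe : q / r * r = q by rewrite divfK.
  have [e _ f] := hc a Ja; have [e' _ f'] := hc' a Ja; split.
    have := @sun _ _ hN J cJ J0 s uniq_foot (c a) (q / r).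
    by rewrite e f qe rs => /(_ isT qr qs); rewrite cE scl.
  have := @sun _ _ hN J cJ J0 s uniq_foot (c' a) (q / r).
  rewrite e' f' qe rs => /(_ isT qr qs).
  by rewrite c'E // -!scalerN scl.
exists u; split => //.
- move=> a q Ja /andP[q0 qs]; have qr : 0 < q / r by rewrite divr_gt0.
  have qe : q / r * r = q by rewrite divfK.
  have [e Sx f] := hc a Ja; have [e' Sx' f'] := hc' a Ja; split.
    have := @side_scale (fun x => ~ F x) out_seg (c a) (q / r).
    by rewrite e f qe rs => /(_ isT qr qs Sx); rewrite cE scl.
  have := @side_scale F in_seg (c' a) (q / r).
  rewrite e' f' qe rs => /(_ isT qr qs Sx').
  by rewrite c'E // -!scalerN scl.
- move=> x nFx xs; set a := ft x; have Ja : J a := footJ hN cJ J0 x.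
  have x0 : 0 < dJ x by apply: dist_gt0 => // /boundaryE[].
  have xI : 0 < dJ x < s by rewrite x0.
  pose q := r / dJ x; have q0 : 0 < q by rewrite divr_gt0.
  have qe : q * dJ x = r by rewrite /q divfK // gt_eqF.
  have qs : q * dJ x < s by rewrite qe; case/andP: rs.
  have e1 := sun hN cJ J0 uniq_foot xI (ltW q0) qs; rewrite qe in e1.
  have S1 := @side_scale (fun x => ~ F x) out_seg x q xI q0 qs nFx.
  have [e' Sx' f'] := hc' a Ja.
  have := @centers_opposite r a (a + q *: (x - a)) (c' a) rs e1 e' S1 Sx' _ f'.
  have -> : ft (a + q *: (x - a)) = a.
    apply: (foot_unique hN cJ J0 uniq_foot); [by rewrite e1; case/andP: rs|exact: footJ|].
    rewrite e1 (_ : _ - a = q *: (x - a)); last by vec.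
    by rewrite (normZp hN) ?(ltW q0) // footE.
  move=> /(_ erefl); rewrite -(opp a Ja) => /addIr; rewrite cE => /addrI h.
  have xd : dJ x = q^-1 * r by rewrite /q invfM invrK mulrC mulrA mulfV ?mul1r.
  rewrite xd -scalerA -h scalerA mulVf ?scale1r ?subrKC //.
  by rewrite gt_eqF.
- move=> e e0; pose C := [set x | dJ x = r /\ ~ F x].
  have cC : compact C.
    apply: (compact_normP hN).
      move=> x nC; have [ee|ne] := eqVneq (dJ x) r.
        exists r => // y yx [ey Sy]; apply: nC; split => //.
        by apply: out_ball Sy _; rewrite (normC hN) ey.
      exists `|dJ x - r|; first by rewrite normr_gt0 subr_eq0.
      move=> y yx [ey _]; have := dist_lip_abs hN cJ J0 x y.
      by rewrite ey (normC hN); lin.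
    have [M hM] := compact_norm_bounded hN cJ.
    exists (r + M) => x [ex _]; have := hM _ (footJ hN cJ J0 x).
    have := norm_tri hN (x - ft x) (ft x); rewrite subrK footE ex; lin.
  have cK : compact (C `*` C)%classic by apply: compact_setX.
  pose er := e * r / 2; have er0 : 0 < er by rewrite /er; have := mulr_gt0 e0 r0; lin.
  pose f (p : plane R * plane R) := N (ft p.1 - ft p.2).
  pose g (p : plane R * plane R) := N (p.1 - p.2).
  have [[x y] [[/= ex _] [/= ey _]] q q0||[x y] [[/= ex nx] [/= ey ny]] /(norm_eq0 hN)/eqP|m m0 hm] := @compact_modulus R _ _ f g er cK.
  + have xs : dJ x < s by rewrite ex; case/andP: rs.
    have ys : dJ y < s by rewrite ey; case/andP: rs.
    have [d d0 hd] := foot_pair_cont hN cJ J0 uniq_foot xs ys q0.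
    by exists d => // -[x' y'] _ /hd[].
  + by move=> p _; exact: norm_ge0.
  + rewrite subr_eq0 => /eqP ef; have Jf : J (ft x) := footJ hN cJ J0 x.
    have [e' Sx' f'] := hc' (ft x) Jf.
    have o1 := @centers_opposite r (ft x) x (c' (ft x)) rs ex e' nx Sx' erefl f'.
    have o2 := @centers_opposite r (ft x) y (c' (ft x)) rs ey e' ny Sx' (esym ef) f'.
    by move: o1; rewrite -o2 /g /= => /addIr ->; rewrite subrr (norm0 hN).
  have md : 0 < Num.min m er by rewrite lt_min m0.
  exists (Num.min m er) => // a b Ja Jb; rewrite lt_min => /andP[ab1 ab2].
  have [ea na fa] := hc a Ja; have [eb nb fb] := hc b Jb.
  have := hm (c a, c b) (conj (conj ea na) (conj eb nb)); rewrite /f /g /= fa fb => /(_ ab1) h2.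
  rewrite (_ : u a - u b = r^-1 *: ((c a - c b) - (a - b))); last by rewrite /u; vec.
  rewrite (normZp hN) ?invr_ge0 ?(ltW r0) // mulrC ltr_pdivrMr //.
  have := norm_tri hN (c a - c b) (- (a - b)); rewrite (normN hN) => h3.
  apply: le_lt_trans h3 _; have -> : e * r = er + er by rewrite /er; field.
  by lin.
Qed.

End NormalField.

(** * The outer curve and its chords *)

(* The boundary of F, parametrized by the circle R / Z through a, with its outer normal
   field u, inside the tube of radius s in which nearest points are unique. *)
Record tube {R : realType} (N : plane R -> R) (F : set (plane R)) (s : R)
    (a u : R -> plane R) : Prop := Tube {
  tube_norm : is_norm N;
  tube_compact : compact F;
  tube_unique : forall x, dist N (boundary F) x < s -> forall p q, boundary F p ->
    boundary F q -> N (x - p) = dist N (boundary F) x ->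
    N (x - q) = dist N (boundary F) x -> p = q;
  tube_param : forall p, boundary F p <-> exists t, a t = p;
  tube_cont : unif_cont N a;
  tube_per : periodic a;
  tube_inj : forall t t', 0 < t' - t < 1 -> a t <> a t';
  tube_ncont : unif_cont N u;
  tube_nper : periodic u;
  tube_unit : forall t, N (u t) = 1;
  tube_dist : forall t r, 0 <= r < s ->
    dist N (boundary F) (a t + r *: u t) = r /\ dist N (boundary F) (a t - r *: u t) = r;
  tube_side : forall t r, 0 < r < s -> ~ F (a t + r *: u t) /\ F (a t - r *: u t);
  tube_normal : forall x t, ~ F x -> dist N (boundary F) x < s ->
    N (x - a t) = dist N (boundary F) x -> x = a t + dist N (boundary F) x *: u t }.

Lemma clopen_interval (R : realType) (P : R -> Prop) (c d : R) : c <= d -> P c ->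
  (forall r, c <= r <= d -> exists2 e, 0 < e &
     forall r', c <= r' <= d -> `|r' - r| < e -> P r <-> P r') -> P d.
Proof.
move=> cd Pc hP; apply: contrapT => nPd.
pose f r : R := if `[< P r >] then 1 else 0.
have [||r rI] := @IVT_eps R f c d (1/2) cd.
- move=> r rI e e0; have [h h0 hh] := hP r rI; exists h => // r' r'I /(hh _ r'I) rr'.
  by rewrite /f (asbool_equiv_eq rr') subrr normr0.
- right; rewrite /f (asboolF nPd) (asboolT Pc).
  by apply/andP; split; lin.
by rewrite /f; case: asboolP => _ h; lin.
Qed.

Lemma param_shift (R : realType) (t0 t : R) : exists n : int, t0 <= t + n%:~R < t0 + 1.
Proof.
exists (- Num.floor (t - t0)); have /andP[h1 h2] := floor_itv (t - t0).
rewrite intrD1 in h2; rewrite mulrNz; set n := _%:~R in h1 h2 *; clearbody n.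
by apply/andP; split; lin.
Qed.

Section Tube.
Context {R : realType} (N : plane R -> R) (F : set (plane R)) (s : R) (a u : R -> plane R).
Hypothesis T : tube N F s a u.
Local Notation J := (boundary F).
Implicit Types (x y z v p : plane R) (t r q : R).

Let hN := tube_norm T.
Let cF := tube_compact T.
Let cJ : compact J := compact_boundary cF.

Lemma tube_J t : J (a t).
Proof. by apply/(tube_param T); exists t. Qed.

Lemma tube_J0 : J !=set0.
Proof. by exists (a 0); exact: tube_J. Qed.

Local Notation J0 := tube_J0.
Local Notation dJ := (dist N J).
Definition ft := foot (tube_norm T) (compact_boundary (tube_compact T)) tube_J0.

Let fJ x : J (ft x) := footJ hN cJ J0 x.
Let fE x : N (x - ft x) = dJ x := footE hN cJ J0 x.

Lemma ft_eq x t : dJ x < s -> ft x = a t <-> N (x - a t) = dJ x.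
Proof.
move=> xs; split; first by move=> <-; exact: fE.
exact: (foot_unique hN cJ J0 (tube_unique T) xs (tube_J t)).
Qed.

Lemma ft_ex x : exists t, a t = ft x.
Proof. by apply/(tube_param T); exact: fJ. Qed.

Lemma tube_rep x t : dJ x < s -> (F x -> J x) -> ft x = a t -> x = a t + dJ x *: u t.
Proof.
move=> xs FJ fx; have [Fx|nF] := pselect (F x).
  have Jx := FJ Fx; have e0 := dist_J hN cJ J0 Jx.
  move: fx => /(ft_eq _ xs); rewrite e0 => /(norm_eq0 hN) /eqP.
  by rewrite subr_eq0 scale0r addr0 => /eqP.
by apply: (tube_normal T) => //; apply/(ft_eq _ xs).
Qed.

Lemma inj_eq t t' : a t = a t' -> t' - t < 1 -> t <= t' -> t = t'.
Proof.
move=> e h1 h2; apply/eqP; rewrite eq_le h2 /= leNgt; apply/negP => h.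
by case: (tube_inj T (t := t) (t' := t')) => //; apply/andP; split; lin.
Qed.

(** Continuity of the inverse of the parametrization of the boundary by the circle. *)
Lemma near_param t r : 0 < r -> exists2 m, 0 < m &
  forall p, J p -> N (p - a t) < m -> exists2 t', `|t' - t| < r & a t' = p.
Proof.
move=> r0; pose d := Num.min r (1 / 2).
have d0 : 0 < d by rewrite lt_min r0; lin.
have dh : d <= 1 / 2 by rewrite ge_min lexx orbT.
have dr : d <= r by rewrite ge_min lexx.
have [m m0 hm] := injectivity_modulus hN (tube_cont T) (tube_per T) (tube_inj T) d0.
exists m => // p /(tube_param T)[q <-] h.
have [n /andP[n1 n2]] := param_shift (t - 1 / 2) q.
rewrite -(tube_per T q n) in h *; exists (q + n%:~R) => //.
set q' := q + n%:~R in n1 n2 h *; clearbody q'.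
apply: lt_le_trans dr; rewrite ltNge; apply/negP => h'.
move: h; rewrite ltNge => /negP; apply.
have [e|e] := lerP t q'.
  by apply: hm; rewrite ger0_norm in h'; [apply/andP; split; lin|lin].
by rewrite (normC hN); apply: hm; rewrite ltr0_norm in h'; [apply/andP; split; lin|lin].
Qed.

Variable lam : R.
Hypotheses (lam0 : 0 < lam) (lams : 2 * lam < s).

Definition outer_curve t := a t + lam *: u t.
Local Notation w := outer_curve.

Let lamI : 0 <= lam < s. Proof. by have := lam0; have := lams; lin. Qed.
Let lamI' : 0 < lam < s. Proof. by have := lam0; have := lams; lin. Qed.

Lemma w_dist t : dJ (w t) = lam.
Proof. by have [] := tube_dist T t lamI. Qed.

Lemma w_out t : ~ F (w t).
Proof. by have [] := tube_side T t lamI'. Qed.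

Lemma w_ft t : ft (w t) = a t.
Proof.
apply/ft_eq; first by rewrite w_dist; case/andP: lamI.
rewrite w_dist (_ : w t - a t = lam *: u t); last by rewrite /outer_curve; vec.
by rewrite (normZp hN) ?(tube_unit T) ?mulr1 ?ltW.
Qed.

Lemma w_per : periodic w.
Proof. by move=> t n; rewrite /outer_curve (tube_per T) (tube_nper T). Qed.

Lemma w_inj t t' : 0 < t' - t < 1 -> w t <> w t'.
Proof. by move=> h e; apply: (tube_inj T h); rewrite -w_ft e w_ft. Qed.

Lemma w_cont : unif_cont N w.
Proof.
move=> e e0; have e2 : 0 < e / 2 by lin.
have l2 : 0 < e / (2 * lam) by rewrite divr_gt0 // mulr_gt0.
have [d1 d10 h1] := tube_cont T e2; have [d2 d20 h2] := tube_ncont T l2.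
exists (Num.min d1 d2); first by rewrite lt_min d10.
move=> t t'; rewrite lt_min => /andP[/h1 k1 /h2 k2].
rewrite (_ : w t - w t' = (a t - a t') + lam *: (u t - u t')); last by rewrite /outer_curve; vec.
apply: le_lt_trans (norm_tri hN _ _) _; rewrite (normZp hN _ (ltW lam0)).
move: k2; rewrite ltr_pdivlMr ?mulr_gt0 //; lin.
Qed.

Definition outer_chord t t' r := w t + r *: (w t' - w t).
Local Notation seg := outer_chord.

Lemma seg0 t t' : seg t t' 0 = w t.
Proof. by rewrite /outer_chord scale0r addr0. Qed.
Lemma seg1 t t' : seg t t' 1 = w t'.
Proof. by rewrite /outer_chord scale1r subrKC. Qed.
Lemma segC t t' r : seg t' t r = seg t t' (1 - r).
Proof. by rewrite /outer_chord; vec. Qed.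
Lemma seg_dist t t' r r' : N (seg t t' r - seg t t' r') = `|r - r'| * N (w t - w t').
Proof.
rewrite (normC hN (w t)) -(norm_scale hN); congr (N _); rewrite /outer_chord; vec.
Qed.

Section Chord.
Variables (t t' : R).
Hypothesis chord : N (w t - w t') <= 2 * lam.

(** The chord is covered by the balls of radius [lam] about its ends, which meet [F] only on its
    boundary. So it avoids the interior of [F] and stays within [2 * lam < s] of the boundary. *)
Lemma seg_near r : 0 <= r <= 1 ->
  N (seg t t' r - w t) <= lam \/ N (seg t t' r - w t') <= lam.
Proof.
move=> /andP[r0 r1]; have ch := chord; have n0 := norm_ge0 hN (w t - w t').
have g1 := seg_dist t t' r 0; have g2 := seg_dist t t' r 1.
rewrite seg0 subr0 (ger0_norm r0) in g1; rewrite seg1 ler0_norm ?subr_le0 // opprB in g2.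
rewrite g1 g2; have [h|h] := lerP r (1 / 2); [left|right]; nra.
Qed.

Lemma seg_bound r : 0 <= r <= 1 -> dJ (seg t t' r) <= 2 * lam.
Proof.
move=> rI; have [h|h] := seg_near rI.
  by have := dist_lip hN cJ J0 (seg t t' r) (w t); rewrite w_dist; lin.
by have := dist_lip hN cJ J0 (seg t t' r) (w t'); rewrite w_dist; lin.
Qed.

Lemma seg_s r : 0 <= r <= 1 -> dJ (seg t t' r) < s.
Proof. by move=> /seg_bound h; apply: le_lt_trans h lams. Qed.

Lemma seg_out r : 0 <= r <= 1 -> F (seg t t' r) -> J (seg t t' r).
Proof.
move=> rI Fx; have l0 := lam0.
suff h t1 : N (seg t t' r - w t1) <= lam -> J (seg t t' r).
  by have [/h|/h] := seg_near rI.
move: (seg t t' r) Fx => x Fx xw; apply: contrapT => nJ.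
have d0 := dist_gt0 hN cJ J0 nJ.
pose e := Num.min 1 (dJ x / (2 * lam)).
have e0 : 0 < e by rewrite lt_min ltr01 divr_gt0 // mulr_gt0.
have e1 : e <= 1 by rewrite ge_min lexx.
have e2 : e * (2 * lam) <= dJ x by rewrite -ler_pdivlMr ?mulr_gt0 // ge_min lexx orbT.
clearbody e; have n0 := norm_ge0 hN (x - w t1).
have : F (x + e *: (w t1 - x)).
  apply: (in_ball hN cF Fx); rewrite (_ : _ - x = e *: (w t1 - x)); last by vec.
  rewrite (normZp hN _ (ltW e0)) (normC hN).
  have := ler_wpM2l (ltW e0) xw; have := mulr_gt0 e0 l0; lin.
apply: (out_ball hN cF (w_out (t := t1))).
rewrite w_dist (_ : _ - w t1 = (1 - e) *: (x - w t1)); last by vec.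
have e3 : 0 <= 1 - e by lin.
rewrite (normZp hN _ e3).
have := ler_wpM2l e3 xw; have := mulr_gt0 e0 l0; lin.
Qed.

Lemma seg_rep r q : 0 <= r <= 1 -> ft (seg t t' r) = a q ->
  seg t t' r = a q + dJ (seg t t' r) *: u q.
Proof. by move=> rI; apply: tube_rep; [exact: seg_s|exact: seg_out]. Qed.

(** Going from the chord point to [w q] along the normal costs the difference between the two
    distances to the boundary, which is at most the distance from the chord point to either end of
    the chord. Going on to the other end then costs no more than the whole chord. *)
Lemma seg_close r q : 0 <= r <= 1 -> ft (seg t t' r) = a q ->
  N (w q - w t) <= N (w t - w t') /\ N (w q - w t') <= N (w t - w t').
Proof.
move=> rI fq; have e := seg_rep rI fq; have [r0 r1] := andP rI.
have h : N (seg t t' r - w q) = `|dJ (seg t t' r) - lam|.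
  rewrite {1}e (_ : _ - w q = (dJ (seg t t' r) - lam) *: u q); last by rewrite /outer_curve; vec.
  by rewrite (norm_scale hN) (tube_unit T) mulr1.
have h1 := dist_lip_abs hN cJ J0 (seg t t' r) (w t).
have h2 := dist_lip_abs hN cJ J0 (seg t t' r) (w t').
have h3 := norm_triB hN (w q) (seg t t' r) (w t).
have h4 := norm_triB hN (w q) (seg t t' r) (w t').
rewrite (normC hN (w q) (seg t t' r)) h in h3; rewrite (normC hN (w q) (seg t t' r)) h in h4.
rewrite w_dist in h1; rewrite w_dist in h2.
have g1 := seg_dist t t' r 0; have g2 := seg_dist t t' r 1.
rewrite seg0 subr0 (ger0_norm r0) in g1.
rewrite seg1 ler0_norm ?subr_le0 // in g2.
split; lin.
Qed.

(* Two points of the chord with the same foot would lie on one normal line, along which the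
   distance to the boundary increases. *)
Lemma seg_foot_inj_pos r r' q : 0 <= r <= 1 -> 0 <= r' <= 1 -> r < r' ->
  ft (seg t t' r) = a q -> ft (seg t t' r') = a q -> 
  0 < dJ (seg t t' r') - dJ (seg t t' r) -> False.
Proof.
move=> rI rI' rr f f' dd; have ls := lams; have l0 := lam0.
have e := seg_rep rI f; have e' := seg_rep rI' f'.
have [r0 r1] := andP rI; have [r0' r1'] := andP rI'.
set c := (dJ (seg t t' r') - dJ (seg t t' r)) / (r' - r).
have rr0 : 0 < r' - r by lin.
have c0 : 0 < c by rewrite divr_gt0.
have wc : w t' - w t = c *: u q.
  have rrn : r' - r != 0 by rewrite gt_eqF.
  apply: (scalerI rrn); rewrite scalerA /c mulrC divfK //.
  transitivity (seg t t' r' - seg t t' r); first by rewrite /outer_chord; vec.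
  by rewrite {1}e' {1}e; vec.
have pt q' : seg t t' q' = a q + (dJ (seg t t' r) + (q' - r) * c) *: u q.
  transitivity (seg t t' r + (q' - r) *: (w t' - w t)); first by rewrite /outer_chord; vec.
  by rewrite {1}e wc; vec.
have ub := seg_bound rI.
set sg := dJ (seg t t' r) in pt ub *.
have sg0 : 0 <= sg := dist_ge0 hN cJ J0 _.
clearbody sg c.
(* Along the chord the height over [a q] is affine with slope [c > 0]. By [hi] and [lo] it stays
   between 0 and [2 * lam], where it is the distance to the boundary; but both ends of the chord are
   at distance [lam]. *)
have hi : sg + (1 - r) * c <= 2 * lam.
  rewrite leNgt; apply/negP => h.
  pose z := Num.min (sg + (1 - r) * c) ((2 * lam + s) / 2).
  have z1 : 2 * lam < z by rewrite lt_min h /=; lin.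
  have z2 : z <= sg + (1 - r) * c by rewrite ge_min lexx.
  have z3 : z < s by rewrite gt_min; apply/orP; right; lin.
  clearbody z; pose q' := r + (z - sg) / c.
  have qI : 0 <= q' <= 1.
    apply/andP; split; first by rewrite addr_ge0 // divr_ge0 ?(ltW c0) //; lin.
    by rewrite /q' -lerBrDl ler_pdivrMr //; lin.
  have := seg_bound qI; rewrite pt.
  have -> : sg + (q' - r) * c = z by rewrite /q' [r + _]addrC addrK divfK ?gt_eqF // subrKC.
  have zI : 0 <= z < s by apply/andP; split; lin.
  by have [-> _] := tube_dist T q zI; lin.
have lo : 0 <= sg + (0 - r) * c.
  rewrite leNgt; apply/negP => h.
  pose z := Num.min (- (sg + (0 - r) * c)) (s / 2).
  have z1 : 0 < z by rewrite lt_min; apply/andP; split; lin.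
  have z2 : z <= - (sg + (0 - r) * c) by rewrite ge_min lexx.
  have z3 : z < s by rewrite gt_min; apply/orP; right; lin.
  clearbody z; pose q' := r + (- z - sg) / c.
  have qI : 0 <= q' <= 1.
    apply/andP; split; last first.
      have : (- z - sg) / c <= 0 by rewrite ler_pdivrMr // mul0r; lin.
      by rewrite /q'; lin.
    by rewrite /q' -lerBlDl ler_pdivlMr //; lin.
  have := pt q'.
  have -> : sg + (q' - r) * c = - z by rewrite /q' [r + _]addrC addrK divfK ?gt_eqF // subrKC.
  rewrite scaleNr => eq.
  have zI : 0 < z < s by rewrite z1.
  have zI' : 0 <= z < s by rewrite z3 ltW.
  have [_ Fz] := tube_side T q zI; have [_ dz] := tube_dist T q zI'.
  have := seg_out qI; rewrite eq => /(_ Fz) /(dist_J hN cJ J0); rewrite dz; lin.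
have I0 : 0 <= sg + (0 - r) * c < s.
  rewrite lo /=; have := mulr_ge0 r0 (ltW c0); lin.
have I1 : 0 <= sg + (1 - r) * c < s.
  have : 0 <= (1 - r) * c by rewrite mulr_ge0 ?(ltW c0) // subr_ge0.
  by move=> ?; apply/andP; split; lin.
have [d0 _] := tube_dist T q I0; have [d1 _] := tube_dist T q I1.
rewrite -pt seg0 w_dist in d0; rewrite -pt seg1 w_dist in d1; lin.
Qed.

End Chord.

Lemma seg_foot_inj t t' r r' q : N (w t - w t') <= 2 * lam -> w t <> w t' ->
  0 <= r <= 1 -> 0 <= r' <= 1 ->
  ft (seg t t' r) = a q -> ft (seg t t' r') = a q -> r = r'.
Proof.
move=> ch ww.
wlog rr : r r' / r <= r'.
  by move=> H rI r'I f f'; have [h|/ltW h] := lerP r r'; [exact: H|exact/esym/H].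
rewrite le_eqVlt in rr; case/orP: rr => [/eqP //|rr] rI r'I f f'; exfalso.
have e := seg_rep ch rI f; have e' := seg_rep ch r'I f'.
have [dd|dd|dd] := ltrgtP (dJ (seg t t' r)) (dJ (seg t t' r')).
- by apply: (seg_foot_inj_pos ch rI r'I rr f f'); lin.
- have sb (b : R) : 1 - (1 - b) = b by ring.
  have ch' : N (w t' - w t) <= 2 * lam by rewrite (normC hN).
  have [r0 r1] := andP rI; have [r0' r1'] := andP r'I.
  apply: (@seg_foot_inj_pos t' t ch' (1 - r') (1 - r) q).
  + by apply/andP; split; lin.
  + by apply/andP; split; lin.
  + by lin.
  + by rewrite segC sb.
  + by rewrite segC sb.
  + by rewrite !(segC t t') !sb; lin.
- have := seg_dist t t' r r'; rewrite {1}e {1}e' dd subrr (norm0 hN) => /esym/eqP.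
  rewrite mulf_eq0 normr_eq0 subr_eq0 lt_eqF //= => /eqP /(norm_eq0 hN) /eqP.
  by rewrite subr_eq0 => /eqP.
Qed.

End Tube.

Section Chords.
Context {R : realType} (N : plane R -> R) (F : set (plane R)) (s : R) (a u : R -> plane R).
Hypothesis T : tube N F s a u.
Variable lam : R.
Hypotheses (lam0 : 0 < lam) (lams : 2 * lam < s).
Local Notation J := (boundary F).
Implicit Types (x y z v p : plane R) (t r q c d : R).

Let hN := tube_norm T.
Let cF := tube_compact T.
Let cJ : compact J := compact_boundary cF.
Let J0 := tube_J0 T.
Local Notation dJ := (dist N J).
Local Notation w := (outer_curve a u lam).
Local Notation seg := (outer_chord a u lam).
Local Notation ft := (ft T).
Local Notation chord t t' := (N (w t - w t') <= 2 * lam).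

Let seg_s t t' r (ch : chord t t') rI := seg_s T lam0 lams ch (r := r) rI.

Lemma ft_seg0 t t' : ft (seg t t' 0) = a t.
Proof. by rewrite seg0; exact: w_ft. Qed.
Lemma ft_seg1 t t' : ft (seg t t' 1) = a t'.
Proof. by rewrite seg1; exact: w_ft. Qed.

Lemma seg_ft_cont t t' r e : chord t t' -> 0 <= r <= 1 -> 0 < e -> exists2 d, 0 < d &
  forall r', `|r' - r| < d -> N (ft (seg t t' r') - ft (seg t t' r)) < e.
Proof.
move=> ch rI e0.
have [d d0 hd] := foot_cont hN cJ J0 (tube_unique T) (seg_s ch rI) e0.
have L0 : 0 < N (w t - w t') + 1 by have := norm_ge0 hN (w t - w t'); lin.
exists (d / (N (w t - w t') + 1)); first by rewrite divr_gt0.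
move=> r' h; apply: hd; rewrite (seg_dist T).
move: h; rewrite ltr_pdivlMr //; apply: le_lt_trans.
by rewrite ler_wpM2l //; lin.
Qed.

(** The foot moves continuously on the circle, so it cannot leave the open arc from [t1] to [t2]
    without passing through one of its ends. *)
Lemma separate t t' t1 t2 c d : chord t t' -> 0 <= c -> c <= d -> d <= 1 -> t1 < t2 < t1 + 1 ->
  (forall r, c <= r <= d -> ft (seg t t' r) <> a t1 /\ ft (seg t t' r) <> a t2) ->
  (exists2 q, t1 < q < t2 & a q = ft (seg t t' c)) ->
  exists2 q, t1 < q < t2 & a q = ft (seg t t' d).
Proof.
move=> ch c0 cd d1 /andP[t12 t21] av Pc.
apply: (clopen_interval (P := fun r => exists2 q, t1 < q < t2 & a q = ft (seg t t' r)) cd Pc).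
move=> r rcd; have rI : 0 <= r <= 1 by case/andP: rcd => h1 h2; apply/andP; split; lin.
have [av1 av2] := av r rcd.
have [q0 hq0] := ft_ex T (seg t t' r).
have [n] := param_shift t1 q0; have {hq0} := hq0; rewrite -(tube_per T q0 n).
move: (q0 + _) => {}q0 hq0 /andP[q1 q2].
have n1 : q0 != t1 by apply: contra_notN av1 => /eqP e; rewrite -hq0 e.
have n2 : q0 != t2 by apply: contra_notN av2 => /eqP e; rewrite -hq0 e.
have [lt2|gt2] := ltrP q0 t2.
  have del0 : 0 < Num.min (q0 - t1) (t2 - q0) by rewrite lt_min !subr_gt0 lt2 lt_neqAle eq_sym n1 q1.
  have [m m0 hm] := near_param T q0 del0.
  have [e e0 he] := seg_ft_cont ch rI m0.
  exists e => // r' _ rr; have := hm _ (footJ hN cJ J0 (seg t t' r')); rewrite hq0.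
  move=> /(_ (he _ rr)) [q' qq hq']; split=> _.
    exists q' => //; move: qq; rewrite lt_min !ltr_norml => /andP[/andP[h1 h2] /andP[h3 h4]].
    by apply/andP; split; lin.
  by exists q0 => //; apply/andP; split => //; rewrite lt_neqAle eq_sym n1.
have del0 : 0 < Num.min (q0 - t2) (t1 + 1 - q0).
  by rewrite lt_min !subr_gt0 q2 lt_neqAle eq_sym n2 gt2.
have [m m0 hm] := near_param T q0 del0.
have [e e0 he] := seg_ft_cont ch rI m0.
have no q q' : t1 < q < t2 -> t2 < q' < t1 + 1 -> a q = a q' -> False.
  move=> /andP[h1 h2] /andP[h3 h4]; apply: (tube_inj T); apply/andP; split; lin.
exists e => // r' _ rr; have := hm _ (footJ hN cJ J0 (seg t t' r')); rewrite hq0.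
move=> /(_ (he _ rr)) [q' qq hq']; split=> -[q qI hq]; exfalso.
  by apply: (no q q0 qI); rewrite ?hq //; apply/andP; split; rewrite // lt_neqAle eq_sym n2.
apply: (no q q' qI); last by rewrite hq.
move: qq; rewrite lt_min !ltr_norml => /andP[/andP[h1 h2] /andP[h3 h4]].
by apply/andP; split; lin.
Qed.

Definition hits t t' q := exists2 r, 0 <= r <= 1 & ft (seg t t' r) = a q.

(* The nearest points to the chord from w t to w t' fill the arc from a t to a t' (caseI) or
   the complementary one (caseII). *)
Definition caseI t t' := forall q, t <= q <= t' -> hits t t' q.
Definition caseII t t' := forall q, t' <= q <= t + 1 -> hits t t' q.

Let I0 : 0 <= (0 : R) <= 1. Proof. by rewrite lexx ler01. Qed.
Let I1 : 0 <= (1 : R) <= 1. Proof. by rewrite lexx ler01. Qed.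

Let per1 t : a (t + 1) = a t.
Proof. by rewrite -[in RHS](tube_per T t 1). Qed.

Lemma hits_left t t' : hits t t' t.
Proof. by exists 0 => //; rewrite ft_seg0. Qed.
Lemma hits_right t t' : hits t t' t'.
Proof. by exists 1 => //; rewrite ft_seg1. Qed.
Lemma hits_left1 t t' : hits t t' (t + 1).
Proof. by exists 0 => //; rewrite ft_seg0 per1. Qed.

(** A missed point in each of the two arcs would separate [a t] from [a t'] on the circle, although
    the foot moves from one to the other. *)
Lemma case_or t t' : t <= t' <= t + 1 -> chord t t' -> caseI t t' \/ caseII t t'.
Proof.
move=> /andP[tt1 tt2] ch; apply: contrapT => /not_orP[].
move=> /existsNP[t1 /not_implyP[/andP[a1 a2] nh1]].
move=> /existsNP[t2 /not_implyP[/andP[b1 b2] nh2]].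
have n1 : t1 != t by apply: contra_notN nh1 => /eqP ->; exact: hits_left.
have n2 : t1 != t' by apply: contra_notN nh1 => /eqP ->; exact: hits_right.
have n3 : t2 != t' by apply: contra_notN nh2 => /eqP ->; exact: hits_right.
have n4 : t2 != t + 1 by apply: contra_notN nh2 => /eqP ->; exact: hits_left1.
have s1 : t < t1 by rewrite lt_neqAle eq_sym n1.
have s2 : t1 < t' by rewrite lt_neqAle n2.
have s3 : t' < t2 by rewrite lt_neqAle eq_sym n3.
have s4 : t2 < t + 1 by rewrite lt_neqAle n4.
have [|r rI||q qI] := @separate t t' t2 (t1 + 1) 0 1 ch (lexx _) ler01 (lexx _).
- by apply/andP; split; lin.
- by split => e; [apply: nh2|apply: nh1]; exists r => //; rewrite e ?per1.
- by exists (t + 1); rewrite ?ft_seg0 ?per1 //; apply/andP; split; lin.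
rewrite ft_seg1 => /esym; apply: (tube_inj T).
by case/andP: qI => h1 h2; apply/andP; split; lin.
Qed.

Lemma extreme_boundary f : f != 0 -> exists2 q, F (a q) & forall x, F x -> dot f x <= dot f (a q).
Proof.
move=> f0; have F0 : F !=set0 by exists (a 0); have /(boundaryE cF)[] := tube_J T 0.
have [|p Fp pm] := @compact_norm_max _ _ hN F (dot f) F0 cF.
- by move=> x _ e e0; have [d d0 hd] := dot_cont hN f x e0; exists d => // y _; exact: hd.
have Jp : J p.
  apply/(boundaryE cF); split => // /(interior_normP hN F) [d d0 hd].
  have L0 : 0 < N f + 1 by have := norm_ge0 hN f; lin.
  pose e := d / (N f + 1); have e0 : 0 < e by rewrite divr_gt0.
  have := pm (p + e *: f); rewrite dotDr dotZr.
  have : F (p + e *: f).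
    apply: hd; rewrite (_ : _ - p = e *: f); last by vec.
    by rewrite (normZp hN _ (ltW e0)) /e mulrAC ltr_pdivrMr // ltr_pM2l //; lin.
  move=> h /(_ h); have := mulr_gt0 e0 (dotvv_gt0 f0); lin.
by have [q e] := (tube_param T p).1 Jp; exists q; rewrite e.
Qed.

(** Otherwise every boundary point is the foot of a chord point. Take [f] constant along the chord.
    At a point of [F] where [f] is maximal the outer normal does not decrease [f], so the chord lies
    at least as high as all of [F]; the same holds for [- f], and [F] would lie on a line. *)
Lemma case_not_both t t' : t <= t' <= t + 1 -> chord t t' -> caseI t t' -> caseII t t' -> False.
Proof.
move=> /andP[tt1 tt2] ch c1 c2; have l0 := lam0; have ls := lams.
have all q : exists q' r, [/\ 0 <= r <= 1, a q' = a q, u q' = u q & ft (seg t t' r) = a q].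
  have [n /andP[n1 n2]] := param_shift t q.
  have [r rI fr] : hits t t' (q + n%:~R).
    have [h|h] := lerP (q + n%:~R) t'; first by apply: c1; rewrite n1.
    by apply: c2; rewrite !ltW.
  exists (q + n%:~R), r; split; rewrite ?(tube_per T) ?(tube_nper T) //.
  by rewrite fr (tube_per T).
have [f f0 ff] : exists2 f, f != 0 & dot f (w t' - w t) = 0.
  have [e|ne] := eqVneq (w t' - w t) 0.
    by have [f f0] := @nonzero_plane R; exists f; rewrite ?e ?dot0r.
  exists (perp (w t' - w t)); last by rewrite dot_perp detxx.
  apply/eqP => e; have := dotvv_gt0 ne.
  have -> : dot (w t' - w t) (w t' - w t) = det (w t' - w t) (perp (w t' - w t)).
    by rewrite /det /dot !mxE /=; ring.
  by rewrite e /det !mxE !mulr0 subrr ltxx.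
have cst r : dot f (seg t t' r) = dot f (w t) by rewrite dotDr dotZr ff mulr0 addr0.
have above g : g != 0 -> (forall r, dot g (seg t t' r) = dot g (w t)) ->
    forall x, F x -> dot g x <= dot g (w t).
  move=> g0 gc x Fx; have [q Fq qm] := extreme_boundary g0.
  apply: le_trans (qm x Fx) _.
  have [q' [r [rI aq uq fr]]] := all q.
  rewrite -(gc r) (seg_rep lam0 lams ch rI fr) dotDr dotZr lerDl.
  rewrite mulr_ge0 ?(dist_ge0 hN cJ J0) //.
  have lI : 0 < lam < s by rewrite l0; lin.
  (* The inner point [a q - lam *: u q] belongs to [F], so [g] is nonnegative on [u q]. *)
  have := qm _ (tube_side T q lI).2; rewrite dotBr dotZr gerBl pmulr_rge0 //.
have hi := above f f0 cst.
have lo := above (- f) _ _.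
have {}lo x : F x -> dot f (w t) <= dot f x.
  move=> Fx; have := lo _ _ x Fx; rewrite oppr_eq0 f0 !dotNl lerN2; apply => // r.
  by rewrite !dotNl cst.
have lI : 0 < lam < s by rewrite l0; lin.
have lI' : 0 <= lam < s by rewrite ltW //; lin.
have [_ Fx] := tube_side T t lI; have [_ dx] := tube_dist T t lI'.
move: (a t - _) Fx dx => x Fx dx.
have L0 : 0 < N f + 1 by have := norm_ge0 hN f; lin.
pose e := lam / (N f + 1); have e0 : 0 < e by rewrite divr_gt0.
have Fy : F (x + e *: f).
  apply: (in_ball hN cF Fx); rewrite dx (_ : _ - x = e *: f); last by vec.
  by rewrite (normZp hN _ (ltW e0)) /e mulrAC ltr_pdivrMr // ltr_pM2l //; lin.
have := hi _ Fy; have := lo _ Fx; rewrite dotDr dotZr.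
have := mulr_gt0 e0 (dotvv_gt0 f0); lin.
Qed.

Lemma foot_unif e : 0 < e -> exists2 d, 0 < d & forall x y, dJ x <= 2 * lam ->
  dJ y <= 2 * lam -> N (x - y) < d -> N (ft x - ft y) < e.
Proof.
move=> e0; have ls := lams; pose C := [set x | dJ x <= 2 * lam].
have cC : compact C.
  apply: (compact_normP hN).
    move=> x /negP; rewrite -ltNge => nC; exists (dJ x - 2 * lam); first by rewrite subr_gt0.
    move=> y yx ey; have {}ey : dJ y <= 2 * lam := ey; have := dist_lip hN cJ J0 x y; rewrite (normC hN); lin.
  have [M hM] := compact_norm_bounded hN cJ.
  exists (2 * lam + M) => x ex; have {}ex : dJ x <= 2 * lam := ex; have := hM _ (footJ hN cJ J0 x).
  have := norm_tri hN (x - ft x) (ft x); rewrite subrK footE; lin.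
have cK : compact (C `*` C)%classic by apply: compact_setX.
pose f (p : plane R * plane R) := N (p.1 - p.2).
pose g (p : plane R * plane R) := N (ft p.1 - ft p.2).
have [[x y] [ex ey] q q0||[x y] _ /(norm_eq0 hN)/eqP|m m0 hm] := @compact_modulus R _ _ f g e cK.
- have {}ex : dJ x <= 2 * lam := ex; have {}ey : dJ y <= 2 * lam := ey.
  have xs : dJ x < s by lin.
  have ys : dJ y < s by lin.
  have [d d0 hd] := foot_pair_cont hN cJ J0 (tube_unique T) xs ys q0.
  by exists d => // -[x' y'] _ /hd.
- by move=> p _; exact: norm_ge0.
- by rewrite subr_eq0 /g => /eqP /= ->; rewrite subrr (norm0 hN).
exists m => // x y ex ey xy; exact: (hm (x, y) (conj ex ey)).
Qed.

Lemma not_hit_open t t' q : chord t t' -> ~ hits t t' q -> exists2 e, 0 < e &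
  forall t1 t1', `|t1 - t| < e -> `|t1' - t'| < e -> chord t1 t1' -> ~ hits t1 t1' q.
Proof.
move=> ch nh.
have [||m m0 hm] := @compact_positive R R (`[0, 1]%classic : set R) (fun r => N (ft (seg t t' r) - a q))
  (@segment_compact _ 0 1).
- move=> r /=; rewrite in_itv /= => rI e e0; have [d d0 hd] := seg_ft_cont ch rI e0.
  exists d => // r' _ /hd h; apply: le_lt_trans h; apply: le_trans (norm_dist hN _ _) _.
  by rewrite (_ : _ - _ = ft (seg t t' r') - ft (seg t t' r)) //; vec.
- move=> r /=; rewrite in_itv /= => rI; apply: (norm_gt0 hN); rewrite subr_eq0; apply/eqP => e.
  by apply: nh; exists r.
have [d d0 hd] := foot_unif m0.
have d2 : 0 < d / 2 by lin.
have [e e0 he] := w_cont T lam0 d2.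
exists e; first exact: e0.
move=> t1 t1' h1 h2 ch1 [r rI fr].
have : N (ft (seg t t' r) - ft (seg t1 t1' r)) < m.
  apply: hd; [exact: (seg_bound T lam0 lams)|exact: (seg_bound T lam0 lams)|].
  have -> : seg t t' r - seg t1 t1' r = (1 - r) *: (w t - w t1) + r *: (w t' - w t1').
    by rewrite /outer_chord; vec.
  have k1 : N (w t - w t1) < d / 2 by apply: he; rewrite distrC.
  have k2 : N (w t' - w t1') < d / 2 by apply: he; rewrite distrC.
  apply: le_lt_trans (norm_tri hN _ _) _; case/andP: rI => r0 r1.
  have r1' : 0 <= 1 - r by lin.
  rewrite !(normZp hN) //.
  have := ler_wpM2l r0 (ltW k2); have := ler_wpM2l r1' (ltW k1); lin.
have rI' : `[0, 1]%classic r by rewrite /= in_itv.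
by have := hm r rI'; rewrite fr leNgt => /negP.
Qed.

(** The chord is deformed to the single point [w c], where case I is trivial. Missing a given point
    is an open condition on the chord; as exactly one case holds, case I is both open and closed
    along the deformation. *)
Lemma case_family c t t' : t <= c <= t' -> t' <= t + 1 ->
  (forall r, 0 <= r <= 1 -> chord (c + r * (t - c)) (c + r * (t' - c))) -> caseI t t'.
Proof.
move=> /andP[tc ct] tt ch.
pose al r := c + r * (t - c); pose be r := c + r * (t' - c).
have ab r : 0 <= r <= 1 -> al r <= be r <= al r + 1.
  move=> /andP[r0 r1]; rewrite /al /be; apply/andP; split; nra.
have ch' r : 0 <= r <= 1 -> chord (al r) (be r) by exact: ch.
have c1 : forall r, 0 <= r <= 1 -> caseI (al r) (be r) \/ caseII (al r) (be r).
  by move=> r rI; apply: case_or; [exact: ab|exact: (ch' r rI)].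
have al1 : al 1 = t by rewrite /al; ring.
have be1 : be 1 = t' by rewrite /be; ring.
have al0 : al 0 = c by rewrite /al; ring.
have be0 : be 0 = c by rewrite /be; ring.
suff : caseI (al 1) (be 1) by rewrite al1 be1.
apply: (clopen_interval (P := fun r => caseI (al r) (be r)) ler01).
  rewrite al0 be0 => q; rewrite -eq_le => /eqP <-; exact: hits_left.
pose L := `|t - c| + `|t' - c| + 1.
have L0 : 0 < L by rewrite /L; have := normr_ge0 (t - c); have := normr_ge0 (t' - c); lin.
have close r r' : `|al r' - al r| <= `|r' - r| * L /\ `|be r' - be r| <= `|r' - r| * L.
  have -> : al r' - al r = (r' - r) * (t - c) by rewrite /al; ring.
  have -> : be r' - be r = (r' - r) * (t' - c) by rewrite /be; ring.
  have := normr_ge0 (t - c); have := normr_ge0 (t' - c).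
  by rewrite !normrM /L => h1 h2; split; rewrite ler_wpM2l //; lin.
clearbody al be; move=> r rI.
have [cI|nI] := pselect (caseI (al r) (be r)).
  have nII : ~ caseII (al r) (be r) by move=> cII; exact: (case_not_both (ab r rI) (ch' r rI) cI cII).
  move/existsNP: nII => [q /not_implyP[/andP[q1 q2] nh]].
  have n1 : q != be r by apply: contra_notN nh => /eqP ->; exact: hits_right.
  have n2 : q != al r + 1 by apply: contra_notN nh => /eqP ->; exact: hits_left1.
  have s1 : 0 < q - be r by rewrite subr_gt0 lt_neqAle eq_sym n1.
  have s2 : 0 < al r + 1 - q by rewrite subr_gt0 lt_neqAle n2.
  have [e e0 he] := not_hit_open (ch' r rI) nh.
  exists (Num.min e (Num.min (q - be r) (al r + 1 - q)) / L).
    by rewrite divr_gt0 // !lt_min e0 s1.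
  move=> r' r'I; rewrite ltr_pdivlMr // !lt_min => /and3P[h1 h2 h3].
  have [k1 k2] := close r r'; split => // _.
  have [//|cII] := c1 _ r'I; exfalso.
  have k3 : `|al r' - al r| < e by lin.
  have k4 : `|be r' - be r| < e by lin.
  apply: (he _ _ k3 k4 (ch' r' r'I)); apply: cII.
  have k5 : `|be r' - be r| < q - be r by lin.
  have k6 : `|al r' - al r| < al r + 1 - q by lin.
  move: k5 k6; rewrite !ltr_norml => /andP[? ?] /andP[? ?]; apply/andP; split; lin.
move/existsNP: (nI) => [q /not_implyP[/andP[q1 q2] nh]].
have n1 : q != be r by apply: contra_notN nh => /eqP ->; exact: hits_right.
have n2 : q != al r by apply: contra_notN nh => /eqP ->; exact: hits_left.
have s1 : 0 < be r - q by rewrite subr_gt0 lt_neqAle n1.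
have s2 : 0 < q - al r by rewrite subr_gt0 lt_neqAle eq_sym n2.
have [e e0 he] := not_hit_open (ch' r rI) nh.
exists (Num.min e (Num.min (be r - q) (q - al r)) / L).
  by rewrite divr_gt0 // !lt_min e0 s1.
move=> r' r'I; rewrite ltr_pdivlMr // !lt_min => /and3P[h1 h2 h3].
have [k1 k2] := close r r'; split => // cI; exfalso.
have k3 : `|al r' - al r| < e by lin.
have k4 : `|be r' - be r| < e by lin.
apply: (he _ _ k3 k4 (ch' r' r'I)); apply: cI.
have k5 : `|be r' - be r| < be r - q by lin.
have k6 : `|al r' - al r| < q - al r by lin.
move: k5 k6; rewrite !ltr_norml => /andP[? ?] /andP[? ?]; apply/andP; split; lin.
Qed.

(** If [r2 < r1], then by injectivity the foot meets neither [a t1] nor [a t'] before the parameter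
    [r2], although these two points separate its start [a t] from [a t2]. *)
Lemma hits_monotone t t' t1 t2 r1 r2 : t < t' < t + 1 -> chord t t' -> caseI t t' ->
  t <= t1 -> t1 < t2 -> t2 <= t' -> 0 <= r1 <= 1 -> 0 <= r2 <= 1 ->
  ft (seg t t' r1) = a t1 -> ft (seg t t' r2) = a t2 -> r1 < r2.
Proof.
move=> /andP[tt tt1] ch cI a1 a12 a2 r1I r2I f1 f2; rewrite ltNge; apply/negP => r21.
have ww : w t <> w t' by apply: (w_inj T lam0 lams); apply/andP; split; lin.
have inj r r' q := seg_foot_inj (T := T) lam0 lams (t := t) (t' := t') (r := r) (r' := r') (q := q) ch ww.
have n12 : r2 != r1.
  apply/eqP => e; move: f2; rewrite e f1; apply: (tube_inj T); apply/andP; split; lin.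
have {r21}r21 : r2 < r1 by rewrite lt_neqAle n12.
have [r10 r11] := andP r1I; have [r20 r2_1] := andP r2I.
have n1 : t1 != t.
  apply/eqP => e; have f1' : ft (seg t t' r1) = a t by rewrite f1 e.
  have e' := inj r1 0 t r1I I0 f1' (ft_seg0 t t').
  by move: r21; rewrite e'; lin.
have n2 : t2 != t'.
  apply/eqP => e; have f2' : ft (seg t t' r2) = a t' by rewrite f2 e.
  have e' := inj r2 1 t' r2I I1 f2' (ft_seg1 t t').
  by move: r21; rewrite e'; lin.
have s1 : t < t1 by rewrite lt_neqAle eq_sym n1.
have s2 : t2 < t' by rewrite lt_neqAle n2.
have [|r rI||q qI] := @separate t t' t' (t1 + 1) 0 r2 ch (lexx _) r20 r2_1.
- by apply/andP; split; lin.
- have [h1 h2] := andP rI; have rI' : 0 <= r <= 1 by rewrite h1; lin.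
  rewrite per1; split => e.
    by have e' := inj r 1 t' rI' I1 e (ft_seg1 t t'); move: h2; rewrite e'; lin.
  by have e' := inj r r1 t1 rI' r1I e f1; move: h2; rewrite e'; lin.
- by exists (t + 1); rewrite ?ft_seg0 ?per1 //; apply/andP; split; lin.
rewrite f2 => /esym; apply: (tube_inj T).
by case/andP: qI => h1 h2; apply/andP; split; lin.
Qed.

(* A path X from w t to w t' that lies over the arc from a t to a t' along normals, with an
   arc length function L of total increase at most l. *)
Definition track t t' (l : R) := exists (X : R -> plane R) (sg L : R -> R),
  [/\ forall q, t <= q <= t' -> X q = a q + sg q *: u q /\ 0 <= sg q <= 2 * lam,
      sg t = lam, sg t' = lam,
      forall q q', t <= q -> q <= q' -> q' <= t' -> N (X q' - X q) <= L q' - L q &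
      L t' - L t <= l].

(** Each time of the arc is sent to the chord point above it. By [hits_monotone] these points run
    along the chord in order, so arc length is measured on the chord. *)
Lemma track_chord t t' : t < t' < t + 1 -> chord t t' -> caseI t t' -> track t t' (2 * lam).
Proof.
move=> tI ch cI; have [tt tt1] := andP tI; have l0 := lam0; have ls := lams.
have ww : w t <> w t' by apply: (w_inj T lam0 lams); apply/andP; split; lin.
have inj r r' q := seg_foot_inj (T := T) lam0 lams (t := t) (t' := t') (r := r) (r' := r') (q := q) ch ww.
have hq q : exists r, t <= q <= t' -> 0 <= r <= 1 /\ ft (seg t t' r) = a q.
  have [h|h] := boolP (t <= q <= t'); last by exists 0.
  by have [r] := cI q h; exists r.
have [r hr] := choice hq.
have e0 : r t = 0.
  by have [|h1 h2] := hr t; [rewrite lexx ltW|apply: (inj _ _ t) => //; exact: ft_seg0].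
have e1 : r t' = 1.
  by have [|h1 h2] := hr t'; [rewrite lexx ltW|apply: (inj _ _ t') => //; exact: ft_seg1].
exists (fun q => seg t t' (r q)), (fun q => dJ (seg t t' (r q))), (fun q => r q * N (w t - w t')).
split.
- move=> q /hr [rI fr]; split; first exact: (seg_rep lam0 lams ch rI fr).
  by rewrite (dist_ge0 hN cJ J0) (seg_bound T lam0 lams ch rI).
- by rewrite e0 seg0; exact: (w_dist T lam0 lams).
- by rewrite e1 seg1; exact: (w_dist T lam0 lams).
- move=> q q' tq qq qt; rewrite (seg_dist T) -mulrBl ler_wpM2r ?(norm_ge0 hN) //.
  have [->|nq] := eqVneq q q'; first by rewrite subrr normr0.
  have qq' : q < q' by rewrite lt_neqAle nq.
  have [|rI fr] := hr q; first by rewrite tq (le_trans qq qt).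
  have [|rI' fr'] := hr q'; first by rewrite qt (le_trans tq qq).
  have lt := hits_monotone tI ch cI tq qq' qt rI rI' fr fr'.
  by rewrite ger0_norm // subr_ge0 ltW.
- by rewrite e0 e1 mul0r mul1r subr0.
Qed.

Lemma track_cat t t' t'' (l l' : R) : t <= t' <= t'' -> track t t' l -> track t' t'' l' ->
  track t t'' (l + l').
Proof.
move=> /andP[tt tt'] [X [sg [L [h1 h2 h3 h4 h5]]]] [X' [sg' [L' [h1' h2' h3' h4' h5']]]].
have XX : X t' = X' t'.
  have [|-> _] := h1 t'; first by rewrite tt lexx.
  have [|-> _] := h1' t'; first by rewrite tt' lexx.
  by rewrite h3 h2'.
exists (fun q => if q <= t' then X q else X' q), (fun q => if q <= t' then sg q else sg' q),
  (fun q => if q <= t' then L q else L t' - L' t' + L' q).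
split.
- move=> q /andP[q1 q2]; case: (lerP q t') => qt; first by apply: h1; rewrite q1.
  by apply: h1'; rewrite q2 ltW.
- by rewrite tt.
- case: (lerP t'' t') => // h; have e : t'' = t' by apply/eqP; rewrite eq_le h.
  by rewrite e.
- move=> q q' q1 q2 q3; case: (lerP q t') => qt; case: (lerP q' t') => qt'.
  + exact: h4.
  + apply: le_trans (norm_triB hN (X' q') (X t') (X q)) _.
    have := h4 q t' q1 qt (lexx _); have := h4' t' q' (lexx _) (ltW qt') q3.
    by rewrite XX; lin.
  + by move: (lt_le_trans qt (le_trans q2 qt')); rewrite ltxx.
  + by have := h4' q q' (ltW qt) q2 q3; lin.
- rewrite tt; case: (lerP t'' t') => h; last by lin.
  have e : t'' = t' by apply/eqP; rewrite eq_le h.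
  have h0 := h4' t' t'' (lexx _) tt' (lexx _).
  have n0 := norm_ge0 hN (X' t'' - X' t').
  by rewrite [in L t'']e; lin.
Qed.

Lemma track_weaken t t' (l l' : R) : l <= l' -> track t t' l -> track t t' l'.
Proof.
by move=> ll [X [sg [L [? ? ? ? h]]]]; exists X, sg, L; split => //; apply: le_trans h ll.
Qed.

Lemma track_refl t : track t t 0.
Proof.
exists (fun q => a q + lam *: u q), (fun=> lam), (fun=> 0); have l0 := lam0; split => //.
- by move=> q _; split => //; apply/andP; split; lin.
- move=> q q' h1 h2 h3; have -> : q = q' by apply/eqP; rewrite eq_le h2 (le_trans h3 h1).
  by rewrite subrr (norm0 hN) subrr.
Qed.

End Chords.

(** * Greedy packing *)

Section Greedy.
Context {R : realType} (N : plane R -> R) (F : set (plane R)) (s : R) (a u : R -> plane R).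
Hypothesis T : tube N F s a u.
Variable lam : R.
Hypotheses (lam0 : 0 < lam) (lams : 2 * lam < s).
Implicit Types (t q x y e : R) (G : seq R).

Let hN := tube_norm T.
Local Notation w := (outer_curve a u lam).
Local Notation seg := (outer_chord a u lam).
Local Notation chord t t' := (N (w t - w t') <= 2 * lam).
Local Notation track := (track N a u lam).

Definition step t t' := t <= t' <= t + 1 /\ forall q, t <= q <= t' -> chord t q.

(** After a full turn the chord would be the single point [w t], whose only foot is [a t], whereas
    case I holds for it by shrinking from [t'] to [t]. *)
Lemma step_not_full t t' : step t t' -> t' < t + 1.
Proof.
move=> [/andP[tt1 tt2] st]; rewrite lt_neqAle tt2 andbT; apply/eqP => e.
have cI : caseI T lam t t'.
  apply: (case_family T lam0 lams (c := t)) => //; first by rewrite lexx tt1.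
  move=> r /andP[r0 r1]; rewrite subrr mulr0 addr0; apply: st; apply/andP; split; nra.
have [|r rI] := cI (t + 1 / 2); first by apply/andP; split; lin.
have wt : w t' = w t by rewrite e -[in RHS](w_per T lam t 1).
rewrite /outer_chord wt subrr scaler0 addr0 (w_ft T lam0 lams).
by apply: (tube_inj T); apply/andP; split; lin.
Qed.

(** A step controls only distances from [w t]. By [seg_close] on the chord from [w t] to [w y] the
    distances to [w y] are controlled too, so chords ending at [y] can be shrunk towards [y]. *)
Lemma step_track t t' x y : step t t' -> t <= x -> x <= y -> y <= t' -> track x y (2 * lam).
Proof.
move=> hst tx xy yt; have tf := step_not_full hst; have [/andP[tt1 tt2] st] := hst.
rewrite le_eqVlt in xy; case/orP: xy => [/eqP <-|xy].
  by apply: (track_weaken _ (track_refl T lam0 x)); have := lam0; lin.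
have cty : chord t y by apply: st; apply/andP; split; lin.
have c1 : caseI T lam t y.
  apply: (case_family T lam0 lams (c := t)); try by [apply/andP; split; lin|lin].
  move=> r /andP[r0 r1]; rewrite subrr mulr0 addr0; apply: st; apply/andP; split; nra.
have cq q : t <= q <= y -> chord q y.
  by move=> /c1[r rI fr]; have [_ h] := seg_close lam0 lams cty rI fr; lin.
have c2 : caseI T lam x y.
  apply: (case_family T lam0 lams (c := y)); try by [apply/andP; split; lin|lin].
  move=> r /andP[r0 r1]; rewrite subrr mulr0 addr0; apply: cq; apply/andP; split; nra.
apply: (@track_chord _ _ _ _ _ _ T _ lam0 lams) c2; first by apply/andP; split; lin.
by apply: cq; rewrite tx ltW.
Qed.

(** The greedy marks after [t]. Every mark but the last has a successor at distance exactly
    [2 * lam]. *)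
Fixpoint gchain t G e : Prop := match G with
  | [::] => forall q, t <= q <= e -> N (w t - w q) < 2 * lam
  | t' :: G' => [/\ t < t' <= e, N (w t - w t') = 2 * lam,
      forall q, t <= q <= t' -> chord t q & gchain t' G' e]
  end.

Lemma exit_time t e : t <= e -> (forall q, t <= q <= e -> N (w t - w q) < 2 * lam) \/
  exists t', [/\ t < t' <= e, N (w t - w t') = 2 * lam & forall q, t <= q <= t' -> chord t q].
Proof.
move=> te; have l0 := lam0; set S := [set q | t <= q <= e /\ 2 * lam <= N (w t - w q)].
have [S0|/set0P [q0 Sq0]] := eqVneq S set0.
  left => q qI; rewrite ltNge; apply/negP => h.
  have : S q by [].
  by rewrite S0.
right; have hS : has_inf S by split; [exists q0|exists t => q [/andP[]]].
set m := inf S.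
have tm : t <= m by apply: lb_le_inf; [exists q0|move=> q [/andP[]]].
have me : m <= e by apply: le_trans (ge_inf hS.2 Sq0) _; case: Sq0 => /andP[].
have cnt q eps : 0 < eps -> exists2 d, 0 < d & forall q', `|q' - q| < d ->
    `|N (w t - w q') - N (w t - w q)| < eps.
  move=> /(w_cont T lam0) [d d0 hd]; exists d => // q' /hd h.
  apply: le_lt_trans h; apply: le_trans (norm_dist hN _ _) _.
  by rewrite (_ : _ - _ = - (w q' - w q)) ?(normN hN) //; vec.
have hm : 2 * lam <= N (w t - w m).
  rewrite leNgt; apply/negP => h; have h' : 0 < 2 * lam - N (w t - w m) by rewrite subr_gt0.
  have [d d0 hd] := cnt m _ h'.
  have [q [qI Sq] qm] := inf_adherent d0 hS.
  have mq : m <= q by apply: ge_inf; [case: hS|split].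
  have := hd q; rewrite ger0_norm ?subr_ge0 //; rewrite -/m in qm.
  have qd : q - m < d by lin.
  move=> /(_ qd); rewrite ltr_norml => /andP[_]; lin.
have low q : t <= q -> q < m -> N (w t - w q) < 2 * lam.
  move=> tq qm; rewrite ltNge; apply/negP => h.
  have : S q by split => //; apply/andP; split; lin.
  by move/(ge_inf hS.2); rewrite -/m leNgt qm.
have n0 : N (w t - w t) = 0 by rewrite subrr (norm0 hN).
have tm' : t < m.
  rewrite lt_neqAle tm andbT; apply: contraTneq hm => <-; rewrite n0 -ltNge; lin.
have [||c /andP[c1 c2] ec] := @IVT_eps R (fun q => N (w t - w q)) t m (2 * lam) tm.
- by move=> q _ eps /(cnt q) [d d0 hd]; exists d => // q' _; exact: hd.
- by left; rewrite n0 hm andbT; lin.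
have ecm : c = m.
  apply/eqP; rewrite eq_le c2 leNgt; apply/negP => h.
  by have := low c c1 h; rewrite ec ltxx.
exists m; rewrite tm' me -ecm ec; split => // q /andP[q1 q2].
have [->|nq] := eqVneq q m; first by rewrite -ecm ec.
by apply: ltW; apply: low => //; rewrite lt_neqAle nq -ecm.
Qed.

(** By uniform continuity each mark advances by at least [d], so there are finitely many. *)
Lemma gchain_exists t e : t <= e -> exists G, gchain t G e.
Proof.
have l2 : 0 < 2 * lam by have := lam0; lin.
have [d d0 hd] := w_cont T lam0 l2.
move=> te; have [n hn] : exists n : nat, e - t <= n%:R * d.
  exists (Num.bound ((e - t) / d)); rewrite -ler_pdivrMr //; apply: ltW.
  by apply: archi_boundP; rewrite divr_ge0 ?subr_ge0 // ltW.
elim: n t te hn => [|n IH] t te hn.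
  exists [::] => q /andP[q1 q2]; have -> : q = t by rewrite mul0r in hn; lin.
  by rewrite subrr (norm0 hN).
have [h|[t' [/andP[tt te'] e1 st]]] := exit_time te; first by exists [::].
have td : d <= t' - t.
  rewrite leNgt; apply/negP => h; have := hd t t'.
  by rewrite e1 ltxx ler0_norm ?subr_le0 ?(ltW tt) // opprB => /(_ h).
have [|G hG] := IH t' te'; first by move: hn; rewrite -natr1 mulrDl mul1r; lin.
by exists (t' :: G); split => //; rewrite tt.
Qed.

Lemma gchain_next t G e q : gchain t G e -> q \in belast t G ->
  t <= q /\ exists2 q', q < q' <= e & N (w q - w q') = 2 * lam.
Proof.
elim: G t => //= t' G IH t [tI e1 st h]; rewrite inE => /orP[/eqP ->|/(IH _ h)[h1 h2]].
  by split=> //; exists t'.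
by split => //; case/andP: tI => t1 _; apply: ltW; apply: lt_le_trans h1.
Qed.

(** Suppose that [w q] is closer than [2 * lam] to [w t]. In case I the successor [t'] of [t], and
    in case II the successor [q'] of [q], lies on the arc under this chord, and [seg_close] brings
    it too close to its predecessor. The last mark has no successor and is dropped by [belast]. *)
Lemma gchain_separated t G e : gchain t G e -> e <= t + 1 ->
  pairwise (fun x y => 2 * lam <= N (w x - w y)) (belast t G).
Proof.
elim: G t => //= t' G IH t [/andP[t1 t2] e1 st h] et; rewrite IH //; last by lin.
rewrite andbT; apply/allP => q /(gchain_next h) [q1 [q' /andP[q2 q3] eq]].
rewrite leNgt; apply/negP => ch.
have tqI : t <= q <= t + 1 by apply/andP; split; lin.
have [cI|cII] := case_or T lam0 lams tqI (ltW ch).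
  have [|r rI fr] := cI t'; first by rewrite (ltW t1) q1.
  have [h1 _] := seg_close lam0 lams (ltW ch) rI fr.
  by rewrite (normC hN) e1 in h1; lin.
have [|r rI fr] := cII q'; first by apply/andP; split; lin.
have [_ h1] := seg_close lam0 lams (ltW ch) rI fr.
by rewrite (normC hN) eq in h1; lin.
Qed.

(** The marks strictly between [x] and [y] cut the arc into one more stretch than there are marks,
    and each stretch lies under a chord of length at most [2 * lam]. *)
Lemma gchain_track t G e x y : gchain t G e -> e <= t + 1 -> t <= x -> x <= y -> y <= e ->
  track x y (2 * lam * (1 + (count (fun z => x < z < y) G)%:R)).
Proof.
have l0 := lam0.
elim: G t x => [|t' G IH] t x /=.
  move=> h et tx xy ye; rewrite addr0 mulr1; apply: (step_track (t := t) (t' := e)) => //.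
  split; first by apply/andP; split; lin.
  by move=> q /h /ltW.
move=> [/andP[t1 t2] e1 st h] et tx xy ye.
have hst : step t t' by split => //; apply/andP; split; lin.
have cnt n : 2 * lam * (1 + 0) <= 2 * lam * (1 + n%:R :> R).
  by rewrite ler_pM2l ?lerD2l ?ler0n //; lin.
have [yt|ty] := lerP y t'.
  by apply: track_weaken (step_track hst tx xy yt); rewrite -[leLHS]mulr1 -[X in _ * X]addr0.
have [tx'|xt] := lerP t' x.
  have et' : e <= t' + 1 by lin.
  by rewrite /= ?add0n; exact: (IH t' x h et' tx' xy ye).
rewrite ?xt ?ty /=.
have := track_cat T (_ : x <= t' <= y) (step_track hst tx (ltW xt) (lexx _))
  (IH t' t' h _ (lexx _) (ltW ty) ye).
rewrite (ltW xt) (ltW ty) => /(_ isT).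
have et' : e <= t' + 1 by lin.
move=> /(_ et'); apply: track_weaken.
have : (count (fun z => (t' < z < y)%R) G <= count (fun z => (x < z < y)%R) G)%N.
  by apply: sub_count => z /andP[z1 z2]; rewrite (lt_trans xt z1).
rewrite -(ler_nat R) natrD => hc.
have := ler_wpM2l (ltW l0) hc; lin.
Qed.

End Greedy.

(** * Variation and length along tracks *)

Section Sums.
Context {R : realType}.
Implicit Types (x y z t : R) (s : seq R) (d f : R -> R -> R).

Lemma vsum_le d f x s : (forall t t', t < t' -> t \in x :: s -> t' \in x :: s -> d t t' <= f t t') ->
  path <%R x s -> vsum d x s <= vsum f x s.
Proof.
elim: s x => //= y s IH x h /andP[xy p]; apply: lerD.
  by apply: h => //; rewrite !inE eqxx ?orbT.
by apply: IH p => t t' tt m m'; apply: h => //; rewrite inE ?m ?m' orbT.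
Qed.

Lemma vsum_telescope (y : R -> R) x s : vsum (fun t t' => y t' - y t) x s = y (last x s) - y x.
Proof. by elim: s x => [|z s IH] x /=; rewrite ?subrr // IH; ring. Qed.

Lemma vsum_tri d x s : (forall t, d t t = 0) -> (forall t t' t'', d t t'' <= d t t' + d t' t'') ->
  d x (last x s) <= vsum d x s.
Proof.
move=> d0 tri; elim: s x => [|y s IH] x /=; first by rewrite d0.
by apply: le_trans (tri x y _) _; rewrite lerD2l.
Qed.

Lemma vsum_big (T : Type) (r : seq T) (f : T -> R -> R -> R) x s :
  vsum (fun t t' => \sum_(i <- r) f i t t') x s = \sum_(i <- r) vsum (f i) x s.
Proof.
elim: s x => [|y s IH] x /=; first by rewrite big1.
by rewrite IH -big_split.
Qed.

Lemma vsum_insert d x s y : (forall t, d t t = 0) ->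
  (forall t t' t'', d t t'' <= d t t' + d t' t'') -> path <%R x s -> x <= y <= last x s ->
  exists s1 s2, [/\ path <%R x s1, last x s1 = y, path <%R y s2, last y s2 = last x s &
    vsum d x s <= vsum d x s1 + vsum d y s2].
Proof.
move=> d0 tri; elim: s x => [|h s IH] x /=.
  move=> _ /andP[h1 h2]; have -> : y = x by apply/eqP; rewrite eq_le h1 h2.
  by exists [::], [::]; split => //=; rewrite addr0.
move=> /andP[xh ps] /andP[xy yl]; rewrite le_eqVlt in xy; case/orP: xy => [/eqP <-|xy].
  by exists [::], (h :: s); split; rewrite /= ?xh ?add0r.
have [yh|hy] := ltrP y h.
  exists [:: y], (h :: s); split; rewrite /= ?xy ?yh ?addr0 ?addrA //.
  by rewrite lerD2r.
have [|s1 [s2 [p1 l1 p2 l2 v]]] := IH h ps; first by rewrite hy.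
by exists (h :: s1), s2; split; rewrite /= ?xh // -addrA lerD2l.
Qed.

Definition fine_step (e : R) := fun t t' : R => (t < t') && (t' < t + e).

Lemma fine_lt e x s : path (fine_step e) x s -> path <%R x s.
Proof. by apply: sub_path => t t' /andP[]. Qed.

Lemma fine_subdivision e x y : 0 < e -> x <= y -> exists s, path (fine_step e) x s /\ last x s = y.
Proof.
move=> e0 xy; have [n hn] : exists n : nat, y - x <= n%:R * (e / 2).
  exists (Num.bound ((y - x) / (e / 2))); rewrite -ler_pdivrMr ?divr_gt0 //; apply: ltW.
  by apply: archi_boundP; rewrite divr_ge0 ?subr_ge0 //; lin.
elim: n x xy hn => [|n IH] x xy hn.
  by exists [::]; split => //=; rewrite mul0r in hn; lin.
rewrite le_eqVlt in xy; case/orP: xy => [/eqP <-|xy]; first by exists [::].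
have [h|h] := ltrP y (x + e / 2).
  by exists [:: y]; split => //=; rewrite andbT /fine_step xy; lin.
have [|s [p l]] := IH (x + e / 2) h.
  by move: hn; rewrite -natr1 mulrDl mul1r; lin.
exists (x + e / 2 :: s); split => //=; rewrite p andbT /fine_step; apply/andP; split; lin.
Qed.

(** Refining a partition does not lower the sum of a [d] with the triangle inequality, so closeness
    of consecutive times may always be imposed. *)
Lemma fine_refine d e x s : 0 < e -> (forall t, d t t = 0) ->
  (forall t t' t'', d t t'' <= d t t' + d t' t'') -> path <%R x s ->
  exists s', [/\ path (fine_step e) x s', last x s' = last x s & vsum d x s <= vsum d x s'].
Proof.
move=> e0 d0 tri; elim: s x => [|y s IH] x /=; first by exists [::].
move=> /andP[xy /IH [s2 [p2 l2 v2]]].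
have [s1 [p1 l1]] := fine_subdivision e0 (ltW xy).
exists (s1 ++ s2); split; first by rewrite cat_path p1 l1.
  by rewrite last_cat l1.
rewrite vsum_cat l1; apply: lerD v2.
by rewrite -{1}l1; exact: vsum_tri.
Qed.

Lemma path_mem_ge x s t : path <%R x s -> t \in x :: s -> x <= t <= last x s.
Proof.
elim: s x t => [|y s IH] x t /=; first by rewrite inE => _ /eqP ->; rewrite lexx.
move=> /andP[xy p]; rewrite inE => /orP[/eqP ->|/(IH _ _ p)/andP[h1 h2]].
  by rewrite lexx /=; apply: le_trans (ltW xy) _; have /andP[] := IH y y p (mem_head _ _).
by rewrite h2 andbT; apply: le_trans (ltW xy) h1.
Qed.

Lemma split_mem x s t : t \in x :: s -> exists s1 s2, s = s1 ++ s2 /\ last x s1 = t.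
Proof.
rewrite inE => /orP[/eqP ->|]; first by exists [::], s.
by case/splitPr => s1 s2; exists (rcons s1 t), s2; rewrite cat_rcons last_rcons.
Qed.

Lemma seq_argmax (y : R -> R) x s : exists2 p, p \in x :: s & forall t, t \in x :: s -> y t <= y p.
Proof.
elim: s x => [|h s IH] x; first by exists x; rewrite ?mem_head // => t; rewrite inE => /eqP ->.
have [p ps pm] := IH h; have [le1|le1] := lerP (y x) (y p).
  exists p; first by rewrite inE ps orbT.
  by move=> t; rewrite inE => /orP[/eqP -> //|]; exact: pm.
exists x; first by rewrite mem_head.
by move=> t; rewrite inE => /orP[/eqP -> //|/pm h1]; apply: le_trans h1 (ltW le1).
Qed.

(* Along P, the function y does not go down, up and down again across a common level. *)
Definition no_zigzag (P : pred R) (y : R -> R) := forall t1 t2 t3 t4, t1 \in P -> t2 \in P ->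
  t3 \in P -> t4 \in P -> t1 < t2 -> t2 < t3 -> t3 < t4 ->
  y t2 < y t1 -> y t2 < y t3 -> y t4 < y t1 -> y t4 < y t3 -> False.

(** Meant for [X] the values of a functional along a track, [S] those of the normal offset and
    [X - S] those along the boundary. When [X - S] is monotone, [S] enters only at the two ends. *)
Lemma vsum_increasing (X S : R -> R) x s : path <%R x s ->
  (forall t t', t \in x :: s -> t' \in x :: s -> t < t' -> X t - S t <= X t' - S t') ->
  vsum (fun t t' => `|(X t' - S t') - (X t - S t)|) x s <=
    vsum (fun t t' => `|X t' - X t|) x s + S x - S (last x s).
Proof.
move=> p h; apply: le_trans (_ : vsum (fun t t' => (X t' - S t') - (X t - S t)) x s <= _).
  apply: vsum_le p => t t' tt m m'; rewrite ger0_norm // subr_ge0; exact: h.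
rewrite (vsum_telescope (fun t => X t - S t)).
have := vsum_abs_ge X x s; have := ler_norm (X (last x s) - X x); lin.
Qed.

Lemma vsum_decreasing (X S : R -> R) x s : path <%R x s ->
  (forall t t', t \in x :: s -> t' \in x :: s -> t < t' -> X t' - S t' <= X t - S t) ->
  vsum (fun t t' => `|(X t' - S t') - (X t - S t)|) x s <=
    vsum (fun t t' => `|X t' - X t|) x s - S x + S (last x s).
Proof.
move=> p h; apply: le_trans (_ : vsum (fun t t' => (S t' - X t') - (S t - X t)) x s <= _).
  by apply: vsum_le p => t t' tt m m'; rewrite ler0_norm ?subr_le0; [lin|exact: h].
rewrite (vsum_telescope (fun t => S t - X t)).
have := vsum_abs_ge X x s; have := ler_norm (- (X (last x s) - X x)).
rewrite normrN; lin.
Qed.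

(** Without zigzags [X - S] rises to its maximum [p], falls to its minimum [q] and rises again. The
    three telescoping sums contain [S p] and [S q] twice each, whence [4 * B]. *)
Lemma vsum_two_turns_aux (X S : R -> R) x s (p q B : R) : path <%R x s ->
  p \in x :: s -> q \in x :: s -> p <= q ->
  (forall t, t \in x :: s -> X t - S t <= X p - S p) ->
  (forall t, t \in x :: s -> X q - S q <= X t - S t) ->
  no_zigzag (mem (x :: s)) (fun t => X t - S t) ->
  (forall t, t \in x :: s -> `|S t| <= B) ->
  vsum (fun t t' => `|(X t' - S t') - (X t - S t)|) x s <=
    vsum (fun t t' => `|X t' - X t|) x s + `|S x| + `|S (last x s)| + 4 * B.
Proof.
move=> ps pm qm pq; set y := fun t => X t - S t => pmax qmin zz SB.
have inc1 i j : i \in x :: s -> j \in x :: s -> i < j -> j <= p -> y i <= y j.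
  move=> im jm ij jp; rewrite leNgt; apply/negP => h.
  have hq := qmin j jm; have hp := pmax i im; rewrite -/(y _) -/(y _) in hq; rewrite -/(y _) -/(y _) in hp.
  have njp : j != p by apply: contraTneq h => ->; rewrite -leNgt.
  have npq : p != q by apply: contraTneq h => e; rewrite -leNgt; move: hq hp; rewrite e; lin.
  have lt1 : j < p by rewrite lt_neqAle njp.
  have lt2 : p < q by rewrite lt_neqAle npq.
  by apply: (zz i j p q) => //; rewrite -/(y _) -/(y _); lin.
have dec i j : i \in x :: s -> j \in x :: s -> i < j -> p <= i -> j <= q -> y j <= y i.
  move=> im jm ij ip jq; rewrite leNgt; apply/negP => h.
  have hq := qmin i im; have hp := pmax j jm; rewrite -/(y _) -/(y _) in hq; rewrite -/(y _) -/(y _) in hp.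
  have njq : j != q by apply: contraTneq h => ->; rewrite -leNgt.
  have nip : i != p by apply: contraTneq h => ->; rewrite -leNgt.
  have lt1 : j < q by rewrite lt_neqAle njq.
  have lt2 : p < i by rewrite lt_neqAle eq_sym nip.
  by apply: (zz p i j q) => //; rewrite -/(y _) -/(y _); lin.
have inc2 i j : i \in x :: s -> j \in x :: s -> i < j -> q <= i -> y i <= y j.
  move=> im jm ij qi; rewrite leNgt; apply/negP => h.
  have hq := qmin j jm; have hp := pmax i im; rewrite -/(y _) -/(y _) in hq; rewrite -/(y _) -/(y _) in hp.
  have niq : i != q by apply: contraTneq h => ->; rewrite -leNgt.
  have npq : p != q by apply: contraTneq h => e; rewrite -leNgt; move: hq hp; rewrite e; lin.
  have lt1 : q < i by rewrite lt_neqAle eq_sym niq.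
  have lt2 : p < q by rewrite lt_neqAle npq.
  by apply: (zz p q i j) => //; rewrite -/(y _) -/(y _); lin.
have [s1 [s23 [es l1]]] := split_mem pm.
have : q \in p :: s23.
  move: qm; rewrite es -cat_cons mem_cat => /orP[|h]; last by rewrite inE h orbT.
  move: (ps); rewrite es cat_path => /andP[p1 _] /(path_mem_ge p1) /andP[_]; rewrite l1 => qp.
  by have -> : q = p; [apply/eqP; rewrite eq_le qp|rewrite mem_head].
move=> /split_mem [s2 [s3 [es2 l2]]].
move: ps; rewrite es es2 !cat_path l1 l2 => /and3P[p1 p2 p3].
rewrite !vsum_cat !last_cat l1 l2.
have m1 t : t \in x :: s1 -> t \in x :: s.
  by rewrite es !inE mem_cat => /orP[->//|->]; rewrite orbT.
have m2 t : t \in p :: s2 -> t \in x :: s.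
  rewrite inE => /orP[/eqP -> //|h]; by rewrite es es2 inE !mem_cat h !orbT.
have m3 t : t \in q :: s3 -> t \in x :: s.
  rewrite inE => /orP[/eqP -> //|h]; by rewrite es es2 inE !mem_cat h !orbT.
have h1 : vsum (fun t t' => `|(X t' - S t') - (X t - S t)|) x s1 <=
    vsum (fun t t' => `|X t' - X t|) x s1 + S x - S (last x s1).
  apply: (vsum_increasing p1) => t t' /[dup] /m1 tm _ /[dup] /m1 tm' /(path_mem_ge p1)/andP[_].
  by rewrite l1 => tp tt; exact: inc1.
have h2 : vsum (fun t t' => `|(X t' - S t') - (X t - S t)|) p s2 <=
    vsum (fun t t' => `|X t' - X t|) p s2 - S p + S (last p s2).
  apply: (vsum_decreasing p2) => t t' /[dup] /m2 tm /(path_mem_ge p2)/andP[pt _].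
  move=> /[dup] /m2 tm' /(path_mem_ge p2)/andP[_].
  by rewrite l2 => tq tt; exact: dec.
have h3 : vsum (fun t t' => `|(X t' - S t') - (X t - S t)|) q s3 <=
    vsum (fun t t' => `|X t' - X t|) q s3 + S q - S (last q s3).
  apply: (vsum_increasing p3) => t t' /[dup] /m3 tm /(path_mem_ge p3)/andP[qt _].
  by move=> /[dup] /m3 tm' _ tt; exact: inc2.
rewrite l1 in h1; rewrite l2 in h2.
have := SB p pm; have := SB q qm; rewrite !ler_norml => /andP[b1 b2] /andP[b3 b4].
have := ler_norm (S x); have := ler_norm (- S (last q s3)); rewrite normrN.
move: h1 h2 h3 b1 b2 b3 b4.
move: (vsum _ x s1) (vsum _ p s2) (vsum _ q s3) => V1 V2 V3.
move: (vsum _ x s1) (vsum _ p s2) (vsum _ q s3) => W1 W2 W3.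
move: (S x) (S p) (S q) (S (last q s3)) => Sx Sp Sq Sl; lin.
Qed.

Lemma vsum_two_turns (X S : R -> R) x s (B : R) : path <%R x s ->
  no_zigzag (mem (x :: s)) (fun t => X t - S t) ->
  no_zigzag (mem (x :: s)) (fun t => S t - X t) ->
  (forall t, t \in x :: s -> `|S t| <= B) ->
  vsum (fun t t' => `|(X t' - S t') - (X t - S t)|) x s <=
    vsum (fun t t' => `|X t' - X t|) x s + `|S x| + `|S (last x s)| + 4 * B.
Proof.
move=> ps z1 z2 SB.
have [p pm pmax] := seq_argmax (fun t => X t - S t) x s.
have [q qm qmin] := seq_argmax (fun t => S t - X t) x s.
have [pq|/ltW qp] := lerP p q.
  by apply: (vsum_two_turns_aux (p := p) (q := q)) => // t /qmin; lin.
have := @vsum_two_turns_aux (fun t => - X t) (fun t => - S t) x s q p B ps qm pm qp.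
rewrite !normrN => h.
have e1 : vsum (fun t t' => `|(- X t' - - S t') - (- X t - - S t)|) x s =
    vsum (fun t t' => `|(X t' - S t') - (X t - S t)|) x s.
  by congr vsum; apply/funext => t; apply/funext => t'; rewrite -normrN; congr `|_|; ring.
have e2 : vsum (fun t t' => `|- X t' - - X t|) x s = vsum (fun t t' => `|X t' - X t|) x s.
  by congr vsum; apply/funext => t; apply/funext => t'; rewrite -normrN; congr `|_|; ring.
rewrite e1 e2 in h; apply: h.
- by move=> t /qmin; lin.
- by move=> t /pmax; lin.
- have -> : (fun t => - X t - - S t) = (fun t => S t - X t) by apply/funext => t; ring.
  exact: z2.
- by move=> t /SB; rewrite normrN.
Qed.

End Sums.

Section Arcs.
Context {R : realType} (N : plane R -> R) (hN : is_norm N) (a u : R -> plane R) (lam : R).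
Hypotheses (lam0 : 0 < lam) (u1 : forall t, N (u t) = 1).
Implicit Types (x y z t : R) (s : seq R) (v : plane R).

Local Notation cd := (fun t t' : R => N (a t' - a t)).

Lemma norming_dir v : exists f, dual_ball N f /\ dot f ((N v)^-1 *: v) = N ((N v)^-1 *: v).
Proof. exact: norming_functional. Qed.

(** A functional norming [v], chosen through the unit vector of the same direction so that it
    depends on that direction only. *)
Definition psi v := projT1 (cid (norming_dir v)).

Lemma psi_dual v : dual_ball N (psi v).
Proof. by rewrite /psi; case: cid => f []. Qed.

Lemma psi_norm v : v != 0 -> dot (psi v) v = N v.
Proof.
move=> v0; have p := norm_gt0 hN v0.
rewrite /psi; case: cid => f /= [_]; rewrite dotZr (normZp hN) ?invr_ge0 ?(ltW p) //.
by rewrite mulVf ?gt_eqF // => h; apply: (mulfI (_ : (N v)^-1 != 0)); rewrite ?invr_eq0 ?gt_eqF // h mulVf // gt_eqF.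
Qed.

Lemma psi_scale c v : 0 < c -> psi (c *: v) = psi v.
Proof.
move=> c0; have [->|v0] := eqVneq v 0; first by rewrite scaler0.
have e : (N (c *: v))^-1 *: (c *: v) = (N v)^-1 *: v.
  rewrite (normZp hN _ (ltW c0)) invfM scalerA mulrAC mulVf ?mul1r // gt_eqF //.
rewrite /psi; have E : (fun f => dual_ball N f /\ dot f ((N (c *: v))^-1 *: (c *: v)) =
   N ((N (c *: v))^-1 *: (c *: v))) = (fun f => dual_ball N f /\ dot f ((N v)^-1 *: v) =
   N ((N v)^-1 *: v)) by rewrite e.
(* The choice is made from a proof of existence; once the two predicates are identified, the two
   proofs are equal. *)
by move: (norming_dir (c *: v)) (norming_dir v); rewrite E => h1 h2; rewrite (Prop_irrelevance h1 h2).
Qed.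

Lemma cd0 t : cd t t = 0.
Proof. by rewrite /= subrr (norm0 hN). Qed.
Lemma cd_tri t t' t'' : cd t t'' <= cd t t' + cd t' t''.
Proof. by rewrite /= [leRHS]addrC; apply: (norm_triB hN). Qed.

(** Here [w = p *: v - q *: v'] with nonnegative [p] and [q]. Each functional norms its own vector
    and is at most the norm on the other, so [p * N v - q * N v'] separates the two values. *)
Lemma psi_turn k v v' w : (k = 1 \/ k = -1) -> 0 < k * det w v -> 0 < k * det w v' ->
  0 <= k * det v v' -> dot (psi v') w <= dot (psi v) w.
Proof.
move=> hk wv wv' vv.
have v0 : v != 0 by apply: contraTneq wv => ->; rewrite /det !mxE !mulr0 subrr mulr0 ltxx.
have v'0 : v' != 0 by apply: contraTneq wv' => ->; rewrite /det !mxE !mulr0 subrr mulr0 ltxx.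
have [e|ne] := eqVneq (det v v') 0.
  have [c ec] := det_eq0 v0 e.
  have c0 : 0 < c by move: wv'; rewrite ec detZr mulrCA pmulr_lgt0.
  by rewrite ec psi_scale.
have kk : k * k = 1 by case: hk => ->; ring.
have vv0 : 0 < k * det v v'.
  rewrite lt_neqAle vv andbT eq_sym mulf_neq0 //; by case: hk => ->; rewrite ?oppr_eq0 oner_neq0.
have e := det_decomp w ne.
have -> : w = (k * det w v' / (k * det v v')) *: v - (k * det w v / (k * det v v')) *: v'.
  have k0 : k != 0 by case: hk => ->; rewrite ?oppr_eq0 oner_neq0.
  rewrite {1}e -[- (_ *: v')]scaleNr; congr (_ *: _ + _ *: _).
    by rewrite -mulf_div mulfV // mul1r.
  by rewrite -mulf_div mulfV // mul1r (detC v w) mulNr.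
set p := _ / _; set q := _ / _.
have p0 : 0 <= p by rewrite divr_ge0 // ltW.
have q0 : 0 <= q by rewrite divr_ge0 // ltW.
clearbody p q; rewrite !dotBr !dotZr (psi_norm v0) (psi_norm v'0).
have := ler_wpM2l p0 (psi_dual v' v); have := ler_wpM2l q0 (psi_dual v v'); lin.
Qed.

(* Abel summation along the chain: by psi_turn the boundary terms at inner vertices are at most 0. *)
Lemma convex_chain (k e al be : R) (X : R -> plane R) (sg L : R -> R) :
  (k = 1 \/ k = -1) ->
  (forall t t', fine_step e t t' -> 0 < k * det (u t) (a t' - a t) /\ 0 < k * det (u t') (a t' - a t)) ->
  (forall t t' t'', al <= t -> t'' <= be -> fine_step e t t' -> fine_step e t' t'' ->
     0 <= k * det (a t' - a t) (a t'' - a t')) ->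
  (forall q, al <= q <= be -> X q = a q + sg q *: u q /\ 0 <= sg q) ->
  (forall q q', al <= q -> q <= q' -> q' <= be -> N (X q' - X q) <= L q' - L q) ->
  forall s x y, al <= x -> last y s <= be -> path (fine_step e) x (y :: s) ->
  vsum cd x (y :: s) <= L (last y s) - L x + sg x * dot (psi (a y - a x)) (u x) + sg (last y s).
Proof.
move=> hk side turn hX hL.
(* The increment of the track is tested against the functional that norms the chord of [a] below
   it. *)
have one x y : al <= x -> y <= be -> fine_step e x y ->
    N (a y - a x) <= L y - L x + sg x * dot (psi (a y - a x)) (u x) -
      sg y * dot (psi (a y - a x)) (u y).
  move=> ax yb xy; have [h1 _] := side _ _ xy; have /andP[lt _] := xy.
  have [|eX s0] := hX x; first by rewrite ax (le_trans (ltW lt) yb).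
  have [|eY s0'] := hX y; first by rewrite yb (le_trans ax (ltW lt)).
  have n0 : a y - a x != 0 by apply: contraTneq h1 => ->; rewrite /det !mxE !mulr0 subrr mulr0 ltxx.
  have h2 := hL x y ax (ltW lt) yb.
  have h3 := psi_dual (a y - a x) (X y - X x).
  rewrite -(psi_norm n0); set f := psi _ in h3 *.
  by move: h3; rewrite {1}eX {1}eY !dotBr !dotDr !dotZr; lin.
elim=> [|z s IH] x y ax lb /=.
  rewrite andbT addr0 => xy; apply: le_trans (one _ _ ax lb xy) _.
  have /andP[lt _] := xy; rewrite /= in lb.
  have [|_ s0] := hX y; first by rewrite lb (le_trans ax (ltW lt)).
  have := dual_ball_abs hN (u y) (psi_dual (a y - a x)); rewrite u1 ler_norml => /andP[h _].
  have := ler_wpM2l s0 h; lin.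
move=> /and3P[xy yz p]; have /andP[lt1 _] := xy; have /andP[lt2 _] := yz.
have zb : z <= be.
  by apply: le_trans lb; have /andP[] := path_mem_ge (fine_lt p) (mem_head _ _).
have ay : al <= y by apply: le_trans ax (ltW lt1).
have := IH y z ay lb; rewrite /= yz p => /(_ isT) h.
have yb : y <= be by apply: le_trans (ltW lt2) zb.
have := one _ _ ax yb xy.
have [|_ s0] := hX y; first by rewrite ay.
have [_ d1] := side _ _ xy; have [d2 _] := side _ _ yz.
have := ler_wpM2l s0 (psi_turn hk d1 d2 (turn _ _ _ ax zb xy yz)); lin.
Qed.

(** After the summation only the two ends of the track remain. Both are at height [lam] and the
    normals have norm 1, hence the term [2 * lam]. *)
Lemma convex_arc_length (k e al be l : R) : 0 < e -> (k = 1 \/ k = -1) ->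
  (forall t t', fine_step e t t' -> 0 < k * det (u t) (a t' - a t) /\ 0 < k * det (u t') (a t' - a t)) ->
  (forall t t' t'', al <= t -> t'' <= be -> fine_step e t t' -> fine_step e t' t'' ->
     0 <= k * det (a t' - a t) (a t'' - a t')) ->
  track N a u lam al be l ->
  forall s, path <%R al s -> last al s = be -> vsum cd al s <= l + 2 * lam.
Proof.
move=> e0 hk side turn [X [sg [L [hX sa sb hL ll]]]] s p ls.
have [s' [p' l' v']] := fine_refine e0 cd0 cd_tri p.
apply: le_trans v' _; rewrite ls in l'.
have l0 := lam0.
case: s' p' l' => [|y s'] p' l' /=.
  have e' : al = be := l'.
  by have := hL al al (lexx _) (lexx _); rewrite -e' in ll * => /(_ (lexx _)); rewrite subrr (norm0 hN); lin.
have hX' q : al <= q <= be -> X q = a q + sg q *: u q /\ 0 <= sg q.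
  by move=> /hX [-> /andP[]].
have := convex_chain hk side turn hX' hL (lexx _) _ p'.
move: l'; rewrite /= => ->; rewrite lexx => /(_ isT) h; apply: le_trans h _.
have := dual_ball_abs hN (u al) (psi_dual (a y - a al)); rewrite u1 ler_norml => /andP[_ h].
by rewrite sa sb; have := ler_wpM2l (ltW l0) h; lin.
Qed.

(** The dual polygon has as vertices the functionals norming the edges of one inscribed polygon, so
    half the zonotope sum is at most [N] everywhere and reaches [N] on these edges. *)
Lemma chord_zonotope (g : R -> plane R) x s : exists Ds : seq (plane R),
  (forall v, \sum_(D <- Ds) `|dot D v| <= 2 * N v) /\
  2 * vsum (fun t t' => N (g t' - g t)) x s <=
    vsum (fun t t' => \sum_(D <- Ds) `|dot D (g t') - dot D (g t)|) x s.
Proof.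
pose es := pairmap (fun t t' => g t' - g t) x s.
have [Ds [Dle Dge]] : exists Ds : seq (plane R), (forall v, \sum_(D <- Ds) `|dot D v| <= 2 * N v) /\
    forall f v, f \in [seq psi v | v <- es & v != 0] -> 2 * `|dot f v| <= \sum_(D <- Ds) `|dot D v|.
  apply: (zonotope hN) => f /mapP[v]; rewrite mem_filter => /andP[v0 _] ->.
  by split; [exact: psi_dual|exists v => //; exact: psi_norm].
exists Ds; split => //.
have : forall v, v \in es -> 2 * N v <= \sum_(D <- Ds) `|dot D v|.
  move=> v ve; have [->|v0] := eqVneq v 0.
    by rewrite (norm0 hN) mulr0 sumr_ge0.
  apply: le_trans (Dge (psi v) v _); last by apply: map_f; rewrite mem_filter v0.
  by rewrite ler_pM2l // psi_norm // ler_norm.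
rewrite /es; elim: s x {es Dge} => [|y r IH] x /= h; first by rewrite mulr0.
rewrite mulrDr; apply: lerD; last by apply: IH => v ve; apply: h; rewrite inE ve orbT.
have -> : \sum_(D <- Ds) `|dot D (g y) - dot D (g x)| = \sum_(D <- Ds) `|dot D (g y - g x)|.
  by apply: eq_bigr => D _; rewrite dotBr.
by apply: h; rewrite mem_head.
Qed.

(* The two changes of monotonicity of each functional D of a zonotope and the two ends account
   for the difference between the variations of D along a and along X. *)
Lemma concave_arc_length (al be l P : R) :
  (forall Ds : seq (plane R), (forall v, \sum_(D <- Ds) `|dot D v| <= 2 * N v) ->
     2 * \sum_(D <- Ds) dual_norm hN D <= P) ->
  (forall D, no_zigzag [pred t | al <= t <= be] (fun t => dot D (a t))) ->
  track N a u lam al be l ->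
  forall s, path <%R al s -> last al s = be -> vsum cd al s <= l + 2 * lam + 2 * lam * P.
Proof.
move=> hP zz [X [sg [L [hX sa sb hL ll]]]] s p ls; have l0 := lam0.
have [Ds [Dle hV]] := chord_zonotope a al s.
set V := vsum (fun t t' => \sum_(D <- Ds) _) al s in hV.
have inI t : t \in al :: s -> al <= t <= be.
  by move=> /(path_mem_ge p); rewrite ls.
have hD D : vsum (fun t t' => `|dot D (a t') - dot D (a t)|) al s <=
    vsum (fun t t' => `|dot D (X t') - dot D (X t)|) al s + lam * `|dot D (u al)| +
      lam * `|dot D (u be)| + 8 * lam * dual_norm hN D.
  pose S t := sg t * dot D (u t).
  have SE t : al <= t <= be -> dot D (a t) = dot D (X t) - S t.
    by move=> /hX[-> _]; rewrite dotDr dotZr /S; ring.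
  have := @vsum_two_turns _ (fun t => dot D (X t)) S al s (2 * lam * dual_norm hN D) p.
  have e1 : vsum (fun t t' => `|dot D (a t') - dot D (a t)|) al s =
      vsum (fun t t' => `|dot D (X t') - S t' - (dot D (X t) - S t)|) al s.
    have E x r : (forall t, t \in x :: r -> al <= t <= be) ->
        vsum (fun t t' => `|dot D (a t') - dot D (a t)|) x r =
        vsum (fun t t' => `|dot D (X t') - S t' - (dot D (X t) - S t)|) x r.
      elim: r x => [|y r IH] x //= hI.
      have hx := SE x (hI x (mem_head _ _)).
      have hy : dot D (a y) = dot D (X y) - S y by apply: SE; apply: hI; rewrite !inE eqxx orbT.
      by rewrite hx hy IH // => t tr; apply: hI; rewrite inE tr orbT.
    exact: E.
  rewrite e1 => h; apply: le_trans (h _ _ _) _.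
  - move=> t1 t2 t3 t4 /inI i1 /inI i2 /inI i3 /inI i4 t12 t23 t34.
    by rewrite -!SE //; exact: (zz D).
  - move=> t1 t2 t3 t4 /inI i1 /inI i2 /inI i3 /inI i4 t12 t23 t34.
    have eS t : al <= t <= be -> S t - dot D (X t) = dot (- D) (a t).
      by move=> tI; rewrite dotNl SE //; ring.
    by rewrite !eS //; exact: (zz (- D)).
  - move=> t /inI /hX[_ /andP[s0 s1]]; rewrite /S normrM ger0_norm //.
    apply: ler_pM => //; have := dual_norm_abs hN D (u t); by rewrite u1 mulr1.
  rewrite ls /S sa sb !normrM gtr0_norm //; lin.
have hX2 : vsum (fun t t' => \sum_(D <- Ds) `|dot D (X t') - dot D (X t)|) al s <= 2 * l.
  apply: le_trans (_ : vsum (fun t t' => 2 * (L t' - L t)) al s <= _).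
    apply: vsum_le p => t t' tt /inI /andP[t1 t2] /inI /andP[t1' t2'].
    apply: le_trans (_ : 2 * N (X t' - X t) <= _); last first.
      by rewrite ler_pM2l //; apply: hL => //; exact: ltW.
    apply: le_trans (Dle _); apply: ler_sum => D _; by rewrite dotBr.
  have -> : (fun t t' => 2 * (L t' - L t)) = (fun t t' => 2 * L t' - 2 * L t).
    by apply/funext => t; apply/funext => t'; ring.
  by rewrite (vsum_telescope (fun t => 2 * L t)) ls; lin.
(* The zonotope sum at a unit normal is at most 2, which accounts for the two ends. Each turn of [D]
   occurs at height at most [2 * lam], whence [8 * lam] times the dual norm of [D] in [hD], and
   [4 * lam * P] after summation. Everything is halved at the end. *)
have hV2 : V <= 2 * l + lam * (2 * 1) + lam * (2 * 1) + 4 * lam * P.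
  rewrite /V vsum_big; apply: le_trans (ler_sum _ (fun D _ => hD D)) _.
  rewrite !big_split /= -vsum_big -!mulr_sumr.
  have k1 := Dle (u al); have k2 := Dle (u be); rewrite u1 in k1; rewrite u1 in k2.
  have k3 := hP Ds Dle.
  have := ler_wpM2l (ltW l0) k1; have := ler_wpM2l (ltW l0) k2; have := ler_wpM2l (ltW l0) k3.
  lin.
lin.
Qed.

End Arcs.

Section Partitions.
Context {R : realType}.
Implicit Types (x y z t c : R) (s E : seq R) (d : R -> R -> R).

Lemma vsum_nth x0 d x s :
  vsum d x s = \sum_(0 <= j < size s) d (nth x0 (x :: s) j) (nth x0 (x :: s) j.+1).
Proof.
elim: s x => [|y s IH] x; first by rewrite big_geq.
by rewrite [size _]/= big_nat_recl //= IH.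
Qed.

Lemma vsum_subseq d x s s' : (forall t, d t t = 0) -> (forall t t' t'', d t t'' <= d t t' + d t' t'') ->
  subseq s s' -> last x s = last x s' -> vsum d x s <= vsum d x s'.
Proof.
move=> d0 tri; elim: s' x s => [|y s' IH] x s /=; first by move/eqP ->.
case: s => [|z s].
  by move=> _ e; have := vsum_tri x (y :: s') d0 tri; rewrite /= -e d0.
case: eqVneq => [-> h e|_ h e]; first by rewrite /= lerD2l; apply: IH.
apply: le_trans (_ : d x y + vsum d y (z :: s) <= _); last by rewrite lerD2l; apply: IH.
by rewrite /= addrA lerD2r.
Qed.

Lemma path_refine x s s' y : x <= y -> path <%R x s -> last x s = y -> path <%R x s' -> last x s' = y ->
  exists E, [/\ path <%R x E, last x E = y, subseq s E & subseq s' E].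
Proof.
move=> xy p l p' l'; pose E := sort <=%R (undup (s ++ s')).
have memE t : t \in E = (t \in s) || (t \in s') by rewrite mem_sort mem_undup mem_cat.
have gt r t : path <%R x r -> t \in r -> x < t.
  by move=> /(order_path_min lt_trans)/allP h /h.
have srt : sorted <%R E by rewrite lt_sorted_uniq_le sort_uniq undup_uniq sort_le_sorted.
have pE : path <%R x E.
  by rewrite path_min_sorted //; apply/allP => t; rewrite memE => /orP[]; exact: gt.
have sub r : path <%R x r -> {subset r <= E} -> subseq r E.
  move=> pr h; have -> : r = [seq t <- E | t \in r]; last exact: filter_subseq.
  apply: (irr_sorted_eq lt_trans ltxx); first exact: path_sorted pr.
    exact: sorted_filter lt_trans _ _ srt.
  by move=> t; rewrite mem_filter; case tr : (t \in r) => //=; rewrite h.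
exists E; split => //.
- have le t : t \in x :: E -> t <= y.
    rewrite inE memE => /or3P[/eqP -> //|h|h].
      by have /andP[_] := path_mem_ge p (mem_behead (s := x :: s) h); rewrite l.
    by have /andP[_] := path_mem_ge p' (mem_behead (s := x :: s') h); rewrite l'.
  apply/eqP; rewrite eq_le le ?mem_last //=.
  have yE : y \in x :: E.
    have := mem_last x s; rewrite l !inE memE => /orP[->//|->]; by rewrite orbT.
  by have /andP[_] := path_mem_ge pE yE.
- by apply: sub => // t ts; rewrite memE ts.
- by apply: sub => // t ts; rewrite memE ts orbT.
Qed.

(** To sum over the functionals of a zonotope, one partition must serve them all. *)
Lemma common_refinement (I : eqType) (r : seq I) (d : I -> R -> R -> R) (A : I -> R) x y : x <= y ->
  (forall i t, d i t t = 0) -> (forall i t t' t'', d i t t'' <= d i t t' + d i t' t'') ->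
  (forall i, i \in r -> exists E, [/\ path <%R x E, last x E = y & A i <= vsum (d i) x E]) ->
  exists E, [/\ path <%R x E, last x E = y & forall i, i \in r -> A i <= vsum (d i) x E].
Proof.
move=> xy d0 tri; elim: r => [|i r IH] h.
  move: xy; rewrite le_eqVlt => /orP[/eqP <-|xy]; first by exists [::].
  by exists [:: y]; split; rewrite //= xy.
have [|E [p l hE]] := IH; first by move=> j jr; apply: h; rewrite inE jr orbT.
have [E' [p' l' hE']] := h i (mem_head _ _).
have [E2 [p2 l2 s s']] := path_refine xy p l p' l'.
exists E2; split => // j; rewrite inE => /orP[/eqP ->|jr].
  by apply: le_trans hE' _; apply: vsum_subseq; rewrite ?l2.
by apply: le_trans (hE j jr) _; apply: vsum_subseq; rewrite ?l2.
Qed.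

Lemma path_shift c x s : path <%R (x + c) [seq y + c | y <- s] = path <%R x s.
Proof. by elim: s x => //= y s IH x; rewrite IH ltrD2r. Qed.

Lemma last_shift c x s : last (x + c) [seq y + c | y <- s] = last x s + c.
Proof. by elim: s x => /=. Qed.

Lemma vsum_shift d c x s : (forall t t', d (t + c) (t' + c) = d t t') ->
  vsum d (x + c) [seq y + c | y <- s] = vsum d x s.
Proof. by move=> h; elim: s x => //= y s IH x; rewrite IH h. Qed.

(** Insert the translate of [y] into the closed partition, cut there, and move the first part by one
    period. *)
Lemma vsum_rebase d x s y : (forall t, d t t = 0) -> (forall t t' t'', d t t'' <= d t t' + d t' t'') ->
  (forall (n : int) t t', d (t + n%:~R) (t' + n%:~R) = d t t') ->
  path <%R x s -> last x s = x + 1 ->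
  exists s', [/\ path <%R y s', last y s' = y + 1 & vsum d x s <= vsum d y s'].
Proof.
move=> d0 tri per p l; have [n /andP[n1 n2]] := param_shift x y.
have yI : x <= y + n%:~R <= last x s by rewrite n1 l ltW.
have [s1 [s2 [p1 l1 p2 l2 h]]] := vsum_insert d0 tri p yI; rewrite l in l2.
have sh1 := @vsum_shift d 1 x s1 (per 1).
have p3 : path <%R (y + n%:~R) (s2 ++ [seq z + 1 | z <- s1]) by rewrite cat_path p2 l2 path_shift p1.
exists [seq z + (- n)%:~R | z <- s2 ++ [seq z + 1 | z <- s1]].
have ey : y = y + n%:~R + (- n)%:~R by rewrite -addrA -intrD subrr addr0.
rewrite {1 2 4}ey; split; first by rewrite path_shift.
  by rewrite last_shift last_cat l2 last_shift l1 mulrNz; ring.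
by rewrite vsum_shift // vsum_cat l2 sh1 addrC.
Qed.

End Partitions.

(** * Convex regions and the pieces of the boundary *)

Section ConvexRegions.
Context {R : realType}.
Implicit Types (K : set (plane R)) (x y z v p : plane R) (r q e : R).

Lemma convex_setE K : convex_set (K : set (convex_lmodType (plane R))) <->
  forall x y r, K x -> K y -> 0 <= r <= 1 -> K ((1 - r) *: x + r *: y).
Proof.
split.
  move=> cK x y r Kx Ky r01.
  have r01' : 0 <= (1 - r) <= 1 by apply/andP; split; lin.
  rewrite -{2}(subKr 1 r); apply/set_mem.
  exact: (cK x y (Itv01 (andP r01').1 (andP r01').2) (mem_set Kx) (mem_set Ky)).
move=> h x y l /set_mem Kx /set_mem Ky; apply/mem_set.
have := h x y (1 - l%:num) Kx Ky _.
rewrite subKr; apply; apply/andP; split; first by rewrite subr_ge0.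
by rewrite gerBl.
Qed.

Lemma interior_segment K x y r : convex_region K -> closure K x -> interior K y -> 0 < r <= 1 ->
  interior K ((1 - r) *: x + r *: y).
Proof.
move=> [/convex_setE cK _] /closureP_eps cx /interiorP_eps[d d0 hd] /andP[r0 r1].
have rd : 0 < r * d / 2 by rewrite divr_gt0 // mulr_gt0.
have [x' Kx' xx'] := cx _ rd.
apply/interiorP_eps; exists (r * d / 2) => // p hp.
pose y' := r^-1 *: (p - (1 - r) *: x').
have ep : p = (1 - r) *: x' + r *: y'.
  by rewrite /y' scalerA mulfV ?gt_eqF // scale1r subrKC.
rewrite ep; apply: cK => //; last by rewrite ltW.
apply: hd; have -> : y' - y = r^-1 *: ((p - ((1 - r) *: x + r *: y)) + (1 - r) *: (x - x')).
  rewrite /y'; apply: (scalerI (_ : r != 0)); first by rewrite gt_eqF.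
  rewrite scalerBr !scalerA mulfV ?gt_eqF // !scale1r; vec.
rewrite normrZ gtr0_norm ?invr_gt0 // ltr_pdivrMl //.
apply: le_lt_trans (ler_normD _ _) _.
rewrite normrZ (distrC x x') ger0_norm; last lin.
have : (1 - r) * `|x' - x| <= 1 * `|x' - x| by apply: ler_wpM2r => //; lin.
lin.
Qed.

Lemma interior_closure K : convex_region K -> interior (closure K) `<=` interior K.
Proof.
move=> cK x /interiorP_eps[d d0 hd]; have [_ [y Ky]] := cK.
have [->//|ny] := eqVneq x y.
have n0 : 0 < `|x - y| by rewrite normr_gt0 subr_eq0.
pose m := d / (2 * `|x - y|); have m0 : 0 < m by rewrite divr_gt0 // mulr_gt0.
have cx : closure K (x + m *: (x - y)).
  apply: hd; rewrite addrC addKr normrZ gtr0_norm //.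
  have -> : m * `|x - y| = d / 2 by rewrite /m; field; rewrite gt_eqF.
  lin.
have -> : x = (1 - m / (1 + m)) *: (x + m *: (x - y)) + (m / (1 + m)) *: y.
  have e : 1 - m / (1 + m) = (1 + m)^-1 by field; lin.
  rewrite e; apply: (scalerI (_ : 1 + m != 0)); first by rewrite gt_eqF //; lin.
  rewrite scalerDr !scalerA mulfV ?gt_eqF ?addr_gt0 // scale1r mulrCA mulfV ?gt_eqF ?addr_gt0 // mulr1.
  vec.
apply: interior_segment => //; apply/andP; split; first by rewrite divr_gt0 // addr_gt0.
by rewrite ler_pdivrMr ?addr_gt0 // mul1r; lin.
Qed.

Lemma closure_convex K x y r : convex_region K -> closure K x -> closure K y -> 0 <= r <= 1 ->
  closure K ((1 - r) *: x + r *: y).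
Proof.
move=> [/convex_setE cK _] /closureP_eps cx /closureP_eps cy r01; apply/closureP_eps => d d0.
have [x' Kx' hx] := cx d d0; have [y' Ky' hy] := cy d d0.
exists ((1 - r) *: x' + r *: y'); first exact: cK.
have -> : (1 - r) *: x' + r *: y' - ((1 - r) *: x + r *: y) = (1 - r) *: (x' - x) + r *: (y' - y) by vec.
apply: le_lt_trans (ler_normD _ _) _; rewrite !normrZ.
move/andP : r01 => [r0 r1]; rewrite ger0_norm ?subr_ge0 // ger0_norm //.
have [->|rp] := eqVneq r 0; first by lin.
have : r * `|y' - y| < r * d by rewrite ltr_pM2l // lt_def rp.
have : (1 - r) * `|x' - x| <= (1 - r) * d by apply: ler_wpM2l; [lin|exact: ltW].
lin.
Qed.

Lemma boundary_near_interior K x e : convex_region K -> closure K x -> 0 < e ->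
  exists2 y, interior K y & `|y - x| < e.
Proof.
move=> cK cx e0; have [_ [z Kz]] := cK.
pose r := Num.min 1 (e / (2 * (`|z - x| + 1))).
have p0 : 0 < `|z - x| + 1 by rewrite ltr_wpDl.
have r0 : 0 < r by rewrite lt_min ltr01 divr_gt0 // mulr_gt0.
have r1 : r <= 1 by rewrite ge_min lexx.
exists ((1 - r) *: x + r *: z); first by apply: interior_segment => //; rewrite r0.
have -> : (1 - r) *: x + r *: z - x = r *: (z - x) by vec.
rewrite normrZ gtr0_norm //.
have : r * (2 * (`|z - x| + 1)) <= e by rewrite -ler_pdivlMr ?mulr_gt0 // ge_min lexx orbT.
nra.
Qed.

Lemma boundary_near_exterior K x e : convex_region K -> ~ interior K x -> 0 < e ->
  exists2 y, ~ closure K y & `|y - x| < e.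
Proof.
move=> cK nx e0; apply: contrapT => h; apply: nx; apply: interior_closure => //.
by apply/interiorP_eps; exists e => // y yx; apply: contrapT => ny; apply: h; exists y.
Qed.

(* The line of the three points meets the interior of K in a point y, and two of them lie on
   the same side of y. *)
Lemma three_collinear K (D x1 x2 x3 p q : plane R) (l : R) : convex_region K ->
  closure K p -> closure K q -> l < dot D p -> dot D q < l ->
  dot D x1 = l -> dot D x2 = l -> dot D x3 = l ->
  x1 <> x2 -> x2 <> x3 -> x1 <> x3 ->
  boundary K x1 -> boundary K x2 -> boundary K x3 -> False.
Proof.
move=> cK cp cq lp ql e1 e2 e3 n12 n23 n13 [c1 i1] [c2 i2] [c3 i3].
have [y Ky Dy] : exists2 y, interior K y & dot D y = l.
  have [_ [z Kz]] := cK.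
  have cross x : closure K x -> (dot D x < l < dot D z) || (dot D z < l < dot D x) ->
      exists2 y, interior K y & dot D y = l.
    move=> cx h; pose r := (l - dot D x) / (dot D z - dot D x).
    exists ((1 - r) *: x + r *: z).
      apply: interior_segment => //; rewrite /r.
      case/orP: h => /andP[h1 h2].
        by rewrite divr_gt0 ?subr_gt0 // ?ler_pdivrMr ?subr_gt0; lin.
      by rewrite -mulrNN -invrN divr_gt0 ?ler_pdivrMr; lin.
    rewrite dotDr !dotZr /r; field; case/orP: h => /andP[h1 h2]; lin.
  have [zl|zl|zl] := ltgtP (dot D z) l.
  - by apply: (cross p) => //; rewrite zl lp orbT.
  - by apply: (cross q) => //; rewrite zl ql.
  - by exists z.
have D0 : D != 0 by apply: contraTneq lp => D0; move: ql; rewrite D0 !dot0l => ql; rewrite -leNgt ltW.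
have par x : dot D x = l -> exists c, x = y + c *: perp D.
  move=> ex; have P0 : perp D != 0.
    apply: contraNneq D0 => h; apply/eqP.
    have := congr1 (fun v : plane R => v 0 0) h; have := congr1 (fun v : plane R => v 0 1) h.
    by rewrite /perp !mxE /= => h1 h2; apply: plane_eqP; rewrite !mxE; lin.
  have d0 : det (perp D) (x - y) = 0.
    have -> : det (perp D) (x - y) = - dot D (x - y) by rewrite /det /dot /perp !mxE /=; ring.
    by rewrite dotBr ex Dy subrr oppr0.
  by have [c ec] := det_eq0 P0 d0; exists c; rewrite -ec subrKC.
have [k1 {}e1] := par _ e1; have [k2 {}e2] := par _ e2; have [k3 {}e3] := par _ e3.
have nk x c : x = y + c *: perp D -> ~ interior K x -> c != 0.
  by move=> ex nx; apply: contra_notN nx => /eqP c0; rewrite ex c0 scale0r addr0.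
have z1 := nk _ _ e1 i1; have z2 := nk _ _ e2 i2; have z3 := nk _ _ e3 i3.
have sep x x' c c' : x = y + c *: perp D -> x' = y + c' *: perp D -> closure K x' ->
    ~ interior K x -> 0 < c / c' -> c / c' < 1 -> False.
  move=> ex ex' cx' nx h0 h1; apply: nx.
  have c'0 : c' != 0 by apply: contraTneq h0 => ->; rewrite invr0 mulr0 ltxx.
  have -> : x = (1 - (1 - c / c')) *: x' + (1 - c / c') *: y.
    rewrite ex ex' subKr scalerDr scalerA -mulrA mulVf // mulr1; vec.
  by apply: interior_segment => //; apply/andP; split; lin.
have same x x' c c' : x = y + c *: perp D -> x' = y + c' *: perp D -> closure K x -> closure K x' ->
    ~ interior K x -> ~ interior K x' -> x <> x' -> c != 0 -> c' != 0 -> 0 < c * c' -> False.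
  move=> ex ex' cx cx' nx nx' n c0 c'0 cc.
  have d0 : 0 < c / c' by rewrite -(pmulr_lgt0 _ (_ : 0 < c' ^+ 2)) ?exprn_even_gt0 // expr2 mulrA mulfVK.
  have [h|h|h] := ltgtP (c / c') 1.
  - exact: (sep _ _ _ _ ex ex').
  - apply: (sep _ _ _ _ ex' ex) => //.
      by rewrite -invf_div invr_gt0.
    by rewrite -invf_div invf_lt1.
  - by apply: n; rewrite ex ex'; congr (_ + _ *: _); rewrite -(divfK c'0 c) h mul1r.
have [h|h] := ltrP 0 (k1 * k2); first exact: (same _ _ _ _ e1 e2).
have [h'|h'] := ltrP 0 (k1 * k3); first exact: (same _ _ _ _ e1 e3).
apply: (same _ _ _ _ e2 e3) => //.
have : 0 < (k1 * k2) * (k1 * k3).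
  by rewrite -mulrNN mulr_gt0 // oppr_gt0 lt_neqAle ?h ?h' mulf_neq0.
have -> : k1 * k2 * (k1 * k3) = k1 ^+ 2 * (k2 * k3) by ring.
by rewrite pmulr_rgt0 // exprn_even_gt0.
Qed.

End ConvexRegions.

Section PieceGeometry.
Context {R : realType} (N : plane R -> R) (F : set (plane R)) (s : R) (a u : R -> plane R).
Hypothesis T : tube N F s a u.
Hypothesis s0 : 0 < s.
Implicit Types (K : set (plane R)) (x y z v p q : plane R) (t : R).

Let hN := tube_norm T.

Lemma triangle_interior K (c p q : plane R) (al be : R) : convex_region K -> closure K c -> closure K (c + p) ->
  closure K (c + q) -> det p q != 0 -> 0 < al -> 0 < be -> al + be < 1 ->
  interior K (c + (al *: p + be *: q)).
Proof.
move=> cK cc cp cq n al0 be0 ab; apply: interior_closure => //.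
have in_tri al' be' : 0 < al' -> 0 < be' -> al' + be' < 1 -> closure K (c + (al' *: p + be' *: q)).
  move=> a0 b0 ab'; have ab0 : 0 < al' + be' by rewrite addr_gt0.
  have h : closure K ((1 - be' / (al' + be')) *: (c + p) + (be' / (al' + be')) *: (c + q)).
    apply: closure_convex => //; apply/andP; split; first by rewrite divr_ge0 ?ltW.
    by rewrite ler_pdivrMr // mul1r lerDr ltW.
  have := closure_convex (r := al' + be') cK cc h.
  have -> : (1 - (al' + be')) *: c +
     (al' + be') *: ((1 - be' / (al' + be')) *: (c + p) + (be' / (al' + be')) *: (c + q)) =
     c + (al' *: p + be' *: q).
    have e1 : 1 - be' / (al' + be') = al' / (al' + be') by field; rewrite gt_eqF.
    rewrite e1 [in X in _ + X]scalerDr !scalerA !(mulrC (al' + be')) !divfK ?gt_eqF //; vec.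
  by apply; apply/andP; split; lin.
have D0 : 0 < `|det p q| by rewrite normr_gt0.
pose m := Num.min (Num.min al be) ((1 - (al + be)) / 2).
have m0 : 0 < m by rewrite !lt_min al0 be0 /=; lin.
have [m1 m2 m3] : [/\ m <= al, m <= be & m <= (1 - (al + be)) / 2].
  by rewrite /m !ge_min !lexx !orbT.
clearbody m; have mD : 0 < m * `|det p q| by rewrite mulr_gt0.
pose x := al *: p + be *: q.
have [d1 d10 h1] := det_cont hN x q mD.
have [d2 d20 h2] := det_cont hN p x mD.
have d0 : 0 < Num.min d1 d2 by rewrite lt_min d10.
have [d d'0 hd] := std_to_norm hN d0; apply/interiorP_eps; exists d => // y /hd.
rewrite lt_min -/x (_ : y - (c + x) = (y - c) - x); last by vec.
move=> /andP[/h1 k1 /h2 k2].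
have n1 : N (q - q) < d1 by rewrite subrr (norm0 hN).
have n2 : N (p - p) < d2 by rewrite subrr (norm0 hN).
move: (k1 _ n1) (k2 _ n2).
have e1 : det x q = al * det p q by rewrite /x detDl !detZl detxx mulr0 addr0.
have e2 : det p x = be * det p q by rewrite /x detDr !detZr detxx mulr0 add0r.
rewrite e1 e2; have ey : y = c + ((det (y - c) q / det p q) *: p + (det p (y - c) / det p q) *: q).
  by rewrite -det_decomp // subrKC.
have near (r r' : R) : `|r - r' * det p q| < m * `|det p q| -> `|r / det p q - r'| < m.
  by move=> h; rewrite -(ltr_pM2r D0) -normrM mulrBl divfK.
move=> /near; rewrite ltr_distl => /andP[a1 a2] /near; rewrite ltr_distl => /andP[b1 b2].
rewrite ey; apply: in_tri; lin.
Qed.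

(** If the chords turned the wrong way at [t'], the outer normal [u t'] would point into the
    triangle of the three points, hence into the interior of [K]. Close to [a t'] this is the
    interior of [F], while the normal leads out of [F]. *)
Lemma convex_turn K (k al be : R) : convex_region K ->
  (forall t, al <= t <= be -> boundary K (a t)) ->
  (forall t, al < t < be -> exists2 d, 0 < d &
     forall y, N (y - a t) < d -> interior K y -> interior F y) ->
  (k = 1 \/ k = -1) ->
  forall t t' t'', al <= t -> t < t' -> t' < t'' -> t'' <= be ->
    0 < k * det (u t') (a t' - a t) -> 0 < k * det (u t') (a t'' - a t') ->
    0 <= k * det (a t' - a t) (a t'' - a t').
Proof.
move=> cK bK loc hk t t' t'' alt tt' tt'' tbe h1 h2; rewrite leNgt; apply/negP => h.
have kk : k * k = 1 by case: hk => ->; ring.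
set A := a t' - a t in h1 h *; set A' := a t'' - a t' in h2 h *.
have [d d0 hd] : exists2 d, 0 < d & forall y, N (y - a t') < d -> interior K y -> interior F y.
  by apply: loc; rewrite (le_lt_trans alt tt') (lt_le_trans tt'' tbe).
have cl r : al <= r <= be -> closure K (a r) by move=> /bK [].
have n : det (- A) A' != 0.
  by rewrite detNl oppr_eq0; apply: contraTneq h => ->; rewrite mulr0 ltxx.
have eu := det_decomp (u t') n.
set x := det (u t') A' / _ in eu; set y := det (- A) (u t') / _ in eu.
have kx : x * (- (k * det A A')) = k * det (u t') A'.
  rewrite -mulrN -detNl /x mulrCA; congr (k * _); exact: divfK.
have ky : y * (- (k * det A A')) = k * det (u t') A.
  rewrite -mulrN -detNl /y mulrCA divfK // detNl [det A _]detC opprK //.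
have h' : 0 < - (k * det A A') by lin.
have x0 : 0 < x by rewrite -(pmulr_lgt0 _ h') kx.
have y0 : 0 < y by rewrite -(pmulr_lgt0 _ h') ky.
have m0 : 0 < Num.min (Num.min s d) (x + y)^-1.
  by rewrite !lt_min s0 d0 invr_gt0 addr_gt0.
pose r := Num.min (Num.min s d) (x + y)^-1 / 2; have r0 : 0 < r by rewrite /r; lin.
have [rs rd rxy] : [/\ r < s, r < d & r < (x + y)^-1].
  have : [/\ r * 2 <= s, r * 2 <= d & r * 2 <= (x + y)^-1].
    by rewrite /r divfK // !ge_min !lexx !orbT.
  by case; split; lin.
clearbody r; have rI : 0 < r < s by rewrite r0.
have [nF _] := tube_side T t' rI; apply: nF; apply: interior_subset; apply: hd.
  have -> : a t' + r *: u t' - a t' = r *: u t' by vec.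
  by rewrite (normZp hN _ (ltW r0)) (tube_unit T) mulr1.
rewrite eu scalerDr !scalerA; apply: triangle_interior => //.
- by apply: cl; rewrite (le_trans alt (ltW tt')) (le_trans (ltW tt'') tbe).
- rewrite /A opprB subrKC; apply: cl; rewrite alt; apply: le_trans tbe; exact/ltW/(lt_trans tt').
- rewrite /A' subrKC; apply: cl; rewrite tbe andbT; apply: le_trans alt _; exact/ltW/(lt_trans tt').
- exact: mulr_gt0.
- exact: mulr_gt0.
- by rewrite -mulrDr -ltr_pdivlMr ?addr_gt0 // mul1r.
Qed.

Lemma dot_path_cont D t e : 0 < e -> exists2 d, 0 < d &
  forall t', `|t' - t| < d -> `|dot D (a t') - dot D (a t)| < e.
Proof.
move=> /(dot_cont hN D (a t))[d d0 hd]; have [d' d'0 hd'] := tube_cont T d0.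
by exists d' => // t' /hd' /hd.
Qed.

(** A zigzag crosses some level [l], strictly between its two lows and its two highs, at three
    times. This gives three boundary points of [K] on one line that has points of the closure of [K]
    strictly on both sides. *)
Lemma no_zigzag_boundary K (D : plane R) (al be : R) : convex_region K ->
  (forall t, al <= t <= be -> boundary K (a t)) -> be <= al + 1 ->
  no_zigzag [pred t | al <= t <= be] (fun t => dot D (a t)).
Proof.
move=> cK bK ab t1 t2 t3 t4; rewrite !inE => /andP[i1 _] _ _ /andP[_ i4] t12 t23 t34 y21 y23 y41 y43.
pose y t := dot D (a t).
pose l := (Num.max (y t2) (y t4) + Num.min (y t1) (y t3)) / 2.
have [l2 l4 l1 l3] : [/\ y t2 < l, y t4 < l, l < y t1 & l < y t3].
  have [m1 m2] : y t2 <= Num.max (y t2) (y t4) /\ y t4 <= Num.max (y t2) (y t4).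
    by rewrite !le_max !lexx orbT.
  have [m3 m4] : Num.min (y t1) (y t3) <= y t1 /\ Num.min (y t1) (y t3) <= y t3.
    by rewrite !ge_min !lexx orbT.
  have : Num.max (y t2) (y t4) < Num.min (y t1) (y t3).
    by rewrite gt_max !lt_min y21 y23 y41 y43.
  by rewrite /l; split; lin.
have level (p q : R) : p < q -> (y p < l < y q) || (y q < l < y p) -> exists2 r, p < r < q & y r = l.
  move=> pq h; have [||r /andP[pr rq] er] := @IVT_eps R y p q l (ltW pq).
  - by move=> r _ e /(dot_path_cont D r)[d d0 hd]; exists d => // r' _; exact: hd.
  - by case/orP: h => /andP[h1 h2]; [left|right]; rewrite !ltW.
  exists r => //; rewrite !lt_neqAle pr rq !andbT; apply/andP; split.
    by apply: contraTneq h => ->; rewrite er ltxx andbF.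
  by apply: contraTneq h => <-; rewrite er ltxx andbF.
have [|r1 /andP[p1 q1] e1] := level t1 t2 t12; first by rewrite l1 l2 orbT.
have [|r2 /andP[p2 q2] e2] := level t2 t3 t23; first by rewrite l3 l2.
have [|r3 /andP[p3 q3] e3] := level t3 t4 t34; first by rewrite l3 l4 orbT.
have bK' r : t1 < r -> r < t4 -> boundary K (a r).
  by move=> h1 h2; apply: bK; rewrite (le_trans i1 (ltW h1)) (le_trans (ltW h2) i4).
have c1 : closure K (a t1) by apply: (bK t1 _).1; apply/andP; split; lin.
have c4 : closure K (a t4) by apply: (bK t4 _).1; apply/andP; split; lin.
apply: (three_collinear cK c1 c4 l1 l4 e1 e2 e3).
- by apply: (tube_inj T); apply/andP; split; lin.
- by apply: (tube_inj T); apply/andP; split; lin.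
- by apply: (tube_inj T); apply/andP; split; lin.
- by apply: bK'; lin.
- by apply: bK'; lin.
- by apply: bK'; lin.
Qed.

End PieceGeometry.

Section InnerNear.
Context {R : realType} (N : plane R -> R) (hN : is_norm N) (F : set (plane R)).

(** Provides the approach from inside that the inner touching balls require. At an inner point of a
    piece the interior of [K], or for a concave piece the exterior of its closure, reaches
    arbitrarily near; ends of pieces are limits of inner points. *)
Lemma inner_near_pieces (c d : nat) (g : 'I_c + 'I_d -> R -> plane R) : regular_pieces F g ->
  forall x e, boundary F x -> 0 < e -> exists y, [/\ F y, ~ boundary F y & N (y - x) < e].
Proof.
move=> [eJ hc hd _ _] x e Jx e0.
have [e1 e10 he1] := std_to_norm hN e0.
have arc i : is_arc (g i) by case: i => i; [have [] := hc i|have [] := hd i].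
have mid i t : 0 < t < 1 -> forall r : R, 0 < r -> exists2 y, interior F y & `|y - g i t| < r.
  move=> t01 r r0; have tr (h : R -> plane R) : trace h (h t).
    by exists t => //; rewrite /= in_itv /=; case/andP: t01 => t0 t1; rewrite !ltW.
  case: i => i.
    have [_ _ [K [cK bK loc]]] := hc i; have /nbhs_ballP[d' /= d'0 hd'] := loc t t01.
    have [cl _] := bK _ (tr _).
    have m0 : 0 < Num.min r d' by rewrite lt_min r0.
    have [y Ky] := boundary_near_interior cK cl m0; rewrite lt_min => /andP[yr yd].
    by exists y => //; apply/hd'; rewrite // -ball_normE /= distrC.
  have [_ _ [K [cK bK loc]]] := hd i; have /nbhs_ballP[d' /= d'0 hd'] := loc t t01.
  have [_ ni] := bK _ (tr _).
  have m0 : 0 < Num.min r d' by rewrite lt_min r0.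
  have [y Ky] := boundary_near_exterior cK ni m0; rewrite lt_min => /andP[yr yd].
  exists y => //; apply/interiorP_eps.
  have /closedP_eps /(_ y Ky)[m m1 hm] : closed (closure K) by exact: closed_closure.
  have q0 : 0 < Num.min m (d' - `|y - g (inr i) t|) by rewrite lt_min m1 subr_gt0.
  exists (Num.min m (d' - `|y - g (inr i) t|)) => // z; rewrite lt_min => /andP[zm zd].
  have nK : ~ interior K z by move=> /interior_subset /(@subset_closure _ K); exact: hm.
  apply: contrapT => nF; apply: nK; apply/hd' => //; rewrite -ball_normE /= distrC.
  by rewrite (_ : z - _ = (z - y) + (y - g (inr i) t)); [have := ler_normD (z - y) (y - g (inr i) t); lin|vec].
have [y Fy yx] : exists2 y, interior F y & `|y - x| < e1.
  move: Jx; rewrite eJ => -[i _ [t]]; rewrite /= in_itv /= => /andP[t0 t1] <-.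
  have [/withinP_eps ci _] := arc i.
  have h0 : 0 < e1 / 2 by lin.
  have [|d' d'0 hd'] := ci t _ (e1 / 2) h0; first by rewrite /= in_itv /= t0.
  have [t' t'I tt'] : exists2 t', 0 < t' < 1 & `|t' - t| < d'.
    pose h := Num.min d' 1 / 4.
    have [h1 h2 h3] : [/\ 0 < h, h < d' & h < 1 / 2].
      have m0 : 0 < Num.min d' 1 by rewrite lt_min d'0 ltr01.
      have [m1 m2] : Num.min d' 1 <= d' /\ Num.min d' 1 <= 1 by rewrite !ge_min !lexx orbT.
      by rewrite /h; split; lin.
    have [th|th] := lerP t (1 / 2).
      by exists (t + h); [apply/andP; split; lin|rewrite addrAC subrr add0r gtr0_norm].
    exists (t - h); first by apply/andP; split; lin.
    by rewrite addrAC subrr add0r normrN gtr0_norm.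
  have [y Fy hy] := mid i t' t'I (e1 / 2) h0; exists y => //.
  have := hd' t' _ tt'; rewrite /= in_itv /=; case/andP: t'I => p q; rewrite !ltW // => /(_ isT).
  rewrite (_ : y - g i t = (y - g i t') + (g i t' - g i t)); last by vec.
  have := ler_normD (y - g i t') (g i t' - g i t); lin.
exists y; split; [exact: interior_subset Fy|by case|exact: he1].
Qed.

End InnerNear.

(** * Joints and the lower bound *)

Lemma finite_eps {R : realType} (I : finType) (P : I -> R -> Prop) :
  (forall i e e', 0 < e' -> e' <= e -> P i e -> P i e') ->
  (forall i, exists2 e, 0 < e & P i e) -> exists2 e, 0 < e & forall i, P i e.
Proof.
move=> mono h; have [f hf] := choice (fun i => (ltac:(by have [e e0 he] := h i; exists e) : exists e, 0 < e /\ P i e)).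
exists (\big[Num.min/1]_i f i).
  by apply: lt_bigmin => // i _; have [] := hf i.
move=> i; apply: (mono i (f i)); last by have [] := hf i.
  by apply: lt_bigmin => // j _; have [] := hf j.
exact: bigmin_le_cond.
Qed.

Section LowerBound.
Context {R : realType} (N : plane R -> R) (F : set (plane R)) (s : R) (a u : R -> plane R).
Hypothesis T : tube N F s a u.
Variables (nc nd : nat) (g : 'I_nc + 'I_nd -> R -> plane R).
Hypothesis hg : regular_pieces F g.
Implicit Types (t q r x y : R) (G E : seq R) (p v : plane R).

Let hN := tube_norm T.
Local Notation J := (boundary F).

Lemma piece_arc i : is_arc (g i).
Proof. by have [_ hc hd _ _] := hg; case: i => i; [have [] := hc i|have [] := hd i]. Qed.

Lemma piece_cont i r e : 0 <= r <= 1 -> 0 < e -> exists2 d, 0 < d &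
  forall r', 0 <= r' <= 1 -> `|r' - r| < d -> N (g i r' - g i r) < e.
Proof.
move=> rI e0; have [/withinP_eps ci _] := piece_arc i.
have [e' e'0 he] := std_to_norm hN e0.
have [|d d0 hd] := ci r _ e' e'0; first by rewrite /= in_itv.
by exists d => // r' r'I /hd h; apply: he; apply: h; rewrite /= in_itv.
Qed.

Lemma piece_J i r : 0 <= r <= 1 -> J (g i r).
Proof. by move=> rI; have [-> _ _ _ _] := hg; exists i => //; exists r => //; rewrite /= in_itv. Qed.

Lemma piece_closed i p : ~ trace (g i) p -> exists2 m, 0 < m & forall p', N (p' - p) < m -> ~ trace (g i) p'.
Proof.
have cT : compact (trace (g i)).
  by apply: continuous_compact; [have [] := piece_arc i|exact: segment_compact].
move=> np; have /closedP_eps /(_ p np)[d d0 hd] : closed (trace (g i)).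
  by apply: compact_closed cT; exact: norm_hausdorff.
by have [m m0 hm] := norm_to_std hN d0; exists m => // p' /hm /hd.
Qed.

Definition joint t := exists i, endpoints (g i) (a t).
Definition on_piece i t := exists2 r, 0 < r < 1 & g i r = a t.

Lemma on_piece_trace i t : on_piece i t -> trace (g i) (a t).
Proof. by case=> r /andP[r0 r1] <-; exists r => //; rewrite /= in_itv /= !ltW. Qed.

Lemma nonjoint_piece t : ~ joint t -> exists2 i, on_piece i t & forall j, j <> i -> ~ trace (g j) (a t).
Proof.
move=> nj; have [eJ _ _ dj _] := hg; have := tube_J T t; rewrite eJ => -[i _ tr]; exists i.
  have [r] := tr; rewrite /= in_itv /= => /andP[r0 r1] er; exists r => //.
  rewrite !lt_neqAle r0 r1 !andbT; apply/andP; split; apply/eqP => e; apply: nj; exists i.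
    by left; rewrite -er -e.
  by right; rewrite -er e.
by move=> j ji trj; apply: nj; have [] := dj j i ji (a t) (conj trj tr); exists j.
Qed.

Lemma on_piece_nonjoint i t : on_piece i t -> ~ joint t.
Proof.
move=> op; have [r /andP[r0 r1] er] := op; have [_ inj] := piece_arc i.
have I0 : (0 : R) \in `[0, 1] by rewrite in_itv /= lexx ler01.
have I1 : (1 : R) \in `[0, 1] by rewrite in_itv /= lexx ler01.
have Ir : r \in `[0, 1] by rewrite in_itv /= !ltW.
have ni : ~ endpoints (g i) (a t).
  rewrite -er; case=> /= e.
    by have [_ h] := inj _ _ I0 Ir r0 (esym e); rewrite h ltxx in r1.
  by have [h _] := inj _ _ Ir I1 r1 e; rewrite h ltxx in r0.
case=> j ej; have [eij|/eqP ji] := eqVneq j i; first by apply: ni; rewrite -eij.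
have [_ _ _ dj _] := hg; have trj : trace (g j) (a t).
  by case: ej => ->; [exists 0|exists 1].
by have [_ /ni] := dj j i ji (a t) (conj trj (on_piece_trace op)).
Qed.

Lemma on_piece_r i r x : 0 < r < 1 -> a x = g i r -> on_piece i x.
Proof. by exists r. Qed.

(** The inner part of a piece is connected and contains no joint, so it cannot meet both arcs into
    which the joints [t0] and [q] cut the circle. This is what keeps a piece from being charged
    twice. *)
Lemma same_piece i t0 t q t' : joint t0 -> joint q -> t0 < t -> t < q -> q < t' -> t' < t0 + 1 ->
  on_piece i t -> on_piece i t' -> False.
Proof.
move=> j0 jq t0t tq qt' t'1 [r1 r1I e1] [r2 r2I e2].
pose P r := exists2 x, t0 < x < q & a x = g i r.
have loc r : 0 < r < 1 -> exists2 e, 0 < e & forall r', 0 < r' < 1 -> `|r' - r| < e -> P r <-> P r'.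
  move=> rI; have [r0 r1'] := andP rI.
  have [|x0 ex0] := (tube_param T (g i r)).1; first by apply: piece_J; rewrite !ltW.
  have [n /andP[n0 n1]] := param_shift t0 x0; rewrite -(tube_per T x0 n) in ex0.
  set x := x0 + n%:~R in n0 n1 ex0; clearbody x.
  have nj := on_piece_nonjoint (on_piece_r rI ex0).
  have xt0 : t0 < x by rewrite lt_neqAle n0 andbT; apply/eqP => e; apply: nj; rewrite -e.
  have xq : x != q by apply/eqP => e; apply: nj; rewrite e.
  have near rad : 0 < rad -> exists2 e, 0 < e & forall r', 0 < r' < 1 -> `|r' - r| < e ->
      exists2 x', `|x' - x| < rad & a x' = g i r'.
    move=> /(near_param T x)[m m0 hm]; have [|e e0 he] := @piece_cont i r m _ m0.
      by rewrite !ltW.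
    exists e => // r' /andP[r'0 r'1] rr; apply: hm.
      by apply: piece_J; rewrite !ltW.
    by rewrite ex0; apply: he => //; rewrite !ltW.
  have [xq'|qx] := ltrP x q.
    have [|e e0 he] := near (Num.min (x - t0) (q - x)); first by rewrite lt_min !subr_gt0 xt0.
    exists e => // r' r'I /(he _ r'I)[x']; rewrite lt_min => /andP[h1 h2] ex'.
    have Pr : P r by exists x => //; rewrite xt0.
    split=> // _; exists x' => //; move: h1 h2; rewrite !ltr_distl => /andP[h1 _] /andP[_ h2].
    by apply/andP; split; lin.
  have {}qx : q < x by rewrite lt_neqAle eq_sym xq.
  have nP y r' : q < y < t0 + 1 -> a y = g i r' -> ~ P r'.
    move=> /andP[y1 y2] ey [z /andP[z1 z2] ez].
    by apply: (tube_inj T (t := z) (t' := y)); [apply/andP; split; lin|rewrite ey].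
  have [|e e0 he] := near (Num.min (x - q) (t0 + 1 - x)); first by rewrite lt_min !subr_gt0 qx.
  exists e => // r' r'I /(he _ r'I)[x']; rewrite lt_min => /andP[h1 h2] ex'.
  have n1' : ~ P r by apply: nP ex0; rewrite qx.
  have n2' : ~ P r'.
    apply: nP ex'; move: h1 h2; rewrite !ltr_distl => /andP[h1 _] /andP[_ h2].
    by apply/andP; split; lin.
  by split.
have P1 : P r1 by exists t => //; rewrite t0t.
have nP2 : ~ P r2.
  move=> [z /andP[z1 z2] ez].
  by apply: (tube_inj T (t := z) (t' := t')); [apply/andP; split; lin|rewrite ez].
have sub x y r : 0 < x < 1 -> 0 < y < 1 -> x <= r <= y -> 0 < r < 1.
  by move=> /andP[? ?] /andP[? ?] /andP[? ?]; apply/andP; split; lin.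
have [r12|/ltW r21] := lerP r1 r2.
  apply/nP2/(clopen_interval r12 P1) => r rI; have rI' := sub _ _ _ r1I r2I rI.
  by have [e e0 he] := loc r rI'; exists e => // r' r'I; apply: he; apply: sub r'I.
suff : ~ P r1 by [].
apply: (clopen_interval (P := fun r => ~ P r) r21 nP2) => r rI; have rI' := sub _ _ _ r2I r1I rI.
have [e e0 he] := loc r rI'; exists e => // r' r'I rr.
by have [h1 h2] := he r' (sub _ _ _ r2I r1I r'I) rr; split=> h h'; [exact: h (h2 h')|exact: h (h1 h')].
Qed.

(** Near a point that is not a joint only one trace is present, so the index of the piece is locally
    constant on the interval; its ends are limits. *)
Lemma arc_index q q' : q < q' -> (forall t, q < t < q' -> ~ joint t) ->
  exists i, (forall t, q < t < q' -> on_piece i t) /\ (forall t, q <= t <= q' -> trace (g i) (a t)).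
Proof.
move=> qq nj; pose m := (q + q') / 2; have mI : q < m < q' by apply/andP; rewrite /m; split; lin.
have [i oi ni] := nonjoint_piece (nj m mI).
pose P x := trace (g i) (a x).
have loc x : q < x < q' -> exists2 e, 0 < e & forall x', `|x' - x| < e -> P x <-> P x'.
  move=> xI; have [j oj hj] := nonjoint_piece (nj x xI).
  have [e e0 he] : exists2 e, 0 < e & forall k, k <> j -> forall p, N (p - a x) < e -> ~ trace (g k) p.
    apply: (@finite_eps R ('I_nc + 'I_nd)%type (fun k e => k <> j -> forall p, N (p - a x) < e -> ~ trace (g k) p)).
      by move=> k e e' _ ee h kj p pe; apply: h => //; exact: lt_le_trans ee.
    move=> k; have [->|/eqP kj] := eqVneq k j; first by exists 1.
    by have [e e0 he] := piece_closed (hj k kj); exists e => // _.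
  have [d d0 hd] := tube_cont T e0; exists d => // x' /hd xx.
  have [eij|/eqP ij] := eqVneq i j.
    have [eJ _ _ _ _] := hg; have := tube_J T x'; rewrite eJ => -[k _ trk].
    have [ekj|/eqP kj] := eqVneq k j; last by case: (he k kj _ xx).
    by rewrite /P eij; split => _; [rewrite -ekj|exact: on_piece_trace].
  by split=> [/(hj i ij)|/(he i ij _ xx)].
have all t : q < t < q' -> P t.
  move=> tI; have Pm : P m := on_piece_trace oi.
  have sub x y r : q < x < q' -> q < y < q' -> x <= r <= y -> q < r < q'.
    by move=> /andP[? ?] /andP[? ?] /andP[? ?]; apply/andP; split; lin.
  have [mt|/ltW tm] := lerP m t.
    apply: (clopen_interval mt Pm) => r rI; have [e e0 he] := loc r (sub _ _ _ mI tI rI).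
    by exists e => // r' _; exact: he.
  apply: contrapT => nPt; suff : ~ P m by [].
  apply: (clopen_interval (P := fun r => ~ P r) tm nPt) => r rI; have [e e0 he] := loc r (sub _ _ _ tI mI rI).
  by exists e => // r' _ /he [h1 h2]; split=> h h'; [exact: h (h2 h')|exact: h (h1 h')].
exists i; split=> [t tI|t tI].
  have [j oj hj] := nonjoint_piece (nj t tI).
  by have [->//|/eqP /hj h] := eqVneq i j; case: h; exact: all.
apply: contrapT => /piece_closed[e e0 he]; have [d d0 hd] := tube_cont T e0.
have [x xI xt] : exists2 x, q < x < q' & `|x - t| < d.
  have [/andP[t1 t2] h0] : q <= t <= q' /\ 0 < q' - q by rewrite subr_gt0.
  pose h := Num.min d (q' - q) / 4.
  have m0 : 0 < Num.min d (q' - q) by rewrite lt_min d0.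
  have [m1 m2] : Num.min d (q' - q) <= d /\ Num.min d (q' - q) <= q' - q by rewrite !ge_min !lexx !orbT.
  have [tm|mt] := lerP t m.
    rewrite /m in tm; exists (t + h); first by apply/andP; rewrite /h; split; lin.
    by rewrite addrAC subrr add0r /h gtr0_norm; lin.
  rewrite /m in mt; exists (t - h); first by apply/andP; rewrite /h; split; lin.
  by rewrite addrAC subrr add0r normrN /h gtr0_norm; lin.
by apply: (he _ (hd _ _ xt)); exact: all.
Qed.

(** Every piece has endpoints, even one that closes up, so a joint exists and serves as the base
    point of the walk. *)
Lemma joint_list : exists t0 Q, [/\ 0 <= t0 < 1, path <%R t0 Q, last t0 Q = t0 + 1,
  forall q, q \in t0 :: Q -> joint q & forall t, t0 < t < t0 + 1 -> joint t -> t \in Q].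
Proof.
have [i0 _] : exists i : 'I_nc + 'I_nd, True.
  by have := tube_J T 0; have [eJ _ _ _ _] := hg; rewrite eJ => -[i _ _]; exists i.
have time t1 i (b : bool) : exists t, t1 <= t < t1 + 1 /\ a t = g i b%:R.
  have [|x ex] := (tube_param T (g i b%:R)).1; first by apply: piece_J; case: b; rewrite /= ?lexx ler01.
  by have [n nI] := param_shift t1 x; exists (x + n%:~R); rewrite (tube_per T).
have [t0 [t0I e0]] := time 0 i0 false; rewrite add0r in t0I.
have [f hf] := choice (fun ib : ('I_nc + 'I_nd) * bool => time t0 ib.1 ib.2).
have j0 : joint t0 by exists i0; left.
have j1 : joint (t0 + 1) by exists i0; left; rewrite /= (tube_per T t0 1).
pose Q := sort <=%R (undup [seq t <- [seq f ib | ib : ('I_nc + 'I_nd) * bool] | t0 < t]).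
have memQ t : t \in Q = (t0 < t) && (t \in [seq f ib | ib : ('I_nc + 'I_nd) * bool]).
  by rewrite mem_sort mem_undup mem_filter.
have jf ib : joint (f ib).
  have [_ e] := hf ib; exists ib.1; rewrite e; case: (ib.2); [by right|by left].
exists t0, (rcons Q (t0 + 1)); split => //.
- rewrite rcons_path; apply/andP; split.
    rewrite path_min_sorted; last by apply/allP => t; rewrite memQ => /andP[].
    by rewrite lt_sorted_uniq_le sort_uniq undup_uniq sort_le_sorted.
  have := mem_last t0 Q; rewrite inE => /orP[/eqP ->|]; first by lin.
  by rewrite memQ => /andP[_ /mapP[ib _ ->]]; have [/andP[]] := hf ib.
- by rewrite last_rcons.
- move=> q; rewrite inE mem_rcons inE => /or3P[/eqP ->|/eqP ->|] //.
  by rewrite memQ => /andP[_ /mapP[ib _ ->]].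
- move=> t /andP[t1 t2] [i ei]; rewrite mem_rcons inE memQ t1 /=; apply/orP; right.
  have [b eb] : exists b : bool, a t = g i b%:R by case: ei => ->; [exists false|exists true].
  have [/andP[f1 f2] ef] := hf (i, b); rewrite /= -eb in ef.
  suff -> : t = f (i, b) by apply: map_f; rewrite mem_enum.
  have [h|h] := lerP t (f (i, b)); first by apply: (inj_eq T) => //; lin.
  by apply/esym; apply: (inj_eq T) => //; lin.
Qed.

Variable lam : R.
Hypotheses (lam0 : 0 < lam) (lams : 2 * lam < s).
Local Notation w := (outer_curve a u lam).
Local Notation cd := (fun t t' : R => N (a t' - a t)).
Variable P : R.
(** Guarded so that [P = 0] is admissible when no piece is concave, whether or not the perimeter of
    the oval is finite. *)
Hypothesis hP : (0 < nd)%N -> forall Ds : seq (plane R), (forall v, \sum_(D <- Ds) `|dot D v| <= 2 * N v) ->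
  2 * \sum_(D <- Ds) dual_norm hN D <= P.

Definition extra (i : 'I_nc + 'I_nd) : R := if i is inr _ then 2 * lam * P else 0.

Lemma extra_ge0 i : 0 <= extra i.
Proof.
case: i => //= i; have l0 := lam0; apply: mulr_ge0; first lin.
have := hP (leq_ltn_trans (leq0n _) (ltn_ord i)) (Ds := [::]).
by rewrite big_nil mulr0; apply => v; rewrite big_nil mulr_ge0 // (norm_ge0 hN).
Qed.

Lemma tube_curve_side : exists2 d, 0 < d <= 1 & exists k : R, (k = 1 \/ k = -1) /\
  forall t t', 0 < t' - t < d -> 0 < k * det (u t) (a t' - a t) /\ 0 < k * det (u t') (a t' - a t).
Proof.
have l0 := lam0; have ls := lams.
have lI : 0 <= lam < s by apply/andP; split; lin.
apply: (two_sided_side hN (tube_cont T) (tube_ncont T) (tube_unit T) (tube_inj T) lam0) => t t'.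
  have [e _] := tube_dist T t lI; rewrite -{1}e.
  rewrite (_ : a t' - a t - _ = - (a t + lam *: u t - a t')); last by vec.
  by rewrite (normN hN); exact: (dist_le hN _ (tube_J T t')).
have [_ e] := tube_dist T t lI; rewrite -{1}e.
rewrite (_ : a t' - a t + _ = - (a t - lam *: u t - a t')); last by vec.
by rewrite (normN hN); exact: (dist_le hN _ (tube_J T t')).
Qed.

Lemma arc_length t0 G : gchain N a u lam t0 G (t0 + 1) -> forall i q q' E,
  t0 <= q -> q < q' -> q' <= t0 + 1 ->
  (forall t, q < t < q' -> on_piece i t) -> (forall t, q <= t <= q' -> trace (g i) (a t)) ->
  path <%R q E -> last q E = q' ->
  vsum cd q E <= 2 * lam * (1 + (count (fun z => q < z < q') G)%:R) + 2 * lam + extra i.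
Proof.
move=> hG i q q' E tq qq q't on tr pE lE.
have tk := gchain_track T lam0 lams hG (lexx _) tq (ltW qq) q't.
have [_ hc hd _ _] := hg; case: i on tr => i on tr /=.
  have [d /andP[d0 _] [k [hk sd]]] := tube_curve_side.
  have [_ _ [K [cK bK loc]]] := hc i.
  rewrite addr0.
  have sd' t t' : fine_step d t t' -> 0 < k * det (u t) (a t' - a t) /\ 0 < k * det (u t') (a t' - a t).
    by move=> /andP[h1 h2]; apply: sd; rewrite subr_gt0 h1; lin.
  apply: (convex_arc_length hN lam0 (tube_unit T) d0 hk sd' _ tk pE lE) => t t' t'' qt t''q f1 f2.
  have s0 : 0 < s by have := lam0; have := lams; lin.
  apply: (convex_turn T s0 cK (al := q) (be := q')) => //.
  - by move=> r /tr /bK.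
  - move=> r /on [r' r'I er]; have /nbhs_ballP[e /= e0 he] := loc r' r'I.
    have [e' e'0 he'] := norm_to_std hN e0; exists e' => // y /he' ye Ky.
    by apply/he => //; rewrite -ball_normE /= distrC er.
  - by case/andP: f1.
  - by case/andP: f2.
  - by have [] := sd' _ _ f1.
  - by have [] := sd' _ _ f2.
have [_ _ [K [cK bK _]]] := hd i.
have hP' := hP (leq_ltn_trans (leq0n _) (ltn_ord i)).
apply: (concave_arc_length lam0 (tube_unit T) hP' _ tk pE lE) => D.
apply: (no_zigzag_boundary T cK) => [t /tr /bK //|]; lin.
Qed.

(** The list [js] records the pieces met. It is free of duplicates by [same_piece], so its cost is
    at most that of all pieces. Marks inside different arcs are different marks. *)
Lemma pieces_sum t0 G : gchain N a u lam t0 G (t0 + 1) -> joint t0 -> forall Q x, t0 <= x ->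
  path <%R x Q -> last x Q = t0 + 1 -> (forall q, q \in x :: Q -> joint q) ->
  (forall t, x < t < t0 + 1 -> joint t -> t \in Q) ->
  exists js, [/\ uniq js, forall i, i \in js -> exists2 t, x < t < t0 + 1 & on_piece i t &
    forall E, path <%R x E -> last x E = t0 + 1 ->
      vsum cd x E <= \sum_(i <- js) (4 * lam + extra i) + 2 * lam * (count (fun z => x < z < t0 + 1) G)%:R].
Proof.
move=> hG j0; elim=> [|y Q IH] x tx /=.
  move=> _ ex _ _; exists [::]; split => // E pE lE.
  case: E pE lE => [|z E] /= pE lE.
    by rewrite big_nil add0r mulr_ge0 // mulr_ge0 // ltW.
  have /andP[xz p] := pE; have /andP[_] := path_mem_ge p (mem_head _ _); lin.
move=> /andP[xy p] lQ jQ Qj.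
have /andP[_ yt] := path_mem_ge p (mem_head _ _); rewrite lQ in yt.
have gap t : x < t < y -> ~ joint t.
  move=> /andP[xt ty] jt; have tQ : t \in y :: Q by apply: Qj => //; apply/andP; split; lin.
  by have /andP[] := path_mem_ge p tQ; lin.
have [i [on tr]] := arc_index xy gap.
have [|||js [ui his hE]] := IH y _ p lQ.
- by lin.
- by move=> q qQ; apply: jQ; rewrite inE qQ orbT.
- move=> t /andP[yt' tt0] jt; have : t \in y :: Q by apply: Qj => //; apply/andP; split; lin.
  by rewrite inE => /orP[/eqP e|//]; rewrite e ltxx in yt'.
exists (i :: js); split.
- rewrite /= ui andbT; apply/negP => /his [t /andP[yt' tt0] ot].
  pose m := (x + y) / 2; have [h1 h2] : x < m /\ m < y by rewrite /m; split; lin.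
  apply: (@same_piece i t0 m y t) => //; first by apply: jQ; rewrite !inE eqxx orbT.
    by lin.
  by apply: on; rewrite h1.
- move=> k; rewrite inE => /orP[/eqP ->|/his [t /andP[t1 t2] ot]].
    exists ((x + y) / 2); first by apply/andP; split; lin.
    by apply: on; apply/andP; split; lin.
  by exists t => //; apply/andP; split; lin.
move=> E pE lE; have yI : x <= y <= last x E by rewrite lE (ltW xy).
have [E1 [E2 [p1 l1 p2 l2 le]]] := vsum_insert (cd0 hN a) (cd_tri hN a) pE yI.
rewrite lE in l2; have h1 := arc_length hG tx xy yt on tr p1 l1; have h2 := hE E2 p2 l2.
have cnt : (count (fun z => (x < z < y)%R) G + count (fun z => (y < z < t0 + 1)%R) G <=
    count (fun z => (x < z < t0 + 1)%R) G)%N.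
  elim: (G) => //= z G' IH'; have : ((x < z < y)%R + (y < z < t0 + 1)%R <= (x < z < t0 + 1)%R)%N.
    have [h|h] := boolP (x < z < y)%R.
      have /andP[z1 z2] := h; have -> : (y < z < t0 + 1)%R = false by rewrite ltNge (ltW z2).
      by have -> : (x < z < t0 + 1)%R by apply/andP; split; lin.
    have [h'|//] := boolP (y < z < t0 + 1)%R.
    by have -> : (x < z < t0 + 1)%R by case/andP: h' => ? ?; apply/andP; split; lin.
  by move=> h; rewrite addnACA; exact: leq_add h IH'.
rewrite big_cons; move: cnt; rewrite -(ler_nat R) natrD => cnt.
have l0 : 0 < 2 * lam by have := lam0; lin.
have := ler_wpM2l (ltW l0) cnt.
move: h1 h2 le; move: (vsum _ x E) (vsum _ x E1) (vsum _ y E2) (\sum_(j <- js) _) (extra i) => V V1 V2 S X.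
move: (count _ G)%:R (count _ G)%:R (count _ G)%:R => C1 C2 C3; lin.
Qed.

(** The [4 * lam] of each piece consists of [2 * lam] for its additional chord and [2 * lam] for the
    two ends of its track; a concave piece costs [2 * lam * P] more. *)
Lemma lower_bound : exists2 xs, pairwise (fun x y => 2 * lam <= N (w x - w y)) xs &
  forall E, path <%R 0 E -> last 0 E = 1 ->
    vsum cd 0 E <= 2 * lam * (size xs)%:R + 4 * lam * (nc%:R + nd%:R) + nd%:R * (2 * lam * P).
Proof.
have l0 := lam0.
have [t0 [Q [/andP[t00 t01] pQ lQ jQ Qj]]] := joint_list.
have tt1 : t0 <= t0 + 1 by lin.
have [G hG] := gchain_exists T lam0 tt1.
exists (belast t0 G); first exact: (gchain_separated T lam0 lams hG (lexx _)).
have per (n : int) t t' : cd (t + n%:~R) (t' + n%:~R) = cd t t' by rewrite /= !(tube_per T).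
move=> E pE lE; have lE0 : last 0 E = 0 + 1 by rewrite lE add0r.
have [E' [p' l' le]] := vsum_rebase t0 (cd0 hN a) (cd_tri hN a) per pE lE0.
have j0 : joint t0 by apply: jQ; rewrite mem_head.
have [js [ui _ hE]] := pieces_sum hG j0 (lexx _) pQ lQ jQ Qj.
apply: le_trans le _; rewrite size_belast; have h := hE E' p' l'.
apply: le_trans h _; have cnt : (count (fun z => (t0 < z < t0 + 1)%R) G)%:R <= (size G)%:R :> R.
  by rewrite ler_nat count_size.
have l20 : 0 < 2 * lam by lin.
have := ler_wpM2l (ltW l20) cnt.
have : \sum_(i <- js) (4 * lam + extra i) <= \sum_i (4 * lam + extra i).
  rewrite big_uniq //= [leRHS](bigID (mem js)) /= lerDl sumr_ge0 // => i _.
  by have := extra_ge0 i; lin.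
have -> : \sum_i (4 * lam + extra i) = nc%:R * (4 * lam) + nd%:R * (4 * lam + 2 * lam * P).
  by rewrite big_sumType /= !sumr_const !card_ord addr0 !mulr_natl.
move: (\sum_(i <- js) _) (count _ G)%:R (size G)%:R => S C1 C2; lin.
Qed.

End LowerBound.

(** * Turning of the outer curve and the upper bound *)

Section Turning.
Context {R : realType} (N : plane R -> R) (F : set (plane R)) (s : R) (a u : R -> plane R).
Hypothesis T : tube N F s a u.
Variable lam : R.
Hypotheses (lam0 : 0 < lam) (lams : 2 * lam < s).
Implicit Types (t q r x y : R) (E : seq R) (p v D : plane R).

Let hN := tube_norm T.
Local Notation J := (boundary F).
Local Notation dJ := (dist N J).
Local Notation w := (outer_curve a u lam).

(** The outer curve keeps distance [lam] from the boundary, hence at least [lam] from [a t] on one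
    side and, by the Lipschitz property of the distance, from [a t + (2 * lam) *: u t] on the
    other. *)
Lemma outer_curve_side : exists2 d, 0 < d <= 1 & exists k : R, (k = 1 \/ k = -1) /\
  forall t t', 0 < t' - t < d -> 0 < k * det (u t) (w t' - w t) /\ 0 < k * det (u t') (w t' - w t).
Proof.
have l0 := lam0; have ls := lams; have J0 := tube_J0 T.
have cJ := compact_boundary (tube_compact T).
have lI : 0 <= 2 * lam < s by apply/andP; split; lin.
have inj t t' : 0 < t' - t < 1 -> w t <> w t' by apply: (w_inj T).
apply: (two_sided_side hN (w_cont T lam0) (tube_ncont T) (tube_unit T) inj lam0) => t t'.
  have [e _] := tube_dist T t lI; have := dist_lip_abs hN cJ J0 (w t') (a t + (2 * lam) *: u t).
  rewrite e (w_dist T lam0 lams) (_ : w t' - (a t + _) = w t' - w t - lam *: u t); last by rewrite /outer_curve; vec.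
  by rewrite (_ : lam - 2 * lam = - lam) ?normrN ?gtr0_norm //; ring.
rewrite (_ : w t' - w t + lam *: u t = w t' - a t); last by rewrite /outer_curve; vec.
by rewrite -{1}(w_dist T lam0 lams t'); exact: (dist_le hN _ (tube_J T t)).
Qed.

(** Split the chord at [w c]: both parts lie on the same side of the line of [u c]. *)
Lemma chord_pivot d k : (forall t t', 0 < t' - t < d ->
    0 < k * det (u t) (w t' - w t) /\ 0 < k * det (u t') (w t' - w t)) ->
  forall c t t', t <= c -> c <= t' -> t < t' -> t' - t < d -> 0 < k * det (u c) (w t' - w t).
Proof.
move=> sd c t t' tc ct tt td.
have [e1|n1] := eqVneq t c; first by rewrite -e1; apply: (sd t t' _).1; rewrite subr_gt0 tt.
have [e2|n2] := eqVneq c t'; first by rewrite e2; apply: (sd t t' _).2; rewrite subr_gt0 tt.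
have t1 : t < c by rewrite lt_neqAle n1.
have t2 : c < t' by rewrite lt_neqAle n2.
have -> : w t' - w t = (w c - w t) + (w t' - w c) by vec.
rewrite detDr mulrDr addr_gt0 //.
  by apply: (sd t c _).2; apply/andP; split; lin.
by apply: (sd c t' _).1; apply/andP; split; lin.
Qed.

(** If [q] is near [t], all the chords span the time [t1] and are compared with [u t1]. If [q] is
    near [t + 1], the reversed chords span [t + 1]. Otherwise the chord from [w t] to [w q] is long
    and the others differ little from it, so a functional norming it is positive on all. *)
Lemma acute_chords : exists2 d, 0 < d & forall t t1 q q1, t < t1 -> t1 <= q -> q < q1 -> q1 <= t + 1 ->
  t1 - t < d -> q1 - q < d ->
  (q1 < t + 1 -> acute (w q - w t) (w q1 - w t) (w q1 - w t1)) /\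
  (t1 < q -> acute (w q - w t) (w q - w t1) (w q1 - w t1)).
Proof.
have [d /andP[d0 d1] [k [_ sd]]] := outer_curve_side; have pv := chord_pivot sd.
have inj t t' : 0 < t' - t < 1 -> w t <> w t' by apply: (w_inj T).
have d4 : 0 < d / 4 by lin.
have [m m0 hm] := injectivity_modulus hN (w_cont T lam0) (w_per T lam) inj d4.
have m2 : 0 < m / 2 by lin.
have [b b0 hb] := w_cont T lam0 m2.
exists (Num.min b (d / 4)); first by rewrite lt_min b0.
move=> t t1 q q1 tt1 t1q qq1 q1t; rewrite !lt_min => /andP[c1 c2] /andP[c3 c4].
have [near|h1] := ltrP (q - t) (d / 2).
  have [e1 e2 e3 e4] : [/\ q - t < d, q1 - t < d, q1 - t1 < d & q - t1 < d] by split; lin.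
  have l1 := ltW tt1; have l2 := le_trans t1q (ltW qq1); have l3 := lt_le_trans tt1 t1q.
  have l4 := lt_le_trans tt1 l2; have l5 := le_lt_trans t1q qq1.
  by split=> h; exists (k *: perp (u t1)); rewrite !dotZl !dot_perp; split; exact: pv.
have per x : w (x + 1) = w x by exact: (w_per T lam x 1).
have [near|h2] := ltrP (1 - d / 2) (q - t).
  have comp x y : 0 < k * det (u (t + 1)) (w x - w y) -> 0 < dot (- (k *: perp (u (t + 1)))) (w y - w x).
    by rewrite dotNl dotZl dot_perp -mulrN -detNr opprB.
  have tt : t + 1 < t1 + 1 by rewrite ltrD2r.
  have l1 := le_lt_trans q1t tt; have l2 := lt_le_trans qq1 q1t; have l3 := lt_trans l2 tt.
  have [e1 e2 e3 e4] : [/\ t + 1 - q < d, t + 1 - q1 < d, t1 + 1 - q1 < d & t1 + 1 - q < d].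
    by split; lin.
  have [i1 i2 i3] := And3 (ltW tt) (ltW l2) (lexx (t + 1)).
  by split=> h; exists (- (k *: perp (u (t + 1)))); split; apply: comp;
    rewrite -1?(per t) -1?(per t1); exact: pv.
have far : m <= N (w q - w t) by apply: hm; apply/andP; split; lin.
have near1 : N (w t1 - w t) < m / 2 by apply: hb; rewrite ger0_norm; lin.
have near2 : N (w q1 - w q) < m / 2 by apply: hb; rewrite ger0_norm; lin.
have [f [hf ef]] := norming_functional hN (w q - w t).
have f1 := dual_ball_abs hN (w t1 - w t) hf; have f2 := dual_ball_abs hN (w q1 - w q) hf.
rewrite !ler_norml in f1 f2; move: f1 f2 => /andP[f1 f1'] /andP[f2 f2'].
have e2 : w q1 - w t = (w q - w t) + (w q1 - w q) by rewrite [RHS]addrC addrA subrK.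
have e3 : w q1 - w t1 = (w q - w t) + (w q1 - w q) - (w t1 - w t) by rewrite -e2 opprB addrA subrK.
have e4 : w q - w t1 = (w q - w t) - (w t1 - w t) by rewrite opprB addrA subrK.
rewrite e2 e3 e4; move: (w q - w t) (w q1 - w q) (w t1 - w t) ef far near1 near2 f1 f1' f2 f2' => A B C ef far near1 near2 f1 f1' f2 f2'.
have [k1 k2 k3 k4] : [/\ 0 < dot f A, 0 < dot f (A + B), 0 < dot f (A + B - C) & 0 < dot f (A - C)].
  by rewrite !(dotBr, dotDr); split; lin.
by split=> _; exists f.
Qed.

(* Moving from w t by mu in a direction extreme for D raises D by mu times its dual norm, but
   changes the distance to the boundary by at most mu. *)
Lemma extremum_normal D t r : 0 < r -> (forall t', `|t' - t| < r -> dot D (w t') <= dot D (w t)) ->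
  `|dot D (u t)| = dual_norm hN D.
Proof.
move=> r0 mx; have l0 := lam0; have ls := lams; pose J0 := tube_J0 T.
pose cF := tube_compact T; pose cJ := compact_boundary cF.
have le t' : `|dot D (u t')| <= dual_norm hN D.
  by have := dual_norm_abs hN D (u t'); rewrite (tube_unit T) mulr1.
apply/eqP; rewrite eq_le le leNgt; apply/negP => lt.
have e0 : 0 < dual_norm hN D - `|dot D (u t)| by rewrite subr_gt0.
have [b b0 hb] := dot_cont hN D (u t) e0; have [b' b'0 hb'] := tube_ncont T b0.
have rr : 0 < Num.min r b' by rewrite lt_min r0.
have [m m0 hm] := near_param T t rr.
have ws : dJ (w t) < s by rewrite (w_dist T lam0 lams); lin.
have [c c0 hc] := foot_cont hN cJ J0 (tube_unique T) ws m0.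
pose mu := Num.min c lam / 2; have mu1 : 0 < Num.min c lam by rewrite lt_min c0.
have [mu0 muc mul] : [/\ 0 < mu, mu < c & mu < lam].
  have [h1 h2] : Num.min c lam <= c /\ Num.min c lam <= lam by rewrite !ge_min !lexx orbT.
  by rewrite /mu; split; lin.
clearbody mu; have [v v1 Dv] := dual_norm_ex hN D.
pose x := w t + mu *: v.
have xw : N (x - w t) = mu by rewrite /x addrC addKr (normZp hN _ (ltW mu0)) v1 mulr1.
have nFx : ~ F x by apply: (out_ball hN cF (w_out T lam0 lams (t := t))); rewrite xw (w_dist T lam0 lams).
have dx : `|dJ x - lam| <= mu.
  by have := dist_lip_abs hN cJ J0 x (w t); rewrite (w_dist T lam0 lams) xw.
have xs : dJ x < s by move: dx; rewrite ler_distl => /andP[_ h]; lin.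
have fx : N (ft T x - a t) < m.
  by rewrite -(w_ft T lam0 lams t); apply: hc; rewrite xw.
have [t' tt' at'] := hm _ (footJ hN cJ J0 x) fx; move: tt'; rewrite lt_min => /andP[tr tb].
have ex := tube_rep xs (fun h => False_ind _ (nFx h)) (esym at' : ft T x = a t').
have Dx : dot D x = dot D (w t) + mu * dual_norm hN D by rewrite /x dotDr dotZr Dv.
have Dx' : dot D x = dot D (w t') + (dJ x - lam) * dot D (u t').
  by rewrite {1}ex /outer_curve !dotDr !dotZr; ring.
have h1 := mx _ tr.
have h2 : (dJ x - lam) * dot D (u t') <= mu * `|dot D (u t')|.
  by apply: le_trans (ler_norm _) _; rewrite normrM ler_wpM2r.
have h3 : `|dot D (u t')| < dual_norm hN D.
  have := hb _ (hb' _ _ tb); have := ler_normD (dot D (u t') - dot D (u t)) (dot D (u t)).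
  by rewrite subrK; lin.
have := h3; rewrite -(ltr_pM2l mu0); lin.
Qed.

Lemma dual_normN D : dual_norm hN (- D) = dual_norm hN D.
Proof.
have le D' : dual_norm hN (- D') <= dual_norm hN D'.
  have [v v1 <-] := dual_norm_ex hN (- D'); rewrite dotNl -dotNr.
  by have := dual_normP hN D' (- v); rewrite (normN hN) v1 mulr1.
by apply/eqP; rewrite eq_le le -{1}(opprK D) le.
Qed.

Definition extreme_time D t := `|dot D (u t)| = dual_norm hN D.

Lemma extreme_timeN D t : extreme_time (- D) t <-> extreme_time D t.
Proof. by rewrite /extreme_time dotNl normrN dual_normN. Qed.

Lemma dot_w_cont D : {within `[0, 1], continuous (fun t => dot D (w t))} /\
  forall x y, {within `[x, y], continuous (fun t => dot D (w t))}.
Proof.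
suff h (A : set R) : {within A, continuous (fun t => dot D (w t))} by split.
apply/withinP_eps => t _ e /(dot_cont hN D (w t))[d d0 hd].
have [d' d'0 hd'] := w_cont T lam0 d0; exists d' => // t' _ /hd' /hd; exact.
Qed.

(** Otherwise the maximum over the interval would also be attained strictly inside, at an extreme
    time. *)
Lemma no_local_max D t c t' : t < c -> c < t' -> (forall q, t < q < t' -> ~ extreme_time D q) ->
  dot D (w t) <= dot D (w c) -> dot D (w t') <= dot D (w c) -> False.
Proof.
move=> tc ct nz h1 h2; have tt : t <= t' by lin.
have max q : t < q < t' -> (forall r, t <= r <= t' -> dot D (w r) <= dot D (w q)) -> False.
  move=> /[dup] qI /andP[q1 q2] h; apply: (nz q qI).
  apply: (@extremum_normal D q (Num.min (q - t) (t' - q))); first by rewrite lt_min !subr_gt0 q1.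
  move=> r; rewrite lt_min !ltr_distl => /andP[/andP[r1 _] /andP[_ r2]].
  by apply: h; apply/andP; split; lin.
have [m] := EVT_max tt ((dot_w_cont D).2 t t'); rewrite in_itv /= => /andP[m1 m2] hm.
have {}hm r : t <= r <= t' -> dot D (w r) <= dot D (w m) by move=> rI; apply: hm; rewrite in_itv.
have cI : t < c < t' by rewrite tc.
have [e|n1] := eqVneq t m; first by apply: (max c cI) => r /hm; rewrite -e; lin.
have [e|n2] := eqVneq m t'; first by apply: (max c cI) => r /hm; rewrite e; lin.
by apply: (max m) hm; rewrite !lt_neqAle n1 n2 m1.
Qed.

Lemma monotone_at D t c t' : t < c -> c < t' -> (forall q, t < q < t' -> ~ extreme_time D q) ->
  (dot D (w t) < dot D (w c) /\ dot D (w c) < dot D (w t')) \/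
  (dot D (w t) > dot D (w c) /\ dot D (w c) > dot D (w t')).
Proof.
move=> tc ct nz; have h1 := no_local_max tc ct nz.
have nz' q : t < q < t' -> ~ extreme_time (- D) q by move=> /nz h /extreme_timeN.
have := no_local_max tc ct nz'; rewrite !dotNl !lerN2 => h2.
have [k1|k1] := lerP (dot D (w t)) (dot D (w c)).
  have [k2|k2] := lerP (dot D (w t')) (dot D (w c)); first by case: (h1 k1 k2).
  have [k3|k3] := lerP (dot D (w c)) (dot D (w t)); last by left.
  by case: (h2 k3 (ltW k2)).
have [k2|k2] := lerP (dot D (w c)) (dot D (w t')); first by case: (h2 (ltW k1) k2).
by right.
Qed.

(** The lexicographic maximum of [dot D] and [det D] along the outer curve; the second coordinate
    breaks ties exactly as [side] does. *)
Lemma base_time D : D != 0 -> exists t0, forall t, w t <> w t0 -> side D (w t0 - w t).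
Proof.
move=> D0.
have [m mI hm] := EVT_max ler01 (dot_w_cont D).1.
have hm' t : dot D (w t) <= dot D (w m).
  have [n /andP[n1 n2]] := param_shift 0 t; rewrite -(w_per T lam t n).
  by apply: hm; rewrite in_itv /= n1 ltW //; rewrite add0r in n2.
pose S : set R := [set t | t \in `[0, 1] /\ dot D (w t) = dot D (w m)].
have cw (f : plane R -> R) : (forall v e, 0 < e -> exists2 d, 0 < d & forall v', N (v' - v) < d -> `|f v' - f v| < e) ->
    forall t e, 0 < e -> exists2 d, 0 < d & forall t', `|t' - t| < d -> `|f (w t') - f (w t)| < e.
  move=> cf t e /(cf (w t))[d d0 hd]; have [d' d'0 hd'] := w_cont T lam0 d0.
  by exists d' => // t' /hd' /hd.
have cD := cw _ (fun v e => dot_cont hN D v (e := e)).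
have cdet : forall t e, 0 < e -> exists2 d, 0 < d & forall t', `|t' - t| < d -> `|det D (w t') - det D (w t)| < e.
  apply: cw => v e /(det_cont hN D v)[d d0 hd]; exists d => // v' vv; apply: hd vv.
  by rewrite subrr (norm0 hN).
have cS : compact S.
  apply: (subclosed_compact _ (@segment_compact R 0 1)); last by move=> t [].
  apply/closedP_eps => t nS.
  have [tI|/negP tI] := boolP (t \in `[0, 1]); last first.
    have /closedP_eps /(_ t tI)[d d0 hd] : closed `[(0:R), 1]%classic by exact: interval_closed.
    by exists d => // y /hd h [].
  have ne : 0 < `|dot D (w t) - dot D (w m)|.
    by rewrite normr_gt0 subr_eq0; apply/eqP => e; apply: nS.
  have [d d0 hd] := cD t _ ne; exists d => // y /hd h [_ e].
  by move: h; rewrite e distrC ltxx.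
have S0 : S !=set0 by exists m.
have [|c /set_mem [cI Dc] hc] := @compact_EVT_max _ R (fun t => det D (w t)) S S0 cS.
  by apply/withinP_eps => t _ e /(cdet t)[d d0 hd]; exists d => // y _ /hd.
exists c => t nt; rewrite /side !dotBr !detBr subr_gt0 subr_eq0 subr_gt0 Dc.
have := hm' t; rewrite le_eqVlt => /orP[/eqP e|->//]; rewrite e ltxx eqxx /=.
have [n /andP[n1 n2]] := param_shift 0 t.
have le : det D (w t) <= det D (w c).
  rewrite -(w_per T lam t n); apply: hc; apply/mem_set; split; last by rewrite (w_per T lam t n).
  by rewrite in_itv /= n1 ltW //; rewrite add0r in n2.
rewrite lt_neqAle le andbT; apply/eqP => ed; apply: nt.
have [k ek] : exists k, w t - w c = k *: D.
  by apply: det_eq0 => //; rewrite detBr ed subrr.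
have : dot D (w t - w c) = 0 by rewrite dotBr e Dc subrr.
rewrite ek dotZr => /eqP; rewrite mulf_eq0 (gt_eqF (dotvv_gt0 D0)) orbF => /eqP k0.
by apply/eqP; rewrite -subr_eq0 ek k0 scale0r.
Qed.

End Turning.

Section VertexTurn.
Context {R : realType}.
Implicit Types (D e v : plane R) (c k M : R).

Definition signr (b : bool) : R := if b then 1 else - 1.

Lemma side_pmul D v c : 0 < c -> side D (c *: v) = side D v.
Proof. by move=> c0; rewrite /side dotZr detZr !pmulr_rgt0 // mulf_eq0 gt_eqF. Qed.

Lemma signr_dot D e : D != 0 -> e != 0 -> `|dot D e| = signr (side D e) * dot D e.
Proof.
move=> D0 e0; rewrite /signr; case sd : (side D e).
  by rewrite mul1r ger0_norm // side_ge0.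
by rewrite mulN1r ler0_norm // (side_le0 D0 e0) ?sd.
Qed.

Lemma det_neq0 v e k : 0 < k * det v e -> e != 0.
Proof. by apply: contraTneq => ->; rewrite /det !mxE !mulr0 subrr mulr0 ltxx. Qed.

(* Up to the orientation k, the half turn is the sign of D on the normal v. *)
Lemma vertex_turn D k e e' v M : D != 0 -> (k = 1 \/ k = -1) -> 0 < k * det v e -> 0 < k * det v e' ->
  (side D e <> side D e' -> `|dot D v| = M) ->
  dot D v * (signr (side D e) - signr (side D e')) = 2 * k * M * half_turn D e e'.
Proof.
move=> D0 hk ve ve' hM; have e0 := det_neq0 ve; have e'0 := det_neq0 ve'.
have kk : k * k = 1 by case: hk => ->; ring.
rewrite /half_turn; case: eqP => [->|/[dup] ne /hM {}hM]; first by rewrite subrr !mulr0.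
have key : k * dot D v * det e e' = (k * det v e') * dot D e - (k * det v e) * dot D e'.
  by rewrite /det /dot; ring.
have dn : det e e' != 0.
  apply/eqP => /(det_eq0 e0)[c ec]; apply: ne; rewrite ec side_pmul //.
  by move: ve'; rewrite ec detZr mulrCA pmulr_lgt0.
have kv : `|k * dot D v| = M by rewrite normrM hM; case: hk => ->; rewrite ?normrN normr1 mul1r.
have ev : dot D v = k * (k * dot D v) by rewrite mulrA kk mul1r.
rewrite ev; set x := k * dot D v in key kv *; clearbody x.
have [h|h] : (side D e /\ ~~ side D e') \/ (~~ side D e /\ side D e').
  by move: ne; case: (side D e); case: (side D e') => h; [case: h|left|right|case: h].
  have [h1 h2] := h; rewrite h1 (negbTE h2) /signr.
  have s1 := side_ge0 h1; have s2 := side_le0 D0 e'0 h2.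
  have x0 : 0 <= x * det e e'.
    rewrite key; have := mulr_ge0 (ltW ve') s1.
    by have := mulr_ge0 (ltW ve) (_ : 0 <= - dot D e'); rewrite oppr_ge0 mulrN => /(_ s2); lin.
  case: ltrP => hd; first by rewrite pmulr_lge0 // in x0; rewrite -kv ger0_norm //; ring.
  have {}hd : det e e' < 0 by rewrite lt_neqAle dn.
  rewrite nmulr_lge0 // in x0; rewrite -kv ler0_norm //; ring.
have [h1 h2] := h; rewrite h2 (negbTE h1) /signr.
have s2 := side_ge0 h2; have s1 := side_le0 D0 e0 h1.
have x0 : x * det e e' <= 0.
  rewrite key; have := mulr_ge0 (ltW ve) s2.
  by have := mulr_ge0 (ltW ve') (_ : 0 <= - dot D e); rewrite oppr_ge0 mulrN => /(_ s1); lin.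
case: ltrP => hd; first by rewrite pmulr_lle0 // in x0; rewrite -kv ler0_norm //; ring.
have {}hd : det e e' < 0 by rewrite lt_neqAle dn.
rewrite nmulr_lle0 // in x0; rewrite -kv ger0_norm //; ring.
Qed.

Lemma cyclic_abel (s x : nat -> R) n :
  \sum_(0 <= j < n.+1) s j * (x j.+1 - x j) =
  \sum_(0 <= j < n) x j.+1 * (s j - s j.+1) + (x n.+1 * s n - x 0 * s 0).
Proof.
elim: n => [|n IH]; first by rewrite big_nat1 big_geq //; ring.
rewrite big_nat_recr //= IH [in RHS]big_nat_recr //=; ring.
Qed.

End VertexTurn.

Section UpperBound.
Context {R : realType} (N : plane R -> R) (F : set (plane R)) (s : R) (a u : R -> plane R).
Hypothesis T : tube N F s a u.
Variable lam : R.
Hypotheses (lam0 : 0 < lam) (lams : 2 * lam < s).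
Implicit Types (t q r x y b : R) (E C : seq R) (p v D : plane R).

Let hN := tube_norm T.
Local Notation w := (outer_curve a u lam).
Local Notation extreme := (extreme_time T).
Local Notation chord D g := (fun t t' : R => `|dot D (g t') - dot D (g t)|).

(** At a vertex of such a partition that is not an extreme time, no extreme time lies inside the two
    adjacent steps, so [D] is strictly monotone across the vertex and the side does not change
    there. *)
Definition good_step D de b b' := (b < b') && (b' < b + de) &&
  `[< (extreme D b /\ extreme D b') \/ forall q, b < q < b' -> ~ extreme D q >].

(** It suffices to insert the first and the last extreme time of the interval. *)
Lemma good_subdivision D de x y : x <= y -> y < x + de ->
  exists E, path (good_step D de) x E /\ last x E = y.
Proof.
move=> xy yx.
have one b b' : x <= b -> b <= b' -> b' <= y ->
    (extreme D b /\ extreme D b') \/ (forall q, b < q < b' -> ~ extreme D q) ->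
    exists E, path (good_step D de) b E /\ last b E = b'.
  move=> xb bb by' h; move: bb; rewrite le_eqVlt => /orP[/eqP <-|bb]; first by exists [::].
  by exists [:: b']; split => //=; rewrite andbT /good_step bb (asboolT h) andbT /=; lin.
pose S : set R := [set t | t \in `[x, y] /\ extreme D t].
have [S0|/set0P S0] := eqVneq S set0.
  apply: (one x y) => //; right => q /andP[q1 q2] eq.
  have : S q by split => //; rewrite in_itv /= !ltW.
  by rewrite S0.
have cS : compact S.
  apply: (subclosed_compact _ (@segment_compact R x y)); last by move=> t [].
  apply/closedP_eps => t nS.
  have [tI|/negP tI] := boolP (t \in `[x, y]); last first.
    have /closedP_eps /(_ t tI)[d d0 hd] : closed `[x, y]%classic by exact: interval_closed.
    by exists d => // z /hd h [].
  have ne : 0 < `| `|dot D (u t)| - dual_norm hN D|.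
    by rewrite normr_gt0 subr_eq0; apply/eqP => e; apply: nS.
  have [d d0 hd] := dot_cont hN D (u t) ne; have [d' d'0 hd'] := tube_ncont T d0.
  exists d' => // z /hd' /hd h [_ e]; rewrite /extreme_time -/hN in e.
  move: h; rewrite -e distrC => h; have := ler_dist_dist (dot D (u t)) (dot D (u z)); lin.
have cid_ (f : R -> R) : (forall x y, `|f x - f y| <= `|x - y|) -> {within S, continuous f}.
  by move=> h; apply/withinP_eps => t _ e e0; exists e => // z _; apply: le_lt_trans.
have [p /set_mem [pI ep] pm] := compact_EVT_min S0 cS (cid_ id (fun x y => lexx _)).
have [q /set_mem [qI eq] qm] := compact_EVT_max S0 cS (cid_ id (fun x y => lexx _)).
have pq : p <= q by apply: pm; apply/mem_set.
move: pI qI; rewrite !in_itv /= => /andP[xp py] /andP[xq qy].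
have [|E1 [p1 l1]] := one x p (lexx _) xp py.
  right => r /andP[r1 r2] er; have : p <= r.
    by apply: pm; apply/mem_set; split => //; rewrite in_itv /=; apply/andP; split; lin.
  lin.
have [|E2 [p2 l2]] := one p q xp pq qy; first by left.
have [|E3 [p3 l3]] := one q y xq qy (lexx _).
  right => r /andP[r1 r2] er; have : r <= q.
    by apply: qm; apply/mem_set; split => //; rewrite in_itv /=; apply/andP; split; lin.
  lin.
exists (E1 ++ E2 ++ E3); split; first by rewrite !cat_path p1 l1 p2 l2.
by rewrite !last_cat l1 l2.
Qed.

Lemma good_lt D de x E : path (good_step D de) x E -> path <%R x E.
Proof. by apply: sub_path => t t' /andP[/andP[]]. Qed.

Lemma good_refine D de (d : R -> R -> R) x E : 0 < de -> (forall t, d t t = 0) ->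
  (forall t t' t'', d t t'' <= d t t' + d t' t'') -> path <%R x E ->
  exists E', [/\ path (good_step D de) x E', last x E' = last x E & vsum d x E <= vsum d x E'].
Proof.
move=> de0 d0 tri p; have [E1 [p1 <- v1]] := fine_refine de0 d0 tri p.
suff [E' [p' l' v']] : exists E', [/\ path (good_step D de) x E', last x E' = last x E1 &
    vsum d x E1 <= vsum d x E'].
  by exists E'; split => //; exact: le_trans v'.
elim: E1 x {p v1} p1 => [|y E1 IH] x /=; first by exists [::].
move=> /andP[/andP[xy yx] /IH [E2 [p2 l2 v2]]].
have [E3 [p3 l3]] := good_subdivision D (ltW xy) yx.
exists (E3 ++ E2); split; first by rewrite cat_path p3 l3.
  by rewrite last_cat l3.
by rewrite vsum_cat l3; apply: lerD v2; rewrite -{1}l3; exact: vsum_tri.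
Qed.

(* Summation by parts of the signed increments of D along w = a + lam u leaves the values of D
   on the normals at the vertices where the sign changes; by vertex_turn these are half turns. *)
Lemma good_sum D : D != 0 -> exists2 de, 0 < de & forall t0 E,
  (forall t, w t <> w t0 -> side D (w t0 - w t)) -> path (good_step D de) t0 E -> last t0 E = t0 + 1 ->
  vsum (chord D w) t0 E <= vsum (chord D a) t0 E + 4 * lam * dual_norm hN D.
Proof.
move=> D0; have [d1 /andP[d10 _] [k [hk sd]]] := outer_curve_side T lam0 lams.
have [d2 d20 hd2] := acute_chords T lam0 lams.
(* The bound [1 / 4] forces the at least three edges that Hopf's argument requires. *)
exists (Num.min (Num.min d1 d2) (1 / 4)); first by rewrite !lt_min d10 d20 /=; lin.
set de := Num.min _ _; have [de1 de2 de4] : [/\ de <= d1, de <= d2 & de <= 1 / 4].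
  by rewrite /de !ge_min !lexx !orbT.
clearbody de; move=> t0 E base pE lE.
pose m := size E; pose tau j := nth 0 (t0 :: E) j.
have hg j : (j < m)%N -> good_step D de (tau j) (tau j.+1) by move=> jm; apply: (pathP 0 pE).
have step j : (j < m)%N -> 0 < tau j.+1 - tau j < de.
  by move=> /hg /andP[/andP[h1 h2] _]; rewrite subr_gt0 h1 ltrBlDl.
have inc i j : (i < j)%N -> (j <= m)%N -> tau i < tau j.
  move=> ij jm; have srt : sorted <%R (t0 :: E) := good_lt pE.
  by apply: (sorted_ltn_nth lt_trans 0 srt) => //; rewrite inE /= ltnS // ltnW // (leq_trans ij).
have tm : tau m = t0 + 1 by rewrite /tau -lE -[m]/((size (t0 :: E)).-1) nth_last.
have m3 : (3 <= m)%N.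
  rewrite ltnNge; apply/negP => m2; move: tm step; case: (m) m2 => [|[|[|//]]] _; rewrite -/(tau _) => tm st.
  - by move: tm; rewrite /tau /=; lin.
  - by have := st 0 isT; rewrite tm /tau /= => /andP[_ h]; lin.
  - have := st 0 isT; have := st 1 isT; rewrite tm; move: (tau 1) => z; rewrite /tau /=.
    by move=> /andP[_ h1] /andP[_ h2]; lin.
pose v j := w (tau j); pose e i j := v j - v i.
have vm : v m = v 0 by rewrite /v tm (w_per T lam t0 1).
have rng i : (i <= m)%N -> t0 <= tau i <= t0 + 1.
  move=> im; apply/andP; split.
    by case: (i) im => [|i'] im; [exact: lexx|exact/ltW/(inc 0)].
  by move: im; rewrite leq_eqVlt -tm => /orP[/eqP -> //|/inc /(_ (leqnn _))]; exact: ltW.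
have wrap i j : (i < j)%N -> (j <= m)%N -> (0 < i)%N \/ (j < m)%N -> tau j < tau i + 1.
  move=> ij jm hij; have /andP[_ h1] := rng j jm; have /andP[h2 _] := rng i (ltnW (leq_trans ij jm)).
  case: hij => h.
    have := inc 0 i h (ltnW (leq_trans ij jm)); rewrite {1}/tau /=; lin.
  have := inc j m h (leqnn _); rewrite tm; lin.
have inj i j : (i < j)%N -> (j <= m)%N -> (0 < i)%N \/ (j < m)%N -> v j <> v i.
  move=> ij jm /(wrap _ _ ij jm) lt; have lt2 := inc i j ij jm.
  have h : 0 < tau j - tau i < 1 by apply/andP; split; lin.
  by move=> /esym; exact: (w_inj T lam0 lams h).
have stp j : (j < m)%N -> tau j.+1 - tau j < d2.
  by move=> /step /andP[_ h]; exact: lt_le_trans h _.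
have T1 i j : (i < j)%N -> (j < m)%N -> (0 < i)%N \/ (j.+1 < m)%N -> acute (e i j) (e i j.+1) (e i.+1 j.+1).
  move=> ij jm hij; have im := ltn_trans ij jm; have lt := wrap i j.+1 (ltnW ij : (i < j.+1)%N) jm hij.
  apply: (hd2 (tau i) (tau i.+1) (tau j) (tau j.+1) _ _ _ _ (stp _ im) (stp _ jm)).1 => //.
  - exact: inc.
  - by move: ij; rewrite leq_eqVlt => /orP[/eqP -> //|/inc h]; apply/ltW/h/ltnW.
  - exact: inc.
  - exact: ltW.
have T2 i j : (i.+1 < j)%N -> (j < m)%N -> acute (e i j) (e i.+1 j) (e i.+1 j.+1).
  move=> ij jm; have im := ltn_trans (ltnW ij) jm.
  apply: (hd2 (tau i) (tau i.+1) (tau j) (tau j.+1) _ _ _ _ (stp _ im) (stp _ jm)).2.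
  - exact: inc.
  - exact/ltW/inc/ltnW.
  - exact: inc.
  - by have /andP[_ h1] := rng _ jm; have /andP[h2 _] := rng _ (ltnW im); lin.
  - exact/inc/ltnW.
have em : m = m.-1.+1 by rewrite prednK // (ltn_trans _ m3).
have bs j : (0 < j < m)%N -> side D (v 0%N - v j).
  by move=> /andP[j0 jm]; apply: base; exact: (inj 0%N j j0 (ltnW jm) (or_intror jm)).
have hopf := hopf_turning D0 m3 vm T1 T2 bs.
set M := dual_norm hN D.
(* The closing vertex is maximal for [D] on the whole outer curve, so the half turn there can be
   evaluated as well. *)
have ex0 : extreme D t0.
  apply: (extremum_normal T lam0 lams (r := 1)) => // t' _.
  have [->//|ne] := eqVneq (w t') (w t0).
  by have := side_ge0 (base t' (elimN eqP ne)); rewrite dotBr subr_ge0.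
pose x j := dot D (u (tau j)); pose sg j := signr (side D (e j j.+1)) : R.
have enz j : (j < m)%N -> e j j.+1 != 0.
  move=> jm; rewrite subr_eq0; apply/eqP; apply: inj => //.
  by case: (j) jm => [|j'] jm; [right; exact: ltn_trans m3|left].
(* On an edge of [w] the absolute value of [D] is its sign times the sum of the parts along [a] and
   along [lam *: u]; only the first part is estimated, the second is kept for summation by parts. *)
have term j : (0 <= j < m)%N -> `|dot D (w (tau j.+1)) - dot D (w (tau j))| <=
    `|dot D (a (tau j.+1)) - dot D (a (tau j))| + lam * (sg j * (x j.+1 - x j)).
  move=> /andP[_ jm]; rewrite -dotBr (signr_dot D0 (enz j jm)) -/(sg j).
  have -> : dot D (w (tau j.+1) - w (tau j)) =
      (dot D (a (tau j.+1)) - dot D (a (tau j))) + lam * (x j.+1 - x j).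
    by rewrite /x /outer_curve dotBr !dotDr !dotZr; ring.
  rewrite mulrDr mulrCA lerD2r; apply: le_trans (ler_norm _) _.
  by rewrite normrM /sg /signr; case: ifP => _; rewrite ?normrN normr1 mul1r.
have piv j : (j < m)%N -> 0 < k * det (u (tau j)) (e j j.+1) /\ 0 < k * det (u (tau j.+1)) (e j j.+1).
  by move=> /step /andP[h1 h2]; apply: sd; rewrite h1 (lt_le_trans h2 de1).
have turn j : (0 <= j < m.-1)%N ->
    x j.+1 * (sg j - sg j.+1) = 2 * k * M * half_turn D (e j j.+1) (e j.+1 j.+2).
  move=> /andP[_ jm1]; have jm : (j.+1 < m)%N by rewrite em.
  have [_ p1] := piv j (ltnW jm); have [p2 _] := piv j.+1 jm.
  apply: vertex_turn => // sne; apply: contrapT => nex; apply: sne.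
  have clear i b : (i < m)%N -> (b = tau i \/ b = tau i.+1) -> ~ extreme D b ->
      forall q, tau i < q < tau i.+1 -> ~ extreme D q.
    by move=> im hb nb; have /andP[_ /asboolP[[z1 z2]|//]] := hg i im; case: hb nb => ->.
  have n1 := clear j _ (ltnW jm) (or_intror erefl) nex; have n2 := clear j.+1 _ jm (or_introl erefl) nex.
  have lt1 := inc j j.+1 (leqnn _) (ltnW jm); have lt2 := inc j.+1 j.+2 (leqnn _) jm.
  have nz q : tau j < q < tau j.+2 -> ~ extreme D q.
    move=> /andP[q1 q2]; case: (ltrgtP q (tau j.+1)) => h.
    - by apply: n1; rewrite q1.
    - by apply: n2; rewrite h.
    - by rewrite h.
  rewrite /side /e !dotBr; case: (monotone_at lam0 lams lt1 lt2 nz) => -[h1 h2].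
    by rewrite !subr_gt0 h1 h2.
  by rewrite !subr_gt0 !subr_eq0 !(lt_eqF h1) !(lt_eqF h2) !ltNge (ltW h1) (ltW h2).
rewrite !(vsum_nth 0) -/m -/tau.
apply: le_trans (ler_sum_nat term) _; rewrite big_split /= lerD2l -mulr_sumr.
rewrite {1}em cyclic_abel (eq_big_nat _ _ turn) -em -mulr_sumr.
have -> : x m = x 0%N by rewrite /x tm (tube_nper T t0 1).
rewrite -mulrBr.
have em2 : m.-1.+1 = m by rewrite -em.
have -> : x 0%N * (sg m.-1 - sg 0%N) = 2 * k * M * half_turn D (e m.-1 m) (e 0 1).
  have m1 : (m.-1 < m)%N by rewrite {2}em.
  rewrite /sg em2; have [_ p1] := piv m.-1 m1.
  have [p2 _] := piv 0%N (ltn_trans (isT : (0 < 2)%N) m3).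
  apply: vertex_turn => //.
  by move: p1; rewrite em2 tm (tube_nper T t0 1).
rewrite -mulrDr; set H := _ + _ in hopf *; clearbody H.
have M0 : 0 <= M := dual_norm_ge0 hN D.
(* At most two half turns, each worth [2 * lam] times the dual norm of [D]: this is the [4 * lam] of
   the statement. *)
have kH : k * H <= 2.
  by move: hopf; rewrite ler_norml => /andP[h1 h2]; case: hk => ->; lin.
have -> : lam * (2 * k * M * H) = (2 * lam * M) * (k * H) by ring.
have -> : 4 * lam * M = (2 * lam * M) * 2 by ring.
by apply: ler_wpM2l => //; rewrite !mulr_ge0 // ltW.
Qed.

Lemma chord_dot0 (D : plane R) (g : R -> plane R) t : `|dot D (g t) - dot D (g t)| = 0.
Proof. by rewrite subrr normr0. Qed.

Lemma chord_dot_tri (D : plane R) (g : R -> plane R) t t' t'' :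
  `|dot D (g t'') - dot D (g t)| <= `|dot D (g t') - dot D (g t)| + `|dot D (g t'') - dot D (g t')|.
Proof. by rewrite [leRHS]addrC; exact: ler_distD. Qed.

(** The estimate is made on a partition based at the extreme vertex for [D] and then carried to the
    base point 0, common to all functionals. *)
Lemma variation_claim D y C : path <%R y C -> last y C = y + 1 -> exists E,
  [/\ path <%R 0 E, last 0 E = 1 & vsum (chord D w) y C - 4 * lam * dual_norm hN D <= vsum (chord D a) 0 E].
Proof.
move=> pC lC; have [->|D0] := eqVneq D 0.
  exists [:: 1]; split => //=; first by rewrite ltr01.
  have -> : vsum (chord 0 w) y C = 0.
    rewrite (_ : chord 0 w = fun _ _ => 0); last first.
      by apply/funext => t; apply/funext => t'; rewrite !dot0l subrr normr0.
    by elim: (C) (y) => //= z r IH z'; rewrite IH addr0.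
  rewrite sub0r addr0; apply: le_trans (normr_ge0 _); rewrite oppr_le0.
  by rewrite !mulr_ge0 ?dual_norm_ge0 // ltW.
have [t0 base] := base_time T lam0 D0.
have [de de0 hde] := good_sum D0.
have per (g : R -> plane R) : periodic g -> forall (n : int) t t', chord D g (t + n%:~R) (t' + n%:~R) = chord D g t t'.
  by move=> pg n t t'; rewrite !pg.
have [C1 [p1 l1 v1]] := vsum_rebase t0 (chord_dot0 D w) (chord_dot_tri D w) (per _ (w_per T lam)) pC lC.
have [C2 [p2 l2 v2]] := good_refine D de0 (chord_dot0 D w) (chord_dot_tri D w) p1.
have h := hde t0 C2 base p2; rewrite l2 l1 in h; have {}h := h erefl.
have l3 : last t0 C2 = t0 + 1 by rewrite l2.
have [E [pE lE v3]] := vsum_rebase 0 (chord_dot0 D a) (chord_dot_tri D a) (per _ (tube_per T)) (good_lt p2) l3.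
exists E; split => //; first by rewrite lE add0r.
lin.
Qed.

Variables (P L : R).
Hypothesis hP : forall Ds : seq (plane R), (forall v, \sum_(D <- Ds) `|dot D v| <= 2 * N v) ->
  2 * \sum_(D <- Ds) dual_norm hN D <= P.
Hypothesis hL : forall E, path <%R 0 E -> last 0 E = 1 -> vsum (fun t t' => N (a t' - a t)) 0 E <= L.

(** Each functional of a zonotope norm exact on a unit vector has dual norm at least its value
    there. The bound settles packings of at most one ball. *)
Lemma perimeter_ge4 : 4 <= P.
Proof.
have [v v1] := exists_unit hN.
have [Ds [Dle Dge]] := chord_zonotope hN (fun t => t *: v) 0 [:: 1].
apply: le_trans (hP Dle); move: Dge; rewrite /= !scale1r !scale0r subr0 v1 !addr0 => h.
have : \sum_(D <- Ds) `|dot D v - dot D 0| <= \sum_(D <- Ds) dual_norm hN D.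
  by apply: ler_sum => D _; rewrite dot0r subr0; have := dual_norm_abs hN D v; rewrite v1 mulr1.
lin.
Qed.

(** The closed polygon through the centers has edges of length at least [2 * lam]. In a zonotope
    norm exact on them, each [D] varies along it by at most [4 * lam] times its dual norm more than
    along [a]; the excesses sum to at most [2 * lam * P], and the zonotope sum is twice the norm. *)
Lemma upper_bound (xs : seq R) : uniq xs -> (forall x, x \in xs -> 0 <= x < 1) ->
  (forall x y, x \in xs -> y \in xs -> x != y -> 2 * lam <= N (w x - w y)) ->
  2 * lam * (size xs)%:R <= L + lam * P.
Proof.
move=> uxs rng sep; have l0 := lam0; have P4 := perimeter_ge4.
have lP : 4 * lam <= lam * P by rewrite mulrC ler_pM2l.
have L0 : 0 <= L.
  have p1 : path <%R 0 [:: 1 : R] by rewrite /= ltr01.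
  by apply: le_trans (hL p1 erefl); rewrite /= addr0 (norm_ge0 hN).
have : sorted <%R (sort <=%R xs) by rewrite lt_sorted_uniq_le sort_uniq uxs sort_le_sorted.
have := mem_sort <=%R xs; rewrite -(size_sort <=%R).
case: (sort _ _) => [|y r] memr srt; first by rewrite mulr0; lin.
case: r memr srt => [|z r] memr srt; first by rewrite /=; lin.
set r' := z :: r in memr srt *.
have ylast : y < last y r'.
  have /andP[h pr] := srt; apply: (lt_le_trans h).
  by have /andP[] := path_mem_ge pr (mem_head _ _).
clearbody r'; pose C := rcons r' (y + 1).
have lasty : last y r' < y + 1.
  have := rng y; rewrite -memr mem_head => /(_ isT) /andP[y0 _].
  have := rng (last y r'); rewrite -memr mem_last => /(_ isT) /andP[_ h]; lin.
have pC : path <%R y C by rewrite rcons_path lasty andbT.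
have lC : last y C = y + 1 by rewrite last_rcons.
have [Ds [Dle hV]] := chord_zonotope hN w y C.
have sumN : 2 * lam * (size (y :: r'))%:R <= vsum (fun t t' => N (w t' - w t)) y C.
  have -> : size (y :: r') = (size r').+1 by [].
  rewrite /C -cats1 vsum_cat -(natr1 (size r')) mulrDr mulr1 /= addr0; apply: lerD.
    have -> : 2 * lam * (size r')%:R = vsum (fun _ _ => 2 * lam) y r'.
      elim: (r') (y) => [|z' r2 IH] y'; first by rewrite mulr0.
      by rewrite /= -IH -(natr1 (size r2)); ring.
    apply: vsum_le srt => t t' tt m m'; apply: sep; rewrite -?memr //.
    by rewrite gt_eqF.
  rewrite (w_per T lam y 1); apply: sep; rewrite -?memr ?mem_head //.
    exact: mem_last.
  by rewrite lt_eqF.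
have [E [pE lE hE]] : exists E, [/\ path <%R 0 E, last 0 E = 1 & forall D, D \in Ds ->
    vsum (chord D w) y C - 4 * lam * dual_norm hN D <= vsum (chord D a) 0 E].
  apply: (common_refinement (d := fun D => chord D a)) => //.
  - by move=> D t; exact: chord_dot0.
  - by move=> D t t' t''; exact: chord_dot_tri.
  - by move=> D _; exact: variation_claim.
have h1 : \sum_(D <- Ds) (vsum (chord D w) y C - 4 * lam * dual_norm hN D) <=
    \sum_(D <- Ds) vsum (chord D a) 0 E.
  by rewrite !big_seq; apply: ler_sum => D /hE.
rewrite big_split /= sumrN -mulr_sumr -!vsum_big in h1.
have h2 : vsum (fun t t' => \sum_(D <- Ds) chord D a t t') 0 E <= 2 * L.
  apply: le_trans (_ : vsum (fun t t' => 2 * N (a t' - a t)) 0 E <= _).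
    apply: vsum_le pE => t t' _ _ _; apply: le_trans (Dle _).
    by apply: ler_sum => D _; rewrite dotBr.
  rewrite (_ : vsum _ 0 E = 2 * vsum (fun t t' => N (a t' - a t)) 0 E).
    by rewrite ler_pM2l //; exact: hL.
  by elim: (E) (0) => [|z' r2 IH] y' /=; rewrite ?mulr0 // IH; ring.
have h3 := ler_wpM2l (ltW l0) (hP Dle).
lin.
Qed.

End UpperBound.

(** * The gauge of an oval *)

Section Gauge.
Context {R : realType} (z : plane R) (B : set (plane R)).
Hypothesis oB : symmetric_oval z B.
Implicit Types (x y v : plane R) (r t : R).

Local Notation N := (normB z B).
Local Notation S := (fun x => [set t | 0 < t /\ B (z + t^-1 *: x)]).

Let cB x y r : B x -> B y -> 0 <= r <= 1 -> B ((1 - r) *: x + r *: y).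
Proof. by have [_ [/convex_setE h _] _] := oB; exact: h. Qed.

(** [z + x] is the midpoint of [y + 2 *: x], near the interior point [y], and of the reflection of
    [y] in the center. *)
Lemma center_ball : exists2 r, 0 < r & forall x, `|x| < r -> B (z + x).
Proof.
have [_ [_ [y /interiorP_eps[r r0 hr]]] sB] := oB.
have By : B y by apply: hr; rewrite subrr normr0.
exists (r / 2); first by lin.
move=> x xr; have B1 : B (y + 2 *: x).
  by apply: hr; rewrite addrC addKr normrZ ger0_norm //; lin.
have h : 0 <= (1 / 2 : R) <= 1 by apply/andP; split; lin.
have := cB B1 (sB y By) h; congr B.
rewrite -mulr_natr; apply: plane_eqP; rewrite !mxE; lin.
Qed.

Lemma oval_bounded : exists2 M, 0 < M & forall x, B x -> `|x - z| <= M.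
Proof.
have [cB' _ _] := oB; have [M [_ hM]] := compact_bounded cB'.
pose M' := `|M| + 1; have M1 : M < M' by have := ler_norm M; rewrite /M'; lin.
exists (M' + `|z| + 1); first by have := normr_ge0 M; have := normr_ge0 z; rewrite /M'; lin.
move=> x /(hM _ M1) /= h; apply: le_trans (ler_normB _ _) _; rewrite -addrA; apply: lerD => //.
by rewrite lerDl.
Qed.

Lemma gauge_up x t t' : S x t -> t <= t' -> S x t'.
Proof.
move=> [t0 Bt] tt; have t'0 : 0 < t' := lt_le_trans t0 tt; split => //.
have Bz : B z by have [r r0 hr] := center_ball; have := hr 0; rewrite normr0 addr0; exact.
have h : 0 <= t / t' <= 1 by apply/andP; split; [apply: divr_ge0; exact: ltW|rewrite ler_pdivrMr // mul1r].
have := cB Bz Bt h; congr B.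
rewrite scalerDr scalerA mulrAC mulfV ?gt_eqF // mul1r; vec.
Qed.

Lemma gauge_small : exists2 C, 0 < C & forall x t, 0 < t -> C * `|x| <= t -> S x t.
Proof.
have [r r0 hr] := center_ball; exists (2 / r); first by rewrite divr_gt0.
move=> x t t0 xt; split => //; apply: hr; rewrite normrZ gtr0_norm ?invr_gt0 //.
rewrite ltr_pdivrMl //; move: xt; rewrite mulrAC ler_pdivrMr //.
have := mulr_gt0 t0 r0; lin.
Qed.

Lemma gauge_large : exists2 C, 0 < C & forall x t, S x t -> `|x| <= C * t.
Proof.
have [M M0 hM] := oval_bounded; exists M => // x t [t0 /hM].
by rewrite addrC addKr normrZ gtr0_norm ?invr_gt0 // ler_pdivrMl // mulrC.
Qed.

Let S0 x : S x !=set0.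
Proof.
have [C C0 hC] := gauge_small; exists (C * `|x| + 1).
by apply: hC; have := mulr_ge0 (ltW C0) (normr_ge0 x); lin.
Qed.

Lemma gauge_le x t : S x t -> N x <= t.
Proof. by move=> h; apply: ge_inf => //; exists 0 => r [/ltW]. Qed.

Lemma gauge_lt x t : N x < t -> S x t.
Proof. by move=> /(inf_lt (S0 x))[r Sr rt]; apply: gauge_up Sr (ltW rt). Qed.

Lemma gauge_ge x r : (forall t, S x t -> r <= t) -> r <= N x.
Proof. by move=> h; apply: lb_le_inf. Qed.

Lemma gauge_add x y s t : S x s -> S y t -> S (x + y) (s + t).
Proof.
move=> [s0 Bs] [t0 Bt]; split; first exact: addr_gt0.
have st : 0 < s + t by exact: addr_gt0.
have h : 0 <= t / (s + t) <= 1 by apply/andP; split; [apply: divr_ge0; exact: ltW|rewrite ler_pdivrMr // mul1r lerDr ltW].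
have := cB Bs Bt h; congr B.
have -> : 1 - t / (s + t) = s / (s + t) by field; rewrite gt_eqF.
rewrite !scalerDr !scalerA !(mulrAC _ (s + t)^-1) !mulfV ?gt_eqF // !mul1r addrACA -scalerDl -mulrDl mulfV ?gt_eqF //.
by rewrite scale1r.
Qed.

Lemma gauge_scale c x t : 0 < c -> S x t -> S (c *: x) (c * t).
Proof.
move=> c0 [t0 Bt]; split; first exact: mulr_gt0.
by rewrite scalerA invfM mulrAC mulVf ?gt_eqF // mul1r.
Qed.

Lemma gauge_opp x t : S x t -> S (- x) t.
Proof.
move=> [t0 Bt]; split => //; have [_ _ sB] := oB; have := sB _ Bt; congr B.
rewrite mulr2n; vec.
Qed.

Lemma normB_is_norm : is_norm N.
Proof.
have tri x y : N (x + y) <= N x + N y.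
  apply/ler_addgt0Pr => e e0; have e2 : 0 < e / 2 by lin.
  have h1 : S x (N x + e / 2) by apply: gauge_lt; lin.
  have h2 : S y (N y + e / 2) by apply: gauge_lt; lin.
  have := gauge_le (gauge_add h1 h2); lin.
have sc c x : 0 < c -> N (c *: x) = c * N x.
  move=> c0; apply/eqP; rewrite eq_le; apply/andP; split.
    rewrite -ler_pdivrMl //; apply: gauge_ge => t /(gauge_scale c0)/gauge_le h.
    by rewrite ler_pdivrMl.
  apply: gauge_ge => t St; have ci : 0 < c^-1 by rewrite invr_gt0.
  have := gauge_le (gauge_scale ci St); rewrite scalerA mulVf ?gt_eqF // scale1r.
  by rewrite ler_pdivlMl.
have op x : N (- x) = N x.
  have h y : N (- y) <= N y by apply: gauge_ge => t /gauge_opp/gauge_le.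
  by apply/eqP; rewrite eq_le h -{1}(opprK x) h.
have ge0 x : 0 <= N x by apply: gauge_ge => t [/ltW].
have z0 : N 0 = 0.
  apply/eqP; rewrite eq_le ge0 andbT; apply/ler_addgt0Pr => e e0; rewrite add0r.
  have [C C0 hC] := gauge_small; apply/gauge_le/hC => //; rewrite normr0 mulr0; exact: ltW.
split => //.
- move=> c x; case: (ltrgtP c 0) => [c0|c0|->].
  + by rewrite ltr0_norm // -[in LHS](opprK c) scaleNr op sc // oppr_gt0.
  + by rewrite gtr0_norm // sc.
  + by rewrite scale0r normr0 mul0r.
- have [C C0 hC] := gauge_small; have [M M0 hM] := gauge_large.
  exists (C + M); first by lin.
  move=> x; split.
    apply/ler_addgt0Pr => e e0; apply: gauge_le; apply: hC.
      by have := mulr_ge0 (ltW C0) (normr_ge0 x); have := mulr_ge0 (ltW M0) (normr_ge0 x); lin.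
    by have := mulr_ge0 (ltW M0) (normr_ge0 x); lin.
  apply: le_trans (_ : M * N x <= _); last by have := mulr_ge0 (ltW C0) (ge0 x); lin.
  by rewrite -ler_pdivrMl //; apply: gauge_ge => t /hM; rewrite ler_pdivrMl.
Qed.

Let hN := normB_is_norm.

Lemma ovalE x : B x <-> N (x - z) <= 1.
Proof.
split=> [Bx|h].
  by apply: gauge_le; split => //; rewrite invr1 scale1r subrKC.
have [cB' _ _] := oB; apply: contrapT => /(compact_norm_closed hN cB')[d d0 hd].
pose e := d / 2; have [e0 ed] : 0 < e /\ e < d by rewrite /e; split; lin.
have [] := @gauge_lt (x - z) (1 + e); first by lin.
move=> p; apply: hd; have -> : z + (1 + e)^-1 *: (x - z) - x = - (e / (1 + e)) *: (x - z).
  apply: (scalerI (_ : 1 + e != 0)); first by rewrite gt_eqF.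
  rewrite scalerBr scalerDr !scalerA mulrN mulrCA mulfV ?gt_eqF // mulr1 scale1r; vec.
rewrite scaleNr (normN hN) (normZp hN) ?divr_ge0 ?ltW //.
have : e / (1 + e) * N (x - z) <= e / (1 + e) * 1 by rewrite ler_wpM2l // divr_ge0 // ltW.
have : e / (1 + e) <= e by rewrite ler_pdivrMr //; have := mulr_gt0 e0 e0; lin.
lin.
Qed.

End Gauge.

Section Balls.
Context {R : realType} (N : plane R -> R) (hN : is_norm N).
Implicit Types (x y c : plane R) (r : R) (K : set (plane R)).

Lemma interior_normE K x : interior K x <-> exists2 d, 0 < d & forall y, N (y - x) < d -> K y.
Proof.
split=> [/interiorP_eps [d d0 hd]|[d d0 hd]].
  by have [e e0 he] := norm_to_std hN d0; exists e => // y /he; exact: hd.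
by apply/interiorP_eps; have [e e0 he] := std_to_norm hN d0; exists e => // y /he; exact: hd.
Qed.

Lemma ball_interior K c r : 0 < r -> (forall x, K x <-> N (x - c) <= r) ->
  forall x, interior K x <-> N (x - c) < r.
Proof.
move=> r0 hK x; split=> [/interior_normE[d d0 hd]|h].
  have /hK : K x by apply: hd; rewrite subrr (norm0 hN).
  rewrite le_eqVlt => /orP[/eqP e|//].
  pose m := d / (2 * r); have m0 : 0 < m by rewrite divr_gt0 // mulr_gt0.
  have /hK : K (x + m *: (x - c)).
    apply: hd; rewrite addrC addKr (normZp hN _ (ltW m0)) e.
    have -> : m * r = d / 2 by rewrite /m; field; rewrite gt_eqF.
    lin.
  have -> : x + m *: (x - c) - c = (1 + m) *: (x - c) by vec.
  have m1 : 0 <= 1 + m by lin.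
  by rewrite (normZp hN _ m1) e; have := mulr_gt0 m0 r0; lin.
apply/interior_normE; exists (r - N (x - c)); first by rewrite subr_gt0.
by move=> y hy; apply/hK; have := norm_triB hN y x c; lin.
Qed.

Lemma ball_boundary K c r : 0 < r -> (forall x, K x <-> N (x - c) <= r) ->
  forall x, boundary K x <-> N (x - c) = r.
Proof.
move=> r0 hK x; have hi := ball_interior r0 hK x.
have hc : closure K x <-> K x.
  split; last exact: subset_closure.
  move=> /closureP_eps h; apply/hK; apply/ler_addgt0Pr => e /(std_to_norm hN)[d d0 hd].
  have [y /hK Ky /hd yx] := h d d0; have := norm_triB hN x y c; rewrite (normC hN x y); lin.
split=> [[/hc/hK le ni]|e].
  by apply/eqP; rewrite eq_le le leNgt; apply/negP => /hi.
by split; [apply/hc/hK; rewrite e|move/hi; rewrite e ltxx].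
Qed.

End Balls.

Lemma uniform_cont_itv {R : realType} (N : plane R -> R) (hN : is_norm N) (g : R -> plane R) :
  {within `[0, 1], continuous g} -> forall e, 0 < e -> exists2 d, 0 < d &
    forall t t', 0 <= t <= 1 -> 0 <= t' <= 1 -> `|t - t'| < d -> N (g t - g t') < e.
Proof.
move=> /withinP_eps cg e e0.
have cg' t : 0 <= t <= 1 -> forall e, 0 < e -> exists2 d, 0 < d & forall t', 0 <= t' <= 1 -> `|t' - t| < d -> N (g t' - g t) < e.
  move=> tI e' /(std_to_norm hN)[d d0 hd]; have [|d' d'0 hd'] := cg t _ d d0; first by rewrite /= in_itv.
  by exists d' => // t' t'I /hd' h; apply/hd/h; rewrite /= in_itv.
have cK : compact (`[(0 : R), 1] `*` `[(0 : R), 1])%classic by apply: compact_setX; exact: segment_compact.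
pose f (p : R * R) := `|p.1 - p.2|; pose h (p : R * R) := N (g p.1 - g p.2).
have [[x y] [/=]||[x y] _ /eqP|m m0 hm] := @compact_modulus R _ _ f h e cK.
- rewrite !in_itv /= => xI yI r r0; have r2 : 0 < r / 2 by lin.
  have [d1 d10 h1] := cg' x xI _ r2; have [d2 d20 h2] := cg' y yI _ r2.
  exists (Num.min (Num.min d1 d2) (r / 2)); first by rewrite !lt_min d10 d20.
  move=> [x' y'] [/=]; rewrite !in_itv /= => x'I y'I; rewrite prod_normE gt_max /= !lt_min.
  move=> /andP[/andP[/andP[/(h1 _ x'I) k1 _] k2] /andP[/andP[_ /(h2 _ y'I) k3] k4]].
  split; last by apply: le_lt_trans (norm_dist2 hN _ _ _ _) _; lin.
  apply: le_lt_trans (ler_dist_dist _ _) _.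
  have -> : x' - y' - (x - y) = (x' - x) - (y' - y) by ring.
  by apply: le_lt_trans (ler_normB _ _) _; lin.
- by move=> p _; exact: normr_ge0.
- by rewrite normr_eq0 subr_eq0 /h => /eqP /= ->; rewrite subrr (norm0 hN).
exists m => // t t' tI t'I; apply: (hm (t, t')); split; by rewrite /= in_itv.
Qed.

Lemma int_between (k : int) : -1 < k -> k < 2 -> k = 0 \/ k = 1.
Proof. lia. Qed.

Section CircleParam.
Context {R : realType} (N : plane R -> R) (hN : is_norm N) (g : R -> plane R) (J : set (plane R)).
Hypothesis hg : simple_closed_param g J.
Implicit Types (t r : R) (n m : int).

Definition circle_param t := g (t - (Num.floor t)%:~R).
Local Notation a := circle_param.

Lemma circle_paramE r n : 0 <= r < 1 -> a (r + n%:~R) = g r.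
Proof.
move=> /andP[r0 r1]; rewrite /a (_ : Num.floor (r + n%:~R) = n) ?addrK //.
by apply: floor_def; rewrite intrD1; apply/andP; split; lin.
Qed.

Lemma circle_rep t : exists r n, 0 <= r < 1 /\ t = r + n%:~R.
Proof.
have [n] := param_shift 0 t; rewrite add0r => h; exists (t + n%:~R), (- n); split => //.
by rewrite mulrNz addrK.
Qed.

Lemma circle_param01 t : 0 <= t <= 1 -> a t = g t.
Proof.
move=> /andP[t0]; rewrite le_eqVlt => /orP[/eqP ->|t1]; last first.
  by rewrite -[t]addr0 -[X in a X]/(t + 0%:~R) circle_paramE ?t0 ?addr0.
have [_ <- _] := hg; rewrite -[X in a X]add0r -[X in a X]/(0 + 1%:~R) circle_paramE //.
by rewrite lexx ltr01.
Qed.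

Lemma circle_param_per : periodic a.
Proof.
move=> t n; have [r [m [rI ->]]] := circle_rep t.
by rewrite -addrA -intrD !circle_paramE.
Qed.

Lemma circle_param_inj t t' : 0 < t' - t < 1 -> a t <> a t'.
Proof.
have [r [m [rI ->]]] := circle_rep t; have [r' [m' [r'I ->]]] := circle_rep t'.
rewrite !circle_paramE // => h e; have [[_ inj] _ _] := hg.
have [r0 r1] := andP rI; have [r'0 r'1] := andP r'I.
have I1 : r \in `[0, 1] by rewrite in_itv /= r0 ltW.
have I2 : r' \in `[0, 1] by rewrite in_itv /= r'0 ltW.
have [lt|lt|er] := ltgtP r r'.
- by have [_ h1] := inj _ _ I1 I2 lt e; lin.
- by have [_ h1] := inj _ _ I2 I1 lt (esym e); lin.
move: h; rewrite er opprD addrACA subrr add0r -intrB ltr0z ltrz1 => /andP[h1 h2].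
by have [e'|e'] := int_between (lt_trans (isT : -1 < 0 :> int) h1) (lt_trans h2 (isT : 1 < 2 :> int)); rewrite e' in h1 h2.
Qed.

Lemma circle_param_trace p : J p <-> exists t, a t = p.
Proof.
have [_ _ <-] := hg; split=> [[t]|[t <-]].
  by rewrite /= in_itv /= => tI <-; exists t; exact: circle_param01.
have [r [n [/andP[r0 r1] ->]]] := circle_rep t; rewrite circle_paramE ?r0 //.
by exists r => //; rewrite /= in_itv /= r0 ltW.
Qed.

Lemma circle_param_cont : unif_cont N a.
Proof.
have [[cg _] g01 _] := hg; move=> e e0; have e2 : 0 < e / 2 by lin.
have [d d0 hd] := uniform_cont_itv hN cg e2.
have I0 : 0 <= (0 : R) <= 1 by rewrite lexx ler01.
have I1 : 0 <= (1 : R) <= 1 by rewrite lexx ler01.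
have key t t' : t <= t' -> t' - t < Num.min d (1 / 2) -> N (a t - a t') < e.
  have [r [m [rI ->]]] := circle_rep t; have [r' [m' [r'I ->]]] := circle_rep t'.
  rewrite !circle_paramE // lt_min; have [r0 r1] := andP rI; have [r'0 r'1] := andP r'I.
  have J1 : 0 <= r <= 1 by rewrite r0 ltW.
  have J2 : 0 <= r' <= 1 by rewrite r'0 ltW.
  move=> tt /andP[h1 h2].
  have [mm|mm] : m' = m \/ m' = m + 1.
    have b1 : (m' - m)%:~R < 2%:~R :> R by rewrite intrB; lin.
    have b2 : - 1%:~R < (m' - m)%:~R :> R by rewrite intrB; lin.
    rewrite ltr_int in b1; rewrite -mulrNz ltr_int in b2.
    by have [/eqP|e1] := int_between b2 b1; [rewrite subr_eq0 => /eqP; left|right; rewrite -e1 subrKC].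
  - rewrite mm in tt h1; apply: lt_trans (hd r r' J1 J2 _) _; last by lin.
    by rewrite ler0_norm; lin.
  - rewrite mm intrD in tt h1; have k1 : N (g r - g 1) < e / 2.
      by apply: hd => //; rewrite ler0_norm; lin.
    have k2 : N (g 0 - g r') < e / 2 by apply: hd => //; rewrite ler0_norm; lin.
    have := norm_triB hN (g r) (g 1) (g r'); rewrite -{2}g01; lin.
exists (Num.min d (1 / 2)); first by rewrite lt_min d0; lin.
move=> t t' h; have [tt|tt] := lerP t t'.
  by apply: key => //; move: h; rewrite distrC ger0_norm // subr_ge0.
by rewrite (normC hN); apply: key; [exact: ltW|move: h; rewrite ger0_norm // subr_ge0 ltW].
Qed.

End CircleParam.

Lemma tube_exists {R : realType} (N : plane R -> R) (hN : is_norm N) (F : set (plane R)) (s : R) (g : R -> plane R) :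
  compact F -> simple_closed_param g (boundary F) -> 0 < s ->
  (forall x, dist N (boundary F) x < s -> forall p q, boundary F p -> boundary F q ->
     N (x - p) = dist N (boundary F) x -> N (x - q) = dist N (boundary F) x -> p = q) ->
  (forall p e, boundary F p -> 0 < e -> exists y, [/\ F y, ~ boundary F y & N (y - p) < e]) ->
  exists u, tube N F s (circle_param g) u.
Proof.
move=> cF hg s0 uniq inner.
have J0 : (boundary F !=set0)%classic.
  by exists (circle_param g 0); apply/(circle_param_trace hg); exists 0.
have [n [h1 h2 h3 h4 h5]] := normal_exists hN cF J0 uniq inner s0.
have Ja t : boundary F (circle_param g t) by apply/(circle_param_trace hg); exists t.
exists (fun t => n (circle_param g t)); split => //.
- exact: (circle_param_trace hg).
- exact: (circle_param_cont hN hg).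
- exact: (circle_param_per g).
- exact: (circle_param_inj hg).
- move=> e /h5[d d0 hd]; have [d' d'0 hd'] := circle_param_cont hN hg d0.
  by exists d' => // t t' /hd'; exact: hd.
- by move=> t m; rewrite (circle_param_per g).
- by move=> t; exact: h1.
- by move=> t r; exact: h2.
- by move=> t r; exact: h3.
- move=> x t nF xs e; have := h4 x nF xs.
  by rewrite (foot_unique hN (compact_boundary cF) J0 uniq xs (Ja t) e).
Qed.

(** * Lengths and packings *)

Section Lengths.
Context {R : realType} (z : plane R) (B : set (plane R)).
Hypothesis oB : symmetric_oval z B.
Implicit Types (g : R -> plane R) (s E : seq R).
Local Notation N := (normB z B).
Let hN : is_norm N := normB_is_norm oB.

Lemma length_sum g s : \sum_(0 <= n < size s) distB z B (g (nth 1 (0 :: s) n.+1)) (g (nth 1 (0 :: s) n)) =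
  vsum (fun t t' => N (g t' - g t)) 0 s.
Proof. by rewrite (vsum_nth 1). Qed.

Lemma length_ge g s : path <%R 0 s -> last 0 s = 1 ->
  ((vsum (fun t t' => N (g t' - g t)) 0 s)%:E <= lengthB z B g)%E.
Proof.
move=> p l; rewrite -length_sum; apply: ereal_sup_ubound; exists s => //.
by split => //; apply/eqP.
Qed.

Lemma length_le g (M : R) : (forall s, path <%R 0 s -> last 0 s = 1 ->
  vsum (fun t t' => N (g t' - g t)) 0 s <= M) -> (lengthB z B g <= M%:E)%E.
Proof.
move=> h; apply: ge_ereal_sup => _ [s [p /eqP l] <-].
by rewrite lee_fin length_sum; exact: h.
Qed.

Lemma length_ge0 g : (0 <= lengthB z B g)%E.
Proof.
have p1 : path <%R 0 [:: 1 : R] by rewrite /= ltr01.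
apply: le_trans (length_ge g p1 erefl); rewrite lee_fin /= addr0; exact: norm_ge0.
Qed.

Lemma oval_boundaryE x : boundary B x <-> N (x - z) = 1.
Proof. by apply: (ball_boundary hN ltr01) => y; exact: ovalE. Qed.

Lemma path_through (d : R -> R -> R) (x y : R) : (forall t, d t t = 0) -> x <= y ->
  exists s, [/\ path <%R x s, last x s = y & d x y <= vsum d x s].
Proof.
move=> d0; rewrite le_eqVlt => /orP[/eqP <-|xy]; first by exists [::]; rewrite /= d0.
by exists [:: y]; rewrite /= xy addr0.
Qed.

(** The boundary contains [z + v] and [z - v] for a unit [v] at which [D] attains its dual norm. The
    closed curve passes from one to the other and back, each way changing [D] by at least twice that
    norm. *)
Lemma oval_variation g D : simple_closed_param g (boundary B) -> exists E, [/\ path <%R 0 E, last 0 E = 1 &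
  4 * dual_norm hN D <= vsum (fun t t' => `|dot D (g t') - dot D (g t)|) 0 E].
Proof.
move=> [_ g01 tr]; have [v v1 Dv] := dual_norm_ex hN D.
have tp : trace g (z + v) by rewrite tr; apply/oval_boundaryE; rewrite addrC addKr.
have tn : trace g (z - v) by rewrite tr; apply/oval_boundaryE; rewrite addrC addKr (normN hN).
move: tp tn => [p]; rewrite /= in_itv /= => /andP[p0 p1] gp [q]; rewrite /= in_itv /= => /andP[q0 q1] gq.
pose d t t' := `|dot D (g t') - dot D (g t)|.
have d0 t : d t t = 0 by rewrite /d subrr normr0.
have main x y : 0 <= x -> x <= y -> y <= 1 -> `|dot D (g y) - dot D (g x)| = 2 * dual_norm hN D ->
    exists E, [/\ path <%R 0 E, last 0 E = 1 & 4 * dual_norm hN D <= vsum d 0 E].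
  move=> x0 xy y1 e.
  have [s1 [h1 l1 v1']] := path_through d0 x0.
  have [s2 [h2 l2 v2]] := path_through d0 xy.
  have [s3 [h3 l3 v3]] := path_through d0 y1.
  exists (s1 ++ s2 ++ s3); split; first by rewrite !cat_path h1 l1 h2 l2.
    by rewrite !last_cat l1 l2.
  rewrite !vsum_cat l1 l2; rewrite /d g01 in v1' v2 v3; rewrite e in v2.
  have := ler_distD (dot D (g 1)) (dot D (g y)) (dot D (g x)); rewrite e (distrC _ (dot D (g 1))).
  rewrite /d (distrC _ (dot D (g 1))) in v1' *; lin.
have e : dot D (g p) - dot D (g q) = 2 * dual_norm hN D by rewrite gp gq dotDr dotBr Dv; ring.
have M0 := dual_norm_ge0 hN D.
have [pq|/ltW qp] := lerP p q.
  by apply: (main p q) => //; rewrite distrC e ger0_norm // mulr_ge0.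
by apply: (main q p) => //; rewrite e ger0_norm // mulr_ge0.
Qed.

(** Links the dual norms of a zonotope to the perimeter: on a common partition the variations of all
    the functionals along the oval are large, while their sum is at most twice the length. *)
Lemma perimeter_dual g : simple_closed_param g (boundary B) ->
  forall Ds : seq (plane R), (forall v, \sum_(D <- Ds) `|dot D v| <= 2 * N v) ->
  ((2 * \sum_(D <- Ds) dual_norm hN D)%:E <= lengthB z B g)%E.
Proof.
move=> hg Ds Dle; pose d D t t' := `|dot D (g t') - dot D (g t)|.
have [E [pE lE hE]] : exists E, [/\ path <%R 0 E, last 0 E = 1 & forall D, D \in Ds ->
    4 * dual_norm hN D <= vsum (d D) 0 E].
  apply: common_refinement => //.
  - by move=> D t; exact: chord_dot0.
  - by move=> D t t' t''; exact: chord_dot_tri.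
  - by move=> D _; exact: oval_variation.
apply: le_trans (length_ge g pE lE); rewrite lee_fin.
have h1 : \sum_(D <- Ds) 4 * dual_norm hN D <= \sum_(D <- Ds) vsum (d D) 0 E.
  by rewrite !big_seq; apply: ler_sum => D /hE.
have h2 : vsum (fun t t' => \sum_(D <- Ds) d D t t') 0 E <= vsum (fun t t' => 2 * N (g t' - g t)) 0 E.
  apply: vsum_le pE => t t' _ _ _; apply: le_trans (Dle _).
  by apply: ler_sum => D _; rewrite dotBr.
have h3 : vsum (fun t t' => 2 * N (g t' - g t)) 0 E = 2 * vsum (fun t t' => N (g t' - g t)) 0 E.
  by elim: (E) (0) => [|y r IH] x /=; rewrite ?mulr0 // IH; ring.
rewrite -mulr_sumr -vsum_big in h1; lin.
Qed.

End Lengths.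

Section Packing.
Context {R : realType} (z : plane R) (B F : set (plane R)) (s : R) (a u : R -> plane R).
Hypothesis oB : symmetric_oval z B.
Local Notation N := (normB z B).
Hypothesis T : tube N F s a u.
Variable lam : R.
Hypotheses (lam0 : 0 < lam) (lams : 2 * lam < s).
Implicit Types (x y p v : plane R) (t : R) (xs : seq R).
Let hN := tube_norm T.
Local Notation w := (outer_curve a u lam).
Local Notation J := (boundary F).

Lemma homothetE v y : [set v + lam *: b | b in B] y <-> N (y - (v + lam *: z)) <= lam.
Proof.
have E b : y = v + lam *: b -> N (y - (v + lam *: z)) = lam * N (b - z).
  by move=> ->; rewrite -(normZp hN _ (ltW lam0)); congr N; vec.
split=> [[b /(ovalE oB) Bb e]|h].
  by rewrite (E b (esym e)) -[leRHS]mulr1 ler_pM2l.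
have ey : y = v + lam *: (lam^-1 *: (y - v)) by rewrite scalerA mulfV ?gt_eqF // scale1r subrKC.
exists (lam^-1 *: (y - v)) => //; apply/(ovalE oB).
by rewrite (E _ ey) -[leRHS]mulr1 ler_pM2l in h.
Qed.

(** A center in [F] would be a common point inside [S], so the center is outside, at distance
    exactly [lam] from the boundary, and [tube_normal] puts it on the outer curve. Conversely [F]
    keeps distance [lam] from [w t], and a common point interior to [F] could be moved within [F]
    towards [w t]. *)
Lemma touching_ball (S : set (plane R)) c : (forall y, S y <-> N (y - c) <= lam) ->
  (S `&` F !=set0 /\ S `&` F `<=` boundary S `&` J) <-> exists2 t, 0 <= t < 1 & c = w t.
Proof.
move=> hS; have bS := ball_boundary hN lam0 hS; have ls := lams; have l0 := lam0.
have J0 := tube_J0 T; have cF := tube_compact T; have cJ := compact_boundary cF.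
split=> [[[p [Sp Fp]] sub]|[t tI ec]].
  have nF : ~ F c.
    move=> Fc; have Sc : S c by apply/hS; rewrite subrr (norm0 hN) ltW.
    by have [/bS] := sub c (conj Sc Fc); rewrite subrr (norm0 hN) => e; move: l0; rewrite -e ltxx.
  have [bp Jp] := sub p (conj Sp Fp); move/bS : bp => bp.
  have dc : dist N J c = lam.
    apply/eqP; rewrite eq_le -{1}bp (normC hN p c) (dist_le hN) //= leNgt; apply/negP => lt.
    have [q Jq eq] := dist_attained hN cJ J0 c.
    have Fq : F q by exact: ((boundaryE cF q).1 Jq).1.
    have Sq : S q by apply/hS; rewrite (normC hN) eq ltW.
    by have [/bS] := sub q (conj Sq Fq); rewrite (normC hN) eq => e; move: lt; rewrite e ltxx.
  have [q Jq eq] := dist_attained hN cJ J0 c.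
  have [t0 et0] := (tube_param T q).1 Jq; have [n nI] := param_shift 0 t0.
  exists (t0 + n%:~R); first by rewrite add0r in nI.
  rewrite (w_per T lam t0 n) /outer_curve -dc; apply: (tube_normal T) => //; last by rewrite et0.
  by rewrite dc; lin.
have aJ := tube_J T t; have aF : F (a t) by exact: ((boundaryE cF _).1 aJ).1.
have dc : dist N J c = lam by rewrite ec (w_dist T lam0 lams).
have out p : F p -> lam <= N (p - c).
  move=> Fp; rewrite leNgt -{1}dc; apply/negP => lt.
  by apply: (out_ball hN cF _ lt) Fp; rewrite ec; exact: (w_out T lam0 lams).
have ac : N (a t - c) = lam.
  by rewrite ec (normC hN) /outer_curve addrC addKr (normZp hN _ (ltW lam0)) (tube_unit T) mulr1.
have Sa : S (a t) by apply/hS; rewrite ac.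
split; first by exists (a t).
move=> p [/hS le Fp]; have e : N (p - c) = lam by apply/eqP; rewrite eq_le le out.
split; first exact/bS.
apply/(boundaryE cF); split => // /(interior_normE hN)[d d0 hd].
pose m := Num.min (d / (2 * lam)) 1 / 2.
have m1 : 0 < Num.min (d / (2 * lam)) 1 by rewrite lt_min ltr01 andbT divr_gt0 // mulr_gt0.
have [m2 m3] : Num.min (d / (2 * lam)) 1 <= d / (2 * lam) /\ Num.min (d / (2 * lam)) 1 <= 1.
  by rewrite !ge_min !lexx orbT.
have m0 : 0 < m by rewrite /m; lin.
have md : m * lam < d.
  by move: m2; rewrite ler_pdivlMr ?mulr_gt0 // /m; have := mulr_gt0 m1 l0; lin.
have m4 : 0 <= 1 - m by rewrite /m; lin.
have Fq : F (p + m *: (c - p)).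
  by apply: hd; rewrite addrC addKr (normZp hN _ (ltW m0)) (normC hN) e.
have := out _ Fq; have -> : p + m *: (c - p) - c = (1 - m) *: (p - c) by vec.
by rewrite (normZp hN _ m4) e; have := mulr_gt0 m0 l0; lin.
Qed.

Lemma touching_center (S : set (plane R)) : touching_homothets F B lam S ->
  exists t, 0 <= t < 1 /\ forall y, S y <-> N (y - w t) <= lam.
Proof.
move=> [[v ->] h1 h2]; have [t tI e] := (touching_ball (fun y => homothetE v y)).1 (conj h1 h2).
by exists t; split => // y; rewrite -e; exact: homothetE.
Qed.

Lemma center_touching t : exists2 S, touching_homothets F B lam S & forall y, S y <-> N (y - w t) <= lam.
Proof.
have hS y : [set (w t - lam *: z) + lam *: b | b in B] y <-> N (y - w t) <= lam.
  by rewrite -{2}(subrK (lam *: z) (w t)); exact: homothetE.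
exists [set (w t - lam *: z) + lam *: b | b in B] => //.
have [n nI] := param_shift 0 t; rewrite add0r in nI.
have [|h1 h2] := (touching_ball hS).2; last by split => //; exists (w t - lam *: z).
by exists (t + n%:~R) => //; rewrite (w_per T).
Qed.

Lemma disjoint_balls (S S' : set (plane R)) c c' : (forall y, S y <-> N (y - c) <= lam) ->
  (forall y, S' y <-> N (y - c') <= lam) ->
  interior S `&` interior S' = set0 <-> 2 * lam <= N (c - c').
Proof.
move=> hS hS'; have iS := ball_interior hN lam0 hS; have iS' := ball_interior hN lam0 hS'.
split=> [h|h].
  rewrite leNgt; apply/negP => lt; have : (interior S `&` interior S') (c + (1 / 2) *: (c' - c)).
    split; [apply/iS|apply/iS'].
      by rewrite addrC addKr (normZp hN) // (normC hN); lin.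
    have -> : c + (1 / 2) *: (c' - c) - c' = (1 / 2) *: (c - c').
      by apply: plane_eqP; rewrite !mxE; field.
    by rewrite (normZp hN) //; lin.
  by rewrite h.
apply/seteqP; split=> // y [/iS h1 /iS' h2].
by have := norm_triB hN c y c'; rewrite (normC hN c y) /=; lin.
Qed.

Lemma packable_times k : packable F B lam k -> exists xs, [/\ size xs = k, uniq xs,
  forall x : R, x \in xs -> 0 <= x < 1 &
  forall x y : R, x \in xs -> y \in xs -> x != y -> 2 * lam <= N (w x - w y)].
Proof.
move=> [S [tS dS]]; have [f hf] := choice (fun i => touching_center (tS i)).
have sep i j : i != j -> 2 * lam <= N (w (f i) - w (f j)).
  move=> ij; apply/(disjoint_balls (hf i).2 (hf j).2); apply: contrapT => /eqP/set0P h.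
  by move: ij; rewrite (dS i j) ?eqxx.
have injf : injective f.
  move=> i j e; apply/eqP; apply: contraT => /sep; rewrite e subrr (norm0 hN).
  by have := lam0; lin.
exists [seq f i | i : 'I_k]; split.
- by rewrite size_map size_enum_ord.
- by rewrite map_inj_uniq ?enum_uniq.
- by move=> x /mapP[i _ ->]; have [] := hf i.
- move=> x y /mapP[i _ ->] /mapP[j _ ->] ne; apply: sep.
  by apply: contraNneq ne => ->.
Qed.

Lemma times_packable xs : pairwise (fun x y : R => 2 * lam <= N (w x - w y)) xs -> packable F B lam (size xs).
Proof.
move=> /(pairwiseP 0) sep; have [S hS] := choice (fun t => ltac:(
  by have [S tS hS] := center_touching t; exists S) : exists S, touching_homothets F B lam S /\ forall y, S y <-> N (y - w t) <= lam).
exists (fun i => S (nth 0 xs i)); split; first by move=> i; have [] := hS (nth 0 xs i).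
have dis (i j : 'I_(size xs)) : (i < j)%N -> interior (S (nth 0 xs i)) `&` interior (S (nth 0 xs j)) = set0.
  move=> ij; apply/(disjoint_balls (hS (nth 0 xs i)).2 (hS (nth 0 xs j)).2).
  by apply: sep; rewrite ?inE.
move=> i j _ _ [y yij]; apply/val_inj => /=; have [ij|ij|//] := ltngtP (i : nat) j.
  by move: yij; rewrite (dis _ _ ij).
by move: yij; rewrite setIC (dis _ _ ij).
Qed.

(** Two times of a packing cannot lie in one of the [m] equal subintervals of the period, since
    closeness in time would bring the centers closer than [2 * lam]. *)
Lemma packing_number_exists : exists n, is_packing_number F B lam n.
Proof.
have l2 : 0 < 2 * lam by have := lam0; lin.
have [d d0 hd] := w_cont T lam0 l2.
pose m := Num.bound d^-1.
have hm : d^-1 < m%:R by apply: archi_boundP; rewrite invr_ge0 ltW.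
have m0 : 0 < m%:R :> R by apply: le_lt_trans hm; rewrite invr_ge0 ltW.
have ub k : packable F B lam k -> (k <= m)%N.
  move=> /packable_times[xs [<- uxs rng sep]].
  pose f (x : R) := Num.truncn (x * m%:R).
  have trn (x : R) : x \in xs -> (f x)%:R <= x * m%:R < (f x)%:R + 1.
    move=> /rng /andP[x0 _]; rewrite natr1; apply: truncn_itv.
    by rewrite mulr_ge0 // ltW.
  rewrite -(size_map f xs) -(size_iota 0 m); apply: uniq_leq_size.
    rewrite map_inj_in_uniq // => x y xx yx e; apply/eqP; apply: contraT => ne.
    have := sep x y xx yx ne; rewrite leNgt => /negP; case; apply: hd.
    apply: lt_trans (_ : m%:R^-1 < d); last by rewrite -[ltRHS]invrK ltf_pV2 ?posrE ?invr_gt0.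
    rewrite -(ltr_pM2r m0) mulVf ?gt_eqF // -{1}(ger0_norm (ltW m0)) -normrM mulrBl.
    have /andP[x1 x2] := trn x xx; have /andP[y1 y2] := trn y yx; rewrite e in x1 x2.
    by rewrite ltr_norml; apply/andP; split; lin.
  move=> _ /mapP[x xx ->]; rewrite mem_iota add0n leq0n /= -(ltr_nat R).
  have /andP[x1 _] := trn x xx; apply: le_lt_trans x1 _.
  by rewrite -[ltRHS]mul1r ltr_pM2r //; have /andP[] := rng x xx.
have ex : exists n, `[< packable F B lam n >].
  by exists 0%N; apply/asboolP; exists (fun _ => set0); split => [[]|[]].
have ubb n : `[< packable F B lam n >] -> (n <= m)%N by move=> /asboolP; exact: ub.
case: (ex_maxnP ex ubb) => n /asboolP pn hn; exists n; split => // k pk.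
by apply: hn; apply/asboolP.
Qed.

End Packing.

Lemma topological_disk_compact {R : realType} (F : set (plane R)) : closed_topological_disk F -> compact F.
Proof.
move=> [f [_ [[ff _ sf] _ cf _]]].
have -> : F = f @` closed_unit_disk.
  by apply/seteqP; split=> [y /sf[x Dx <-]|_ [x Dx <-]]; [exists x|exact: ff].
apply: continuous_compact cf _; apply: bounded_closed_compact.
  exists 1; split; first exact: num_real.
  move=> r r1 x; rewrite /closed_unit_disk /= => hx.
  rewrite /Num.Def.normr /= mx_normrE; apply/bigmax_leP; split; first by lin.
  move=> [i j] _ /=; rewrite ord1; apply: le_trans (ltW r1).
  rewrite -(@ler_pXn2r _ 2) ?nnegrE // -normrX expr1n ger0_norm ?sqr_ge0 //.
  have s0 := sqr_ge0 (x 0 0); have s1 := sqr_ge0 (x 0 1).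
  case: j => -[|[|//]] jlt.
    by rewrite (_ : Ordinal jlt = 0); [lin|exact: val_inj].
  by rewrite (_ : Ordinal jlt = 1); [lin|exact: val_inj].
apply/closedP_eps => x; rewrite /closed_unit_disk /= => /negP; rewrite -ltNge => hx.
pose M := `|x 0 0| + `|x 0 1| + 1.
have n0 := normr_ge0 (x 0 0); have n1 := normr_ge0 (x 0 1).
have M0 : 0 < M by rewrite /M; lin.
pose q := x 0 0 ^+ 2 + x 0 1 ^+ 2 - 1.
exists (q / (2 * M)); first by rewrite divr_gt0 ?mulr_gt0 // subr_gt0.
move=> y; rewrite ltr_pdivlMr ?mulr_gt0 // => hy; apply/negP; rewrite -ltNge.
have coord (i : 'I_2) : `|y 0 i - x 0 i| <= `|y - x|.
  rewrite [leRHS]/Num.Def.normr /= mx_normrE; apply/bigmax_geP; right.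
  by exists (0, i) => //=; rewrite !mxE.
have low (i : 'I_2) : x 0 i ^+ 2 - 2 * (`|x 0 i| * `|y - x|) <= y 0 i ^+ 2.
  have h : - (x 0 i * (y 0 i - x 0 i)) <= `|x 0 i| * `|y - x|.
    by apply: le_trans (ler_norm _) _; rewrite normrN normrM ler_wpM2l.
  have := sqr_ge0 (y 0 i - x 0 i); rewrite sqrrB; move: h; rewrite mulrBr !expr2; lin.
have := low 0; have := low 1; have := normr_ge0 (y - x).
move: hy; rewrite /q /M; set r := `|y - x|; clearbody r; lin.
Qed.

Theorem proposition7 (R : realType) (z : plane R) (B F : set (plane R))
    (c d : nat) (gF gB : R -> plane R) :
  symmetric_oval z B ->
  closed_topological_disk F ->
  regular F c d ->
  (0 < reach z B (boundary F))%E ->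
  simple_closed_param gF (boundary F) ->
  simple_closed_param gB (boundary B) ->
  forall lambda : R, 0 < lambda ->
  ((2 * lambda)%:E < reach z B (boundary F))%E ->
  exists N : nat,
    [/\ is_packing_number F B lambda N,
        (lengthB z B gF
          - (2 * lambda)%:E * ((2 * c%:R)%:E + lengthB z B gB * (d%:R)%:E
                               + (3 * d%:R)%:E)
         <= (2 * lambda * N%:R)%:E)%E &
        ((2 * lambda * N%:R)%:E
         <= lengthB z B gF + (2 * lambda)%:E * lengthB z B gB)%E].
Proof.
move=> oB dF [g hg] _ hF hB lam lam0 /ereal_sup_gt[e [_ he] lame].
have hN := normB_is_norm oB; have cF := topological_disk_compact dF.
(* The witness [e] of the supremum may be infinite; the tube needs a real radius. *)
have [s lams se] : exists2 s : R, 2 * lam < s & (s%:E <= e)%E.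
  case: e {he} lame => [r|_|//]; first by rewrite lte_fin; exists r.
  by exists (2 * lam + 1); [lin|exact: leey].
have uniq_foot x : dist (normB z B) (boundary F) x < s -> forall p q, boundary F p -> boundary F q ->
    normB z B (x - p) = dist (normB z B) (boundary F) x ->
    normB z B (x - q) = dist (normB z B) (boundary F) x -> p = q.
  move=> xs p q Jp Jq ep eq; have [|r [_ hr]] := he x.
    by apply: lt_le_trans se; rewrite lte_fin.
  by rewrite -(hr p (conj Jp ep)) -(hr q (conj Jq eq)).
have s0 : 0 < s by lin.
have [u T] := tube_exists hN cF hF s0 uniq_foot (inner_near_pieces hN hg).
set a := circle_param gF in T.
have sumE E : path <%R 0 E -> last 0 E = 1 ->
    vsum (fun t t' => normB z B (a t' - a t)) 0 E = vsum (fun t t' => normB z B (gF t' - gF t)) 0 E.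
  move=> pE lE; have aE t : t \in 0 :: E -> a t = gF t.
    by move=> /(path_mem_ge pE); rewrite lE => /(circle_param01 hF).
  by apply/eqP; rewrite eq_le !vsum_le // => t t' _ tE t'E; rewrite !aE.
have dual P : lengthB z B gB = P%:E -> forall Ds : seq (plane R),
    (forall v, \sum_(D <- Ds) `|dot D v| <= 2 * normB z B v) ->
    2 * \sum_(D <- Ds) dual_norm (tube_norm T) D <= P.
  (* [dual_norm] takes the proof that [N] is a norm as an argument, and the two proofs at hand are
     equal by irrelevance. *)
  move=> eP Ds Dle; rewrite (Prop_irrelevance (tube_norm T) (normB_is_norm oB)).
  by have := perimeter_dual oB hB Dle; rewrite eP lee_fin.
have gF0 := length_ge0 oB gF; have gB0 := length_ge0 oB gB.
have [n np] := packing_number_exists oB T lam0 lams; exists n; split => //; have [pn maxn] := np.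
  have low P : ((0 < d)%N -> forall Ds : seq (plane R),
      (forall v, \sum_(D <- Ds) `|dot D v| <= 2 * normB z B v) ->
      2 * \sum_(D <- Ds) dual_norm (tube_norm T) D <= P) ->
      exists2 L, lengthB z B gF = L%:E &
        L - 2 * lam * (2 * c%:R + P * d%:R + 3 * d%:R) <= 2 * lam * n%:R.
    move=> hP; have [xs sep len] := lower_bound hg lam0 lams hP.
    have szn : (size xs)%:R <= n%:R :> R by rewrite ler_nat maxn //; exact: (times_packable oB T lam0 lams sep).
    have := length_le (fun E pE lE => eq_rect _ (fun r => is_true (r <= _)) (len E pE lE) _ (sumE E pE lE)).
    move: gF0; case: (lengthB z B gF) => [L| |] // _; rewrite lee_fin => hL; exists L => //.
    (* The pieces cost [4 * lam] times [c + d], plus [2 * lam * P * d], which is [2 * lam * d] less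
       than claimed. *)
    have l2 : 0 <= 2 * lam by lin.
    have := ler_wpM2l l2 szn; have := mulr_ge0 l2 (ler0n R d); lin.
  move: gB0; case eB : (lengthB z B gB) => [P| |] // _.
    by have [L -> hL] := low P (fun _ => dual P eB); rewrite -!EFinM -!EFinD.
  (* For an infinite perimeter, either [d = 0], the product with it is 0 and the bound is taken with
     [P = 0], or the left side is minus infinity. *)
  have [d0|d0] := posnP d.
    have [|L -> hL] := low 0; first by rewrite d0.
    by move: hL; rewrite d0 mule0 mul0r -!EFinD.
  rewrite gt0_mulye ?lte_fin ?ltr0n // addey // addye // gt0_muley ?lte_fin ?mulr_gt0 //.
  by rewrite addeNy leNye.
have [xs [sz uxs rng sep]] := packable_times oB T lam0 lams pn.
move: gB0; case eB : (lengthB z B gB) => [P| |] // gB0; last first.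
  by rewrite gt0_muley ?lte_fin ?mulr_gt0 // addey ?leey //; case: (lengthB z B gF) gF0.
move: gF0; case eF : (lengthB z B gF) => [L| |] // _; last by rewrite -EFinM addye // leey.
have hL E : path <%R 0 E -> last 0 E = 1 -> vsum (fun t t' => normB z B (a t' - a t)) 0 E <= L.
  by move=> pE lE; rewrite sumE // -lee_fin -eF; exact: length_ge.
have := upper_bound lam0 lams (dual P eB) hL uxs rng sep.
(* The bound obtained exceeds the length by [lam] times the perimeter only, half of what is
   claimed. *)
rewrite sz -EFinM -EFinD lee_fin; rewrite lee_fin in gB0.
have := mulr_ge0 (ltW lam0) gB0; lin.
Qed.
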